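(* Let $x,\alpha>0$ and let $\mu$ be a real number with $\mu<\frac12$. Then $$\Gamma^{2}\left(\tfrac12-\mu\right)W_{\mu,0}(x)+2\sum_{n=1}^{\infty}\left|\Gamma\left(\tfrac12-\mu+i\alpha n\right)\right|^{2}W_{\mu,i\alpha n}(x)$$ $$=\frac{\pi\,2^{\mu+\frac12}\sqrt{x}}{\alpha}\,\Gamma(1-2\mu)\left\{D_{2\mu-1}\left(\sqrt{2x}\right)+2\sum_{n=1}^{\infty}e^{\frac{x\sinh^{2}(\pi n/\alpha)}{2}}D_{2\mu-1}\left(\sqrt{2x}\,\cosh\left(\frac{\pi n}{\alpha}\right)\right)\right\}.$$ Moreover, the following pair of Fourier transforms holds: for every $\xi\in\mathbb{R}$, $$\int_{-\infty}^{\infty}\left|\Gamma\left(\tfrac12-\mu+i\tau\right)\right|^{2}W_{\mu,i\tau}(x)\,e^{-i\tau\xi}\,d\tau=\pi\,2^{\mu+\frac12}\sqrt{x}\,\Gamma(1-2\mu)\,e^{\frac{x\sinh^{2}(\xi/2)}{2}}D_{2\mu-1}\left(\sqrt{2x}\,\cosh\left(\frac{\xi}{2}\right)\right),$$ and, for every $\tau\in\mathbb{R}$, $$\left|\Gamma\left(\tfrac12-\mu+i\tau\right)\right|^{2}W_{\mu,i\tau}(x)=2^{\mu-\frac12}\sqrt{x}\,\Gamma(1-2\mu)\int_{-\infty}^{\infty}e^{\frac{x\sinh^{2}(\xi/2)}{2}}D_{2\mu-1}\left(\sqrt{2x}\,\cosh\left(\frac{\xi}{2}\right)\right)e^{i\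tau\xi}\,d\xi.$$
   Context: For $z>0$, Tricomi's function is $\Psi(a,c;z)=\frac{\Gamma(1-c)}{\Gamma(a-c+1)}\,{}_1F_1(a;c;z)+z^{1-c}\frac{\Gamma(c-1)}{\Gamma(a)}\,{}_1F_1(a-c+1;2-c;z)$ (for integer $c$ defined by continuity in $c$), where ${}_1F_1(a;c;z)=\sum_{k\ge 0}\frac{(a)_k}{(c)_k}\frac{z^k}{k!}$. The Whittaker function is $W_{\mu,\nu}(z)=e^{-z/2}z^{\nu+\frac12}\,\Psi\left(\tfrac12+\nu-\mu,\,2\nu+1;\,z\right)$; it is entire in $\mu$ and in $\nu$. The parabolic cylinder function is, for $z>0$, $D_{\mu}(z)=2^{\frac{\mu}{2}+\frac14}z^{-\frac12}W_{\frac{\mu}{2}+\frac14,\frac14}\left(\frac{z^2}{2}\right)$. *)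

(* Defs.v *)
From HB Require Import structures.
From mathcomp Require Import all_boot all_order all_algebra.
From mathcomp Require Import complex.
From mathcomp Require Import all_classical all_reals all_analysis.
Set Implicit Arguments.
Unset Strict Implicit.
Unset Printing Implicit Defensive.
Import Order.TTheory GRing.Theory Num.Theory.
Import numFieldNormedType.Exports.
Local Open Scope classical_set_scope.
Local Open Scope ring_scope.
Local Open Scope complex_scope.

(* The topology of the complex numbers is that of R[i]^o : the cast ^o occurs
   only where a limit is taken. *)

Section special_functions.
Context {R : realType}.
Implicit Types (a c w mu nu : R[i]) (z t : R) (D : set R) (f : R -> R[i]).

Definition sinh t : R := (expR t - expR (- t)) / 2.
Definition cosh t : R := (expR t + expR (- t)) / 2.

Definition cexp w : R[i] :=
  (expR (complex.Re w))%:C * (cos (complex.Im w) +i* sin (complex.Im w)).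

(* z ^ w (principal value), for z > 0 only *)
Definition cpow z w : R[i] := cexp (w * (ln z)%:C).

Definition cintegrable D f : Prop :=
  lebesgue_measure.-integrable D (EFin \o (fun t => complex.Re (f t))) /\
  lebesgue_measure.-integrable D (EFin \o (fun t => complex.Im (f t))).

Definition cintegral D f : R[i] :=
  (\int[lebesgue_measure]_(t in D) complex.Re (f t))%R +i*
  (\int[lebesgue_measure]_(t in D) complex.Im (f t))%R.

Definition pochhammer a (k : nat) : R[i] := \prod_(0 <= j < k) (a + j%:R).

Definition euler_integral w : R[i] :=
  cintegral `]0, +oo[ (fun t => cpow t (w - 1) * (expR (- t))%:C).

(* Euler's integral for Re w > 0, continued by Gamma(w) = Gamma(w + n) / (w)_n
   where n := truncn (1 - Re w) is the least natural number such that
   Re w + n > 0; in particular n = 0 when Re w > 0.  At the poles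
   w = 0, -1, -2, ... the denominator vanishes, so that Gamma w = 0 and hence
   (Gamma w)^-1 = 0, the value of the entire function 1 / Gamma. *)
Definition Gamma w : R[i] :=
  let n := Num.truncn (1 - complex.Re w) in
  euler_integral (w + n%:R) / pochhammer w n.

Definition hyp1F1 a c z : R[i] :=
  limn (series (fun k : nat =>
    (pochhammer a k / pochhammer c k * (z ^+ k / k`!%:R)%:C : R[i]^o))).

Definition tricomi_generic a c z : R[i] :=
  Gamma (1 - c) / Gamma (a - c + 1) * hyp1F1 a c z
  + cpow z (1 - c) * (Gamma (c - 1) / Gamma a) * hyp1F1 (a - c + 1) (2 - c) z.

(* For integer c, the limit in c (a and z being fixed). *)
Definition tricomi a c z : R[i] :=
  if `[< exists m : int, c = m%:~R >] then
    lim ((tricomi_generic a c' z : R[i]^o) @[c' --> (c : R[i]^o)^'])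
  else tricomi_generic a c z.

Definition whittakerW mu nu z : R[i] :=
  (expR (- z / 2))%:C * cpow z (nu + 2^-1)
  * tricomi (2^-1 + nu - mu) (2 * nu + 1) z.

Definition parabolicD mu z : R[i] :=
  cpow 2 (mu / 2 + 4^-1) * (z `^ (- 2^-1))%:C
  * whittakerW (mu / 2 + 4^-1) 4^-1 (z ^+ 2 / 2).

End special_functions.

(* Main.v *)
Require Import Defs.
From HB Require Import structures.
From mathcomp Require Import all_boot all_order all_algebra.
From mathcomp Require Import complex.
From mathcomp Require Import all_classical all_reals all_analysis.
From mathcomp Require Import measurable_realfun.
From mathcomp Require Import ring lra.
Import Order.TTheory GRing.Theory Num.Theory.
Import numFieldNormedType.Exports.
Set Implicit Arguments.
Unset Strict Implicit.
Unset Printing Implicit Defensive.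
Local Open Scope classical_set_scope.
Local Open Scope ring_scope.
Local Open Scope complex_scope.
Local Notation Re := complex.Re.
Local Notation Im := complex.Im.

(* Put al = 1/2 - mu > 0 and H_w(q) = int exp(w s - e^s - q e^-s) ds, a Bessel
   function K_w up to a power of q.  The integral
     I(a, nu) = int exp(a t - e^t) H_{-nu}(x e^t) dt
   is evaluated in two ways.  Writing H as a combination of two 0F1 series and
   integrating term by term gives the 1F1 form of Tricomi's function: I(a, nu)
   is Gamma(a) Gamma(a - nu) Psi(a, 1 + nu; x).  For a = al + i tau, nu = 2 i tau
   this is |Gamma(al + i tau)|^2 times the Tricomi function of the statement.
   Inserting the integral for H and exchanging the integrations shows that it is
   also a cosine transform in tau of the even, exponentially decaying function
     G(r) = int exp(al s - e^s - 2 sqrt(x) cosh(r / 2) e^(s / 2)) ds.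
   At nu = -1/2 the function H is elementary, so that the first evaluation
   identifies G with the parabolic cylinder function.  The two Fourier
   transforms are then Fourier inversion, and the series identity is Poisson
   summation for G. *)

(** * Changes of variables *)

Section substitution.
Context {R : realType}.
Notation mu := (@lebesgue_measure R).
Implicit Types (f g : R -> R).

Lemma continuous_funrpos f t : {for t, continuous f} -> {for t, continuous (f^\+)%R}.
Proof.
move=> cf; have -> : (f^\+)%R = (fun t => (f t + `|f t|) / 2).
  by apply/funext => u; rewrite /funrpos maxr_absE subr0 addr0.
apply: cvgM; last exact: cvg_cst.
by apply: cvgD; [exact: cf|apply: cvg_norm; exact: cf].
Qed.

Lemma funrneg_oppE f : (f^\-)%R = ((\- f)^\+)%R.
Proof. by rewrite funrposN. Qed.

Lemma continuous_funrneg f t : {for t, continuous f} -> {for t, continuous (f^\-)%R}.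
Proof.
by move=> cf; rewrite funrneg_oppE; apply: continuous_funrpos; apply: cvgN; exact: cf.
Qed.

(* The sign parts reduce a change of variables for signed integrands to the
   nonnegative case, without any integrability hypothesis. *)
Lemma integral_signed_subst (A D E : set R) (phi : R -> R) (w : R -> R) :
  (forall t : R, 0 <= w t) ->
  (forall G : R -> R, (forall t, A t -> {for t, continuous G}) -> (forall t, 0 <= G t) ->
    (\int[mu]_(t in D) (G t)%:E = \int[mu]_(t in E) (G (phi t) * w t)%:E)%E) ->
  forall f, (forall t, A t -> {for t, continuous f}) ->
    (\int[mu]_(t in D) (f t)%:E = \int[mu]_(t in E) (f (phi t) * w t)%:E)%E.
Proof.
move=> w0 H f cf.
rewrite integralE [RHS]integralE; congr (_ - _)%E.
  rewrite (_ : (fun x => (f x)%:E) = EFin \o f)// funerpos H; last 2 first.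
  - by move=> t /cf; exact: continuous_funrpos.
  - by move=> t; exact: funrpos_ge0.
  rewrite (_ : (fun x => (f (phi x) * w x)%:E) = EFin \o (fun x => f (phi x) * w x))// funerpos.
  apply: eq_integral => t _; congr EFin.
  by rewrite /= /funrpos maxr_pMl// mul0r.
rewrite (_ : (fun x => (f x)%:E) = EFin \o f)// funerneg H; last 2 first.
- by move=> t /cf; exact: continuous_funrneg.
- by move=> t; rewrite funrneg_oppE funrpos_ge0.
rewrite (_ : (fun x => (f (phi x) * w x)%:E) = EFin \o (fun x => f (phi x) * w x))// funerneg.
apply: eq_integral => t _; congr EFin.
by rewrite /= /funrneg maxr_pMl// mul0r mulNr.
Qed.

Lemma bigcup_symitv : \bigcup_n `[- n%:R, n%:R]%classic = [set: R].
Proof.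
rewrite -subTset => t _.
exists (Num.truncn `|t|).+1 => //=.
by rewrite in_itv/= -ler_norml ltW// truncnS_gt.
Qed.

Lemma bigcup_expR_symitv :
  \bigcup_n `[expR (- n%:R), expR n%:R]%classic = `]0 : R, +oo[%classic.
Proof.
apply/seteqP; split=> [t [n _]|t]/=; rewrite !in_itv/= ?andbT.
  by case/andP => + _; apply: lt_le_trans; exact: expR_gt0.
move=> t0; have : [set: R] (ln t) by [].
rewrite -bigcup_symitv => -[n _ /=]; rewrite in_itv/= => /andP[h1 h2].
by exists n => //=; rewrite in_itv/= -[t]lnK// !ler_expR h1 h2.
Qed.

Lemma symitv_homo : {homo (fun n => `[- n%:R, n%:R]%classic : set R) :
  n m / (n <= m)%N >-> (n <= m)%O}.
Proof.
move=> n m nm; apply/subsetPset/subset_itv; rewrite bnd_simp ?lerN2 ler_nat//.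
Qed.

Lemma integral_expR_subst f : (forall t, 0 < t -> {for t, continuous f}) ->
  (\int[mu]_(t in `]0%R, +oo[) (f t)%:E
   = \int[mu]_t (f (expR t) * expR t)%:E)%E.
Proof.
apply: (@integral_signed_subst [set t | 0 < t]) => [t|]; first exact: expR_ge0.
move=> G cG G0.
have mG : measurable_fun (`]0, +oo[%classic : set R) (fun t : R => (G t)%:E).
  apply: (proj2 (measurable_EFinP _ _)).
  apply: open_continuous_measurable_fun; first by [].
  by move=> t; rewrite inE/= in_itv/= andbT; exact: cG.
have cG' : continuous (fun t => G (expR t) * expR t).
  move=> t; apply: cvgM; last exact: continuous_expR.
  apply: continuous_comp; [exact: continuous_expR|apply: cG; exact: expR_gt0].
have mG' : measurable_fun setT (fun t => (G (expR t) * expR t)%:E).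
  by apply/measurable_EFinP; exact: continuous_measurable_fun.
have L : (\int[mu]_(x in `[expR (- n%:R), expR n%:R]) (G x)%:E)%E @[n --> \oo]
     --> (\int[mu]_(t in `]0%R, +oo[) (G t)%:E)%E.
  rewrite -bigcup_expR_symitv; apply: ge0_nondecreasing_set_cvg_integral.
  - move=> n m nm; apply/subsetPset/subset_itv; rewrite bnd_simp ler_expR ?lerN2 ler_nat//.
  - by move=> n; exact: measurable_itv.
  - move=> n; apply: measurable_funS mG => //.
    by rewrite -bigcup_expR_symitv => t nt; exists n.
  - by move=> n x _; rewrite lee_fin.
have L' : (\int[mu]_(x in `[(- n%:R)%R, n%:R]) (G (expR x) * expR x)%:E)%E @[n --> \oo]
     --> (\int[mu]_x (G (expR x) * expR x)%:E)%E.
  rewrite -bigcup_symitv; apply: ge0_nondecreasing_set_cvg_integral.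
  - exact: symitv_homo.
  - by move=> n; exact: measurable_itv.
  - by move=> n; exact: measurable_funTS.
  - by move=> n x _; rewrite lee_fin mulr_ge0// expR_ge0.
have dexp : derive1 (expR : R -> R) = expR.
  by apply/funext => t; rewrite derive1E; exact: derive_val.
suff E : (fun n : nat => \int[mu]_(x in `[expR (- n%:R), expR n%:R]) (G x)%:E)%E =
    (fun n : nat => \int[mu]_(x in `[(- n%:R)%R, n%:R]) (G (expR x) * expR x)%:E)%E.
  by rewrite E in L; exact: (cvg_unique _ L L').
apply/funext => n.
have n0 : - n%:R <= n%:R :> R by rewrite ge0_cp// ler0n.
rewrite integration_by_substitution_increasing//; first last.
- apply: continuous_in_subspaceT => x; rewrite inE/= in_itv/= => /andP[x0 _].
  by apply: cG; apply: lt_le_trans x0; exact: expR_gt0.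
- split=> //.
  + by apply: cvg_at_right_filter; exact: continuous_expR.
  + by apply: cvg_at_left_filter; exact: continuous_expR.
- rewrite dexp; apply/cvg_ex; exists (expR n%:R).
  by apply: cvg_at_left_filter; exact: continuous_expR.
- rewrite dexp; apply/cvg_ex; exists (expR (- n%:R)).
  by apply: cvg_at_right_filter; exact: continuous_expR.
- by rewrite dexp => x _; exact: continuous_expR.
- by move=> x y _ _; rewrite ltr_expR.
by apply: eq_integral => x _; rewrite dexp.
Qed.

Lemma integral_affine_subst (k s : R) f : 0 < k -> continuous f ->
  (\int[mu]_t (f t)%:E = \int[mu]_t (f (k * t + s) * k)%:E)%E.
Proof.
move=> k0 cf.
apply: (@integral_signed_subst setT _ _ (fun t => k * t + s) (fun=> k)); last by move=> t _; exact: cf.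
  by move=> t; exact: ltW.
move=> G cG' G0; have cG : continuous G by move=> t; exact: cG'.
have dF (t : R) : is_derive t 1 (fun t => k * t + s) k.
  apply: is_derive_eq; rewrite addr0; exact: mulr1.
have dE : derive1 (fun t : R => k * t + s) = cst k.
  by apply/funext => t; rewrite derive1E; exact: derive_val.
rewrite (@increasing_ge0_integration_by_substitutionT _ (fun t => k * t + s))//.
- by apply: eq_integral => t _; rewrite dE.
- by move=> x y xy; rewrite ltrD2r ltr_pM2l.
- by rewrite dE => x; exact: cvg_cst.
- by rewrite dE; exact: is_cvg_cst.
- by rewrite dE; exact: is_cvg_cst.
- apply: (@cvg_comp _ _ _ (fun t => k * t) (fun t => t + s) _ -oo); last exact: cvg_addrr_Ny.
  by apply: gt0_cvgMrNy.
- apply: (@cvg_comp _ _ _ (fun t => k * t) (fun t => t + s) _ +oo); last exact: cvg_addrr.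
  by apply: gt0_cvgMry.
Qed.

End substitution.

(** * Integrals over the real line *)

Section real_integrals.
Context {R : realType}.
Notation mu := (@lebesgue_measure R).
Implicit Types (f g h F : R -> R).

Lemma measurable_EFin d (T : measurableType d) (f : T -> R) :
  measurable_fun setT f -> measurable_fun setT (fun t => (f t)%:E).
Proof. by move/measurable_EFinP. Qed.

Definition intg f := mu.-integrable setT (EFin \o f).

Lemma integral_oppr_subst f : continuous f ->
  (\int[mu]_t (f t)%:E = \int[mu]_t (f (- t))%:E)%E.
Proof.
move=> cf; transitivity (\int[mu]_t (f (- t) * 1)%:E)%E; last first.
  by apply: eq_integral => t _; rewrite mulr1.
apply: (@integral_signed_subst _ setT) => //; last by move=> t _; exact: cf.
move=> G cG' G0; have cG : continuous G by move=> t; exact: cG'.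
under [RHS]eq_integral do rewrite mulr1.
have cGN : continuous (fun t => G (- t)).
  by move=> t; apply: continuous_comp; [exact: oppr_continuous|exact: cG].
have H (g : R -> R) : continuous g -> (forall t, 0 <= g t) ->
  (\int[mu]_(x in `[(- n%:R)%R, n%:R]) (g x)%:E)%E @[n --> \oo]
     --> (\int[mu]_x (g x)%:E)%E.
  move=> cg g0; rewrite -bigcup_symitv; apply: ge0_nondecreasing_set_cvg_integral.
  - exact: symitv_homo.
  - by move=> n; exact: measurable_itv.
  - by move=> n; apply/measurable_funTS/measurable_EFinP; exact: continuous_measurable_fun.
  - by move=> n x _; rewrite lee_fin.
have L := H _ cG G0; have L' := H _ cGN (fun t => G0 (- t)).
suff E : (fun n : nat => \int[mu]_(x in `[(- n%:R)%R, n%:R]) (G x)%:E)%E =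
    (fun n : nat => \int[mu]_(x in `[(- n%:R)%R, n%:R]) (G (- x))%:E)%E.
  by rewrite E in L; exact: (cvg_unique _ L L').
apply/funext => n.
have n0 : - n%:R <= n%:R :> R by rewrite ge0_cp// ler0n.
have := @integration_by_substitution_oppr _ G _ _ n0; rewrite opprK => -> //.
by apply: continuous_subspaceT.
Qed.

Lemma eq_intg f g : f =1 g -> intg f -> intg g.
Proof. by move=> /funext ->. Qed.

Lemma intg_meas f : intg f -> measurable_fun setT f.
Proof. by move=> /integrableP[/measurable_EFinP]. Qed.

Lemma intg_le f g : measurable_fun setT f -> (forall t, `|f t| <= g t) ->
  intg g -> intg f.
Proof.
move=> mf fg; apply: le_integrable => //; first exact/measurable_EFinP.
by move=> t _ /=; rewrite lee_fin (le_trans (fg t))// ler_norm.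
Qed.

Lemma intgD f g : intg f -> intg g -> intg (fun t => f t + g t).
Proof. by move=> hf hg; exact: (integrableD measurableT hf hg). Qed.

Lemma intgB f g : intg f -> intg g -> intg (fun t => f t - g t).
Proof. by move=> hf hg; exact: (integrableB measurableT hf hg). Qed.

Lemma intgZ k f : intg f -> intg (fun t => k * f t).
Proof. by move=> hf; exact: (integrableZl measurableT k hf). Qed.

Lemma intg_norm f : intg f -> intg (fun t => `|f t|).
Proof. by move=> hf; exact: (integrable_norm hf). Qed.

Lemma RintgD f g : intg f -> intg g ->
  \int[mu]_t (f t + g t) = \int[mu]_t f t + \int[mu]_t g t.
Proof. by move=> hf hg; exact: RintegralD. Qed.

Lemma RintgB f g : intg f -> intg g ->
  \int[mu]_t (f t - g t) = \int[mu]_t f t - \int[mu]_t g t.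
Proof. by move=> hf hg; exact: RintegralB. Qed.

Lemma RintgZ k f : intg f -> \int[mu]_t (k * f t) = k * \int[mu]_t f t.
Proof. by move=> hf; exact: RintegralZl. Qed.

Lemma RintgN f : intg f -> \int[mu]_t (- f t) = - \int[mu]_t f t.
Proof.
by move=> hf; under eq_Rintegral do rewrite -mulN1r; rewrite RintgZ// mulN1r.
Qed.

Lemma eq_Rintg f g : f =1 g -> \int[mu]_t f t = \int[mu]_t g t.
Proof. by move=> /funext ->. Qed.

Lemma Rintg_le f g : intg f -> intg g -> (forall t, f t <= g t) ->
  \int[mu]_t f t <= \int[mu]_t g t.
Proof. by move=> hf hg fg; apply: le_Rintegral. Qed.

Lemma Rintg_norm f g : measurable_fun setT f -> intg g ->
  (forall t, `|f t| <= g t) -> `|\int[mu]_t f t| <= \int[mu]_t g t.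
Proof.
move=> mf hg fg; have hf := intg_le mf fg hg.
apply: le_trans (le_normr_Rintegral _ hf) _ => //.
by apply: Rintg_le => //; exact: intg_norm.
Qed.

Lemma Rintg_affine (k s : R) f : 0 < k -> continuous f ->
  \int[mu]_t f t = \int[mu]_t (f (k * t + s) * k).
Proof. by move=> k0 cf; congr fine; exact: integral_affine_subst. Qed.

Lemma Rintg_oppr f : continuous f -> \int[mu]_t f t = \int[mu]_t f (- t).
Proof. by move=> cf; congr fine; exact: integral_oppr_subst. Qed.

Lemma Rintg_odd f : continuous f -> (forall t, f (- t) = - f t) -> intg f ->
  \int[mu]_t f t = 0.
Proof.
move=> cf of_ hf; have := Rintg_oppr cf; rewrite (eq_Rintg of_) RintgN// => h.
by lra.
Qed.

Lemma Rdct (f_ : nat -> R -> R) f g :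
  (forall n, measurable_fun setT (f_ n)) ->
  (forall t, f_ n t @[n --> \oo] --> f t) ->
  (forall n t, `|f_ n t| <= g t) -> intg g ->
  intg f /\ (\int[mu]_t f_ n t) @[n --> \oo] --> \int[mu]_t f t.
Proof.
move=> mf cf fg hg.
have mlim : measurable_fun setT f.
  apply: (@measurable_fun_cvg _ _ _ _ f_) => // t _; exact: cf.
have ecf t : (f_ n t)%:E @[n --> \oo] --> (f t)%:E.
  by apply: cvg_EFin; [exact: nearW|exact: cf].
have [|||//||h1 _ h3] := @dominated_convergence _ _ _ mu setT measurableT
  (fun n => EFin \o f_ n) (EFin \o f) (EFin \o g).
- by move=> n; exact: (measurable_EFin (mf n)).
- exact: (measurable_EFin mlim).
- by apply: aeW => t _; exact: ecf.
- by apply: aeW => t n _; rewrite /= lee_fin.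
split=> //; apply: fine_cvg; move: h3 => /=.
rewrite /Rintegral fineK//; exact: integrable_fin_num.
Qed.


Lemma product_dominated_integrable (F : R -> R -> R) g1 g2 :
  measurable_fun setT (fun p : R * R => F p.1 p.2) ->
  intg g1 -> intg g2 -> (forall s t, `|F s t| <= g1 s * g2 t) ->
  intg (fun s => \int[mu]_t F s t) /\
  (mu \x mu)%E.-integrable setT (fun p : R * R => (F p.1 p.2)%:E).
Proof.
move=> mF hg1 hg2 Fg.
have mF1 s : measurable_fun setT (F s) by exact: measurableT_comp mF (pair1_measurable s).
have mF2 t : measurable_fun setT (F ^~ t) by exact: measurableT_comp mF (pair2_measurable t).
have i1 s : intg (F s).
  by apply: intg_le (mF1 s) _ (intgZ (g1 s) hg2) => t; exact: Fg.
have i2 t : intg (F ^~ t).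
  by apply: intg_le (mF2 t) _ (intgZ (g2 t) hg1) => s; rewrite mulrC; exact: Fg.
have iF : (mu \x mu)%E.-integrable setT (fun p : R * R => (F p.1 p.2)%:E).
  apply/integrable12ltyP; first exact: (measurable_EFin mF).
  have h (s : R) : (\int[mu]_t `|(F s t)%:E| <= (`|g1 s| * \int[mu]_t `|g2 t|)%:E)%E.
    have ii := intgZ `|g1 s| (intg_norm hg2).
    rewrite -RintgZ; last exact: intg_norm.
    rewrite /Rintegral fineK; last exact: integrable_fin_num.
    apply: ge0_le_integral => //.
    - by apply: measurableT_comp => //; exact: (measurable_EFin (mF1 s)).
    - exact: (measurable_int _ ii).
    - by move=> t _; rewrite /= lee_fin (le_trans (Fg s t))// -normrM ler_norm.
  have ii := intgZ (\int[mu]_t `|g2 t|) (intg_norm hg1).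
  apply: le_lt_trans (_ : (\int[mu]_s (`|g1 s| * \int[mu]_t `|g2 t|)%:E < +oo)%E).
    apply: ge0_le_integral => //.
    - by move=> s _; exact: integral_ge0.
    - have mabs : measurable_fun setT (fun p : R * R => `|(F p.1 p.2)%:E|%E).
        by apply: measurableT_comp => //; exact: (measurable_EFin mF).
      have := @measurable_fun_fubini_tonelli_F _ _ _ _ R mu _ mabs.
      by apply=> p; exact: abse_ge0.
    - apply: measurable_int; apply: eq_integrable ii => // t _; first by rewrite /= mulrC.
    - by move=> s _; exact: h.
  have E0 : (fun s => (`|g1 s| * \int[mu]_t `|g2 t|)%:E) =
      EFin \o (fun s => (\int[mu]_t `|g2 t|) * `|g1 s|).
    by apply/funext => s /=; rewrite mulrC.
  rewrite [X in (X < _)%E](congr1 (fun k => \int[mu]_s k s)%E E0).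
  by rewrite ltey_eq integrable_fin_num.
have E1 : (fun s => (\int[mu]_t F s t)%:E) = (fun s => \int[mu]_t (F s t)%:E)%E.
  by apply/funext => s; rewrite /Rintegral fineK//; exact: (integrable_fin_num _ (i1 s)).
split=> //.
have := integrable_fubini_F iF; rewrite /intg; apply: eq_integrable => // s _.
by rewrite [RHS](congr1 (@^~ s) E1).
Qed.

Lemma Rfubini (F : R -> R -> R) g1 g2 :
  measurable_fun setT (fun p : R * R => F p.1 p.2) ->
  intg g1 -> intg g2 -> (forall s t, `|F s t| <= g1 s * g2 t) ->
  [/\ intg (fun s => \int[mu]_t F s t), intg (fun t => \int[mu]_s F s t) &
    \int[mu]_s (\int[mu]_t F s t) = \int[mu]_t (\int[mu]_s F s t)].
Proof.
move=> mF hg1 hg2 Fg.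
have [h1 iF] := product_dominated_integrable mF hg1 hg2 Fg.
have mF' : measurable_fun setT (fun p : R * R => F p.2 p.1).
  have msw : measurable_fun setT (fun p : R * R => (p.2, p.1)).
    by apply: measurable_fun_pair; [exact: measurable_snd|exact: measurable_fst].
  by have := measurableT_comp mF msw.
have Fg' s t : `|F t s| <= g2 s * g1 t by rewrite mulrC.
have [h2 _] := @product_dominated_integrable (fun s t => F t s) _ _ mF' hg2 hg1 Fg'.
have mF1 s : measurable_fun setT (F s) by exact: measurableT_comp mF (pair1_measurable s).
have mF2 t : measurable_fun setT (F ^~ t) by exact: measurableT_comp mF (pair2_measurable t).
have i1 s : intg (F s).
  by apply: intg_le (mF1 s) _ (intgZ (g1 s) hg2) => t; exact: Fg.
have i2 t : intg (F ^~ t).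
  by apply: intg_le (mF2 t) _ (intgZ (g2 t) hg1) => s; rewrite mulrC; exact: Fg.
split=> //; congr fine.
transitivity (\int[mu]_s \int[mu]_t (F s t)%:E)%E.
  apply: eq_integral => s _; rewrite /Rintegral fineK//.
  exact: (integrable_fin_num _ (i1 s)).
rewrite (Fubini iF); apply: eq_integral => t _; rewrite /Rintegral fineK//.
exact: (integrable_fin_num _ (i2 t)).
Qed.


Lemma is_derive_continuous F f : (forall t : R, is_derive t (1 : R) F (f t)) -> continuous F.
Proof.
move=> dF t; apply: differentiable_continuous.
by apply/derivable1_diffP; have [] := dF t.
Qed.

Lemma is_derive_derive1 F f : (forall t : R, is_derive t (1 : R) F (f t)) -> derive1 F = f.
Proof. by move=> dF; apply/funext => t; rewrite derive1E; exact: derive_val. Qed.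

Lemma FTC_half_ge0 f F (l : R) : continuous f ->
  (forall t : R, is_derive t (1 : R) F (f t)) ->
  (forall t, 0 <= t -> 0 <= f t) -> F t @[t --> +oo] --> l ->
  mu.-integrable `[0, +oo[ (EFin \o f) /\ \int[mu]_(t in `[0, +oo[) f t = l - F 0.
Proof.
move=> cf dF f0 Fl.
have H : (\int[mu]_(t in `[0%R, +oo[) (f t)%:E = l%:E - (F 0)%:E)%E.
  apply: ge0_continuous_FTC2y => //.
  - by apply: continuous_subspaceT.
  - by apply: cvg_at_right_filter; exact: (is_derive_continuous dF).
  - by move=> t _; rewrite (is_derive_derive1 dF).
split; last by rewrite /Rintegral H.
apply/integrableP; split.
  by apply/measurable_funTS/measurable_EFin; exact: continuous_measurable_fun.
under eq_integral.
  move=> t /set_mem; rewrite /= in_itv/= andbT => t0.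
  rewrite ger0_norm ?f0//; over.
by rewrite H -EFinB ltry.
Qed.

(* An integrand of any sign is handled by adding a multiple of exp(-dt) whose
   primitive is known. *)
Lemma FTC_half f F (d C l : R) : 0 < d -> continuous f ->
  (forall t : R, is_derive t (1 : R) F (f t)) ->
  (forall t, 0 <= t -> `|f t| <= C * expR (- (d * t))) ->
  F t @[t --> +oo] --> l ->
  mu.-integrable `[0, +oo[ (EFin \o f) /\ \int[mu]_(t in `[0, +oo[) f t = l - F 0.
Proof.
move=> d0 cf dF bf Fl.
have C0 : 0 <= C.
  by have := bf 0 (lexx _); rewrite mulr0 oppr0 expR0 mulr1; apply: le_trans.
pose e (t : R) := C * expR (- (d * t)); pose E (t : R) := - (C / d) * expR (- (d * t)).
have de (t : R) : is_derive t (1 : R) (fun t => expR (- (d * t))) (- d * expR (- (d * t))).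
  apply: is_derive_eq.
  rewrite -[LHS]/(expR (- (d * t)) * - (d * 1)); ring.
have ce : continuous e.
  by move=> t; apply: cvgM; [exact: cvg_cst|exact: (is_derive_continuous de)].
have dE (t : R) : is_derive t (1 : R) E (e t).
  apply: is_derive_eq; rewrite /e.
  rewrite -[LHS]/(- (C / d) * (- d * expR (- (d * t)))); field.
  by rewrite gt_eqF.
have E0 : E t @[t --> +oo] --> 0.
  rewrite -[X in _ --> X](mulr0 (- (C / d))); apply: cvgM; first exact: cvg_cst.
  apply: (@cvg_comp _ _ _ (fun t => d * t) (fun t => expR (- t)) _ +oo); last exact: cvgr_expR.
  by apply: gt0_cvgMry.
have [ie Ie] := FTC_half_ge0 ce dE (fun t _ => mulr_ge0 C0 (expR_ge0 _)) E0.
have cfe : continuous (fun t => f t + e t) by move=> t; exact: cvgD (cf t) (ce t).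
have dFE (t : R) : is_derive t (1 : R) (fun t => F t + E t) (f t + e t).
  exact: is_deriveD (dF t) (dE t).
have fe0 t : 0 <= t -> 0 <= f t + e t.
  by move=> /bf; rewrite ler_norml /e => /andP[+ _]; rewrite -lerBlDr sub0r.
have [ife Ife] := FTC_half_ge0 cfe dFE fe0 (cvgD Fl E0).
have iF : mu.-integrable `[0, +oo[ (EFin \o f).
  have := @integrableB _ _ _ mu _ (measurable_itv _) _ _ ife ie; apply: eq_integrable => // t _.
  by rewrite /= -EFinB addrK.
split=> //.
have -> : \int[mu]_(t in `[0, +oo[) f t =
    \int[mu]_(t in `[0, +oo[) (f t + e t) - \int[mu]_(t in `[0, +oo[) e t.
  by rewrite -RintegralB//; apply: eq_Rintegral => t _; rewrite addrK.
rewrite Ife Ie; ring.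
Qed.

Lemma is_derive_expRM (d t : R) :
  is_derive t (1 : R) (fun t => expR (d * t)) (d * expR (d * t)).
Proof.
apply: is_derive_eq.
by rewrite -[LHS]/(expR (d * t) * (d * 1)) mulr1 mulrC.
Qed.

Lemma cvg_expRMN (d : R) : 0 < d -> expR (- (d * t)) @[t --> +oo] --> (0 : R).
Proof.
move=> d0.
apply: (@cvg_comp _ _ _ (fun t => d * t) (fun t => expR (- t)) _ +oo); last exact: cvgr_expR.
by apply: gt0_cvgMry.
Qed.

Lemma continuous_expabs (d : R) : continuous (fun t : R => expR (- (d * `|t|))).
Proof.
move=> t; apply: continuous_comp; last exact: continuous_expR.
apply: cvgN; apply: cvgM; first exact: cvg_cst.
exact: norm_continuous.
Qed.

Lemma set_ge0_itv : [set x : R | 0 <= x] = `[0, +oo[%classic.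
Proof. by apply/seteqP; split=> x /=; rewrite in_itv/= andbT. Qed.

Lemma intg_expabs (d : R) : 0 < d -> intg (fun t : R => expR (- (d * `|t|))).
Proof.
move=> d0; have ce := @continuous_expabs d.
apply/integrableP; split; first by apply: measurable_EFin; exact: continuous_measurable_fun.
under eq_integral do rewrite /= ger0_norm ?expR_ge0//.
rewrite ge0_symfun_integralT//; last by move=> t /=; rewrite normrN.
pose E (t : R) := - d^-1 * expR (- d * t).
have dE (t : R) : is_derive t (1 : R) E (expR (- d * t)).
  apply: is_derive_eq (is_deriveZ (- d^-1) (is_derive_expRM (- d) t)) _.
  by rewrite -[LHS]/(- d^-1 * (- d * expR (- d * t))) mulrA mulrNN mulVf ?gt_eqF// mul1r.
have cE : E t @[t --> +oo] --> (- d^-1 * 0).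
  apply: cvgM; first exact: cvg_cst.
  by under eq_fun do rewrite mulNr; exact: cvg_expRMN.
have [i1 _] := FTC_half_ge0 (is_derive_continuous (is_derive_expRM (- d))) dE
  (fun t _ => expR_ge0 _) cE.
rewrite set_ge0_itv; apply: lte_mul_pinfty => //.
rewrite (_ : (\int[mu]_(x in _) _)%E = (\int[mu]_(x in `[0%R, +oo[) (EFin \o (fun t => expR (- d * t))) x)%E).
  by rewrite ltey_eq integrable_fin_num.
by apply: eq_integral => t /set_mem; rewrite /= in_itv/= andbT => t0; rewrite ger0_norm// mulNr.
Qed.

Lemma intg_decay f (d C : R) : 0 < d -> measurable_fun setT f ->
  (forall t, `|f t| <= C * expR (- (d * `|t|))) -> intg f.
Proof. by move=> d0 mf bf; apply: intg_le mf bf (intgZ C (intg_expabs d0)). Qed.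

Lemma ge0_Rintg_even f : continuous f -> (forall t, f (- t) = f t) ->
  (forall t, 0 <= f t) -> \int[mu]_t f t = 2 * \int[mu]_(t in `[0, +oo[) f t.
Proof.
move=> cf ef f0; rewrite /Rintegral ge0_symfun_integralT//; last first.
  by move=> t /=; rewrite ef.
rewrite set_ge0_itv; set I := (\int[mu]_(_ in _) _)%E.
have : (0 <= I)%E by apply: integral_ge0 => t _; rewrite lee_fin.
case: I => [r _||]//.
by rewrite mulry gtr0_sg// mul1e /= mulr0.
Qed.

Lemma Rintg_even f (d C : R) : 0 < d -> continuous f -> (forall t, f (- t) = f t) ->
  (forall t, `|f t| <= C * expR (- (d * `|t|))) ->
  \int[mu]_t f t = 2 * \int[mu]_(t in `[0, +oo[) f t.
Proof.
move=> d0 cf ef bf; pose e (t : R) : R := C * expR (- (d * `|t|)).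
have ce : continuous e.
  by move=> t; apply: cvgM; [exact: cvg_cst|exact: continuous_expabs].
have ie : intg e by exact: intgZ (intg_expabs d0).
have if_ := intg_decay d0 (continuous_measurable_fun cf) bf.
have e0 t : 0 <= e t by apply: le_trans (bf t).
have ee t : e (- t) = e t by rewrite /e normrN.
have S g : intg g -> mu.-integrable `[0, +oo[ (EFin \o g).
  by apply: integrableS => //; exact: measurable_itv.
have := @ge0_Rintg_even (fun t => f t + e t) (fun t => cvgD (cf t) (ce t)).
rewrite RintgD// RintegralD//; [|exact: S|exact: S].
rewrite (ge0_Rintg_even ce ee e0) => h.
suff : \int[mu]_t f t + 2 * \int[mu]_(t in `[0, +oo[) e t =
  2 * (\int[mu]_(t in `[0, +oo[) f t + \int[mu]_(t in `[0, +oo[) e t) by lra.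
apply: h => t; first by rewrite ef ee.
by have := bf t; rewrite ler_norml => /andP[+ _]; rewrite -/(e t); lra.
Qed.

Lemma FTC_line f F (d C l l' : R) : 0 < d -> continuous f ->
  (forall t : R, is_derive t (1 : R) F (f t)) ->
  (forall t, `|f t| <= C * expR (- (d * `|t|))) ->
  F t @[t --> +oo] --> l -> F (- t) @[t --> +oo] --> l' ->
  \int[mu]_t f t = l - l'.
Proof.
move=> d0 cf dF bf Fl Fl'.
have if_ := intg_decay d0 (continuous_measurable_fun cf) bf.
pose f' t := f (- t).
have cf' : continuous f'.
  by move=> t; apply: continuous_comp; [exact: oppr_continuous|exact: cf].
have bf' t : `|f' t| <= C * expR (- (d * `|t|)) by rewrite -(normrN t); exact: bf.
have if' := intg_decay d0 (continuous_measurable_fun cf') bf'.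
have dF' t : is_derive t (1 : R) (fun t => F (- t)) (- f (- t)).
  have dN : is_derive t (1 : R) (fun s : R => - s) (- 1) := is_deriveN (is_derive_id t 1).
  have := @is_derive1_comp _ F (fun s : R => - s) _ _ _ (dF (- t)) dN.
  by rewrite mulrN1.
have dFF t : is_derive t (1 : R) (fun t => F t - F (- t)) (f t + f' t).
  by have := is_deriveB (dF t) (dF' t); rewrite opprK.
have c2 : continuous (fun t => f t + f' t) by move=> t; apply: cvgD; [exact: cf|exact: cf'].
have b2 t : `|f t + f' t| <= (2 * C) * expR (- (d * `|t|)).
  by apply: le_trans (ler_normD _ _) _; have := bf t; have := bf' t; lra.
have [_ I2] := FTC_half d0 c2 dFF
  (fun t t0 => ltac:(by rewrite -{2}(ger0_norm t0); exact: b2)) (cvgB Fl Fl').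
have := Rintg_even d0 c2 (fun t => ltac:(by rewrite /f' opprK addrC)) b2.
have E : \int[mu]_t f' t = \int[mu]_t f t := esym (Rintg_oppr cf).
rewrite I2 RintgD// E oppr0 subrr subr0; lra.
Qed.

End real_integrals.

(** * Complex numbers and complex integrals *)

Section complex_basics.
Context {R : realType}.
Implicit Types (z w : R[i]) (r t : R).

Definition nm z : R := Normc.normc z.

Lemma nm_ge0 z : 0 <= nm z.
Proof. by case: z => a b; exact: sqrtr_ge0. Qed.

Lemma nm0 : nm 0 = 0. Proof. exact: Normc.normc0. Qed.
Lemma nm1 : nm 1 = 1. Proof. exact: Normc.normc1. Qed.
Lemma nmM z w : nm (z * w) = nm z * nm w. Proof. exact: Normc.normcM. Qed.
Lemma nmV z : nm z^-1 = (nm z)^-1. Proof. exact: Normc.normcV. Qed.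
Lemma nmN z : nm (- z) = nm z. Proof. exact: normcN. Qed.
Lemma ler_nmD z w : nm (z + w) <= nm z + nm w. Proof. exact: le_normcD. Qed.
Lemma ler_nmB z w : nm (z - w) <= nm z + nm w.
Proof. by rewrite -(nmN w); exact: ler_nmD. Qed.
Lemma nm_distC z w : nm (z - w) = nm (w - z).
Proof. by rewrite -nmN opprB. Qed.

Lemma nm_real r : nm r%:C = `|r|.
Proof. by rewrite /nm /= expr0n addr0 sqrtr_sqr. Qed.

Lemma nm_eq0 z : (nm z == 0) = (z == 0).
Proof.
apply/eqP/eqP => [|->]; [exact: Normc.eq0_normc|exact: nm0].
Qed.

Lemma nm_gt0 z : (0 < nm z) = (z != 0).
Proof. by rewrite lt_neqAle nm_ge0 andbT eq_sym nm_eq0. Qed.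

Lemma ler_norm_Re z : `|Re z| <= nm z.
Proof.
case: z => a b; rewrite -sqrtr_sqr /nm /= ler_wsqrtr// lerDl sqr_ge0//.
Qed.

Lemma ler_norm_Im z : `|Im z| <= nm z.
Proof.
case: z => a b; rewrite -sqrtr_sqr /nm /= ler_wsqrtr// lerDr sqr_ge0//.
Qed.

Lemma nm_le z : nm z <= `|Re z| + `|Im z|.
Proof.
rewrite {1}(complexE z); apply: le_trans (ler_nmD _ _) _.
rewrite nmM !nm_real lerD2l.
by rewrite /nm /= expr0n expr1n add0r sqrtr1 mul1r.
Qed.

Lemma cReD z w : Re (z + w) = Re z + Re w. Proof. by case: z; case: w. Qed.
Lemma cImD z w : Im (z + w) = Im z + Im w. Proof. by case: z; case: w. Qed.
Lemma cReN z : Re (- z) = - Re z. Proof. by case: z. Qed.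
Lemma cImN z : Im (- z) = - Im z. Proof. by case: z. Qed.
Lemma cReB z w : Re (z - w) = Re z - Re w. Proof. by case: z; case: w. Qed.
Lemma cImB z w : Im (z - w) = Im z - Im w. Proof. by case: z; case: w. Qed.
Lemma cReM z w : Re (z * w) = Re z * Re w - Im z * Im w.
Proof. by case: z; case: w. Qed.
Lemma cImM z w : Im (z * w) = Re z * Im w + Im z * Re w.
Proof. by case: z => a b; case: w => c d /=. Qed.
Lemma cReMr r z : Re (r%:C * z) = r * Re z.
Proof. by rewrite cReM /= mul0r subr0. Qed.
Lemma cImMr r z : Im (r%:C * z) = r * Im z.
Proof. by rewrite cImM /= mul0r addr0. Qed.
Lemma cReMl z r : Re (z * r%:C) = Re z * r.
Proof. by rewrite mulrC cReMr mulrC. Qed.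
Lemma cImMl z r : Im (z * r%:C) = Im z * r.
Proof. by rewrite mulrC cImMr mulrC. Qed.

Lemma complex_ext z w : Re z = Re w -> Im z = Im w -> z = w.
Proof. by case: z => a b; case: w => c d /= -> ->. Qed.

Lemma cexpD z w : cexp (z + w) = cexp z * cexp w.
Proof.
apply: complex_ext; rewrite /cexp !(cReMr, cImMr, cReM, cImM, cReD, cImD) /= expRD ?cosD ?sinD;
  ring.
Qed.

Lemma cexp_real r : cexp r%:C = (expR r)%:C.
Proof.
by apply: complex_ext; rewrite /cexp ?cReMr ?cImMr /= ?cos0 ?sin0 ?mulr1 ?mulr0.
Qed.

Lemma cexp0 : cexp (0 : R[i]) = 1.
Proof. by rewrite (_ : 0 = 0%:C)// cexp_real expR0. Qed.

Lemma nm_cexp w : nm (cexp w) = expR (Re w).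
Proof.
rewrite /cexp nmM nm_real ger0_norm ?expR_ge0// /nm /= cos2Dsin2 sqrtr1 mulr1//.
Qed.

Lemma cexp_neq0 w : cexp w != 0.
Proof. by rewrite -nm_gt0 nm_cexp expR_gt0. Qed.

Lemma cexpN w : cexp (- w) = (cexp w)^-1.
Proof.
apply: (mulfI (cexp_neq0 w)); rewrite mulfV ?cexp_neq0// -cexpD subrr cexp0//.
Qed.

Lemma cexp_conj w : (cexp w)^* = cexp w^*.
Proof.
case: w => a b; apply: complex_ext; rewrite /cexp /=; last first.
  by rewrite sinN; ring.
by rewrite cosN sinN; ring.
Qed.

Lemma Re_cexp w : Re (cexp w) = expR (Re w) * cos (Im w).
Proof. by rewrite /cexp cReMr. Qed.

Lemma Im_cexp w : Im (cexp w) = expR (Re w) * sin (Im w).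
Proof. by rewrite /cexp cImMr. Qed.

Lemma rcM r t : (r * t)%:C = r%:C * t%:C :> R[i]. Proof. exact: rmorphM. Qed.
Lemma rcD r t : (r + t)%:C = r%:C + t%:C :> R[i]. Proof. exact: rmorphD. Qed.
Lemma rcB r t : (r - t)%:C = r%:C - t%:C :> R[i]. Proof. exact: rmorphB. Qed.
Lemma rcN r : (- r)%:C = - r%:C :> R[i]. Proof. exact: rmorphN. Qed.
Lemma rcV r : (r^-1)%:C = (r%:C)^-1 :> R[i]. Proof. exact: fmorphV. Qed.
Lemma rc_nat n : (n%:R)%:C = n%:R :> R[i]. Proof. exact: rmorph_nat. Qed.
Lemma rcX r n : (r ^+ n)%:C = r%:C ^+ n :> R[i]. Proof. exact: rmorphXn. Qed.
Lemma rc_neq0 r : (r%:C != 0 :> R[i]) = (r != 0).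
Proof. by rewrite fmorph_eq0. Qed.

Lemma cvgCP T (F : set_system T) (FF : Filter F) (u : T -> R[i]) (l : R[i]) :
  ((u x : R[i]^o) @[x --> F] --> (l : R[i]^o)) <-> (nm (u x - l) @[x --> F] --> (0 : R)).
Proof.
split=> [h|h].
- apply/cvgrPdist_lt => e e0.
  have e0' : 0 < e%:C :> R[i] by rewrite ltcR.
  move/cvgrPdist_lt : h => /(_ _ e0'); apply: filterS => x.
  move=> hx; have : (nm (l - u x))%:C < e%:C by exact: hx.
  by rewrite ltcR sub0r normrN ger0_norm ?nm_ge0// nm_distC.
- apply/cvgrPdist_lt => e e0.
  have [e1 ee] : exists e1 : R, e = e1%:C.
    by exists (Re e); rewrite RRe_real// gtr0_real.
  rewrite ee ltcR in e0.
  move/cvgrPdist_lt : h => /(_ _ e0); apply: filterS => x.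
  rewrite sub0r normrN (ger0_norm (nm_ge0 _)) nm_distC => hx.
  suff : (nm (l - u x))%:C < e by [].
  by rewrite ee ltcR.
Qed.

Lemma cvgC_ReIm T (F : set_system T) (FF : Filter F) (u : T -> R[i]) (l : R[i]) :
  Re (u x) @[x --> F] --> Re l -> Im (u x) @[x --> F] --> Im l ->
  (u x : R[i]^o) @[x --> F] --> (l : R[i]^o).
Proof.
move=> hr hi; apply/cvgCP.
have h0 : `|Re (u x) - Re l| + `|Im (u x) - Im l| @[x --> F] --> (0 : R).
  rewrite -[X in _ --> X]addr0; apply: cvgD.
    by rewrite -(normr0 R) -(subrr (Re l)); apply: cvg_norm; apply: cvgB => //; exact: cvg_cst.
  by rewrite -(normr0 R) -(subrr (Im l)); apply: cvg_norm; apply: cvgB => //; exact: cvg_cst.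
apply: (squeeze_cvgr _ (cvg_cst 0) h0); apply: nearW => x.
by rewrite nm_ge0 /= -cReB -cImB nm_le.
Qed.

Lemma cvgC_Re T (F : set_system T) (FF : Filter F) (u : T -> R[i]) (l : R[i]) :
  (u x : R[i]^o) @[x --> F] --> (l : R[i]^o) -> Re (u x) @[x --> F] --> Re l.
Proof.
move/cvgCP => h; apply/cvgrPdist_lt => e e0.
move/cvgrPdist_lt : h => /(_ _ e0); apply: filterS => x.
rewrite sub0r normrN ger0_norm ?nm_ge0// => /(le_lt_trans _); apply.
by rewrite distrC -cReB ler_norm_Re.
Qed.

Lemma cvgC_Im T (F : set_system T) (FF : Filter F) (u : T -> R[i]) (l : R[i]) :
  (u x : R[i]^o) @[x --> F] --> (l : R[i]^o) -> Im (u x) @[x --> F] --> Im l.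
Proof.
move/cvgCP => h; apply/cvgrPdist_lt => e e0.
move/cvgrPdist_lt : h => /(_ _ e0); apply: filterS => x.
rewrite sub0r normrN ger0_norm ?nm_ge0// => /(le_lt_trans _); apply.
by rewrite distrC -cImB ler_norm_Im.
Qed.

Lemma cvgC_real T (F : set_system T) (FF : Filter F) (u : T -> R) (l : R) :
  u x @[x --> F] --> l -> ((u x)%:C : R[i]^o) @[x --> F] --> (l%:C : R[i]^o).
Proof. by move=> h; apply: cvgC_ReIm => //=; exact: cvg_cst. Qed.

End complex_basics.

Section complex_integral.
Context {R : realType}.
Notation mu := (@lebesgue_measure R).
Implicit Types (f g : R -> R[i]) (h : R -> R).

Definition cmeas d (T : measurableType d) (f : T -> R[i]) :=
  measurable_fun setT (fun t => Re (f t)) /\ measurable_fun setT (fun t => Im (f t)).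

Definition ccont f :=
  continuous (fun t => Re (f t)) /\ continuous (fun t => Im (f t)).

Lemma ccont_meas f : ccont f -> cmeas f.
Proof. by case=> h1 h2; split; exact: continuous_measurable_fun. Qed.

Lemma cmeasM d (T : measurableType d) (f g : T -> R[i]) :
  cmeas f -> cmeas g -> cmeas (fun t => f t * g t).
Proof.
move=> [a b] [a' b']; split.
  under eq_fun do rewrite cReM.
  by apply: measurable_funB; apply: measurable_funM.
under eq_fun do rewrite cImM.
by apply: measurable_funD; apply: measurable_funM.
Qed.

Lemma cmeasD d (T : measurableType d) (f g : T -> R[i]) :
  cmeas f -> cmeas g -> cmeas (fun t => f t + g t).
Proof.
move=> [a b] [a' b']; split.
  by under eq_fun do rewrite cReD; apply: measurable_funD.
by under eq_fun do rewrite cImD; apply: measurable_funD.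
Qed.

Lemma cmeas_real d (T : measurableType d) (f : T -> R) :
  measurable_fun setT f -> cmeas (fun t => (f t)%:C).
Proof. by move=> mf; split => //=; exact: measurable_cst. Qed.

Lemma cmeas_cst d (T : measurableType d) (c : R[i]) : cmeas (fun _ : T => c).
Proof. by split; exact: measurable_cst. Qed.

Lemma ccontM f g : ccont f -> ccont g -> ccont (fun t => f t * g t).
Proof.
move=> [a b] [a' b']; split.
  under eq_fun do rewrite cReM.
  by move=> t; apply: cvgB; apply: cvgM; [exact: a|exact: a'|exact: b|exact: b'].
under eq_fun do rewrite cImM.
by move=> t; apply: cvgD; apply: cvgM; [exact: a|exact: b'|exact: b|exact: a'].
Qed.

Lemma ccontD f g : ccont f -> ccont g -> ccont (fun t => f t + g t).
Proof.
move=> [a b] [a' b']; split.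
  by under eq_fun do rewrite cReD; move=> t; apply: cvgD; [exact: a|exact: a'].
by under eq_fun do rewrite cImD; move=> t; apply: cvgD; [exact: b|exact: b'].
Qed.

Lemma ccont_real h : continuous h -> ccont (fun t => (h t)%:C).
Proof. by move=> ch; split => //= t; exact: cvg_cst. Qed.

Lemma ccont_cst (c : R[i]) : ccont (fun=> c).
Proof. by split=> t; exact: cvg_cst. Qed.

Lemma ccont_id : ccont (fun t => t%:C).
Proof. by apply: ccont_real => t; exact: cvg_id. Qed.

Lemma ccont_cexp f : ccont f -> ccont (fun t => cexp (f t)).
Proof.
move=> [a b]; split.
  under eq_fun do rewrite Re_cexp.
  move=> t; apply: cvgM; apply: continuous_comp.
  - exact: a.
  - exact: continuous_expR.
  - exact: b.
  - exact: continuous_cos.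
under eq_fun do rewrite Im_cexp.
move=> t; apply: cvgM; apply: continuous_comp.
- exact: a.
- exact: continuous_expR.
- exact: b.
- exact: continuous_sin.
Qed.

Lemma ccont_comp f h : ccont f -> continuous h -> ccont (fun t => f (h t)).
Proof.
move=> [a b] ch; split=> t.
  by apply: (@continuous_comp _ _ _ h (fun t => Re (f t))); [exact: ch|exact: a].
by apply: (@continuous_comp _ _ _ h (fun t => Im (f t))); [exact: ch|exact: b].
Qed.

Definition cint f : R[i] := cintegral setT f.
Definition cintg f : Prop := cintegrable setT f.

Lemma cintgP f : intg (fun t => Re (f t)) -> intg (fun t => Im (f t)) -> cintg f.
Proof. by []. Qed.

Lemma Re_cint f : Re (cint f) = \int[mu]_t Re (f t). Proof. by []. Qed.
Lemma Im_cint f : Im (cint f) = \int[mu]_t Im (f t). Proof. by []. Qed.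

Lemma eq_cint f g : f =1 g -> cint f = cint g.
Proof. by move=> /funext ->. Qed.

Lemma cintg_le f h : cmeas f -> (forall t, nm (f t) <= h t) -> intg h -> cintg f.
Proof.
move=> [a b] fh ih; split; apply: intg_le ih => // t.
  exact: le_trans (ler_norm_Re _) (fh t).
exact: le_trans (ler_norm_Im _) (fh t).
Qed.

Lemma nm_cint_le f h : cmeas f -> (forall t, nm (f t) <= h t) -> intg h ->
  nm (cint f) <= 2 * \int[mu]_t h t.
Proof.
move=> [a b] fh ih; apply: le_trans (nm_le _) _; rewrite Re_cint Im_cint.
have h1 : `|\int[mu]_t Re (f t)| <= \int[mu]_t h t.
  by apply: Rintg_norm => // t; exact: le_trans (ler_norm_Re _) (fh t).
have h2 : `|\int[mu]_t Im (f t)| <= \int[mu]_t h t.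
  by apply: Rintg_norm => // t; exact: le_trans (ler_norm_Im _) (fh t).
lra.
Qed.

Lemma cintgD f g : cintg f -> cintg g -> cintg (fun t => f t + g t).
Proof.
move=> [a b] [a' b']; apply: cintgP.
  by under eq_fun do rewrite cReD; exact: intgD.
by under eq_fun do rewrite cImD; exact: intgD.
Qed.

Lemma cintD f g : cintg f -> cintg g -> cint (fun t => f t + g t) = cint f + cint g.
Proof.
move=> [a b] [a' b']; apply: complex_ext; rewrite ?cReD ?cImD ?(Re_cint, Im_cint).
  by under eq_Rintegral do rewrite cReD; exact: RintgD.
by under eq_Rintegral do rewrite cImD; exact: RintgD.
Qed.

Lemma cintgZ c f : cintg f -> cintg (fun t => c * f t).
Proof.
move=> [a b]; apply: cintgP.
  by under eq_fun do rewrite cReM; apply: intgB; exact: intgZ.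
by under eq_fun do rewrite cImM; apply: intgD; exact: intgZ.
Qed.

Lemma cintZ c f : cintg f -> cint (fun t => c * f t) = c * cint f.
Proof.
move=> [a b]; apply: complex_ext; rewrite ?cReM ?cImM ?(Re_cint, Im_cint).
  under eq_Rintegral do rewrite cReM.
  by rewrite RintgB ?RintgZ//; exact: intgZ.
under eq_Rintegral do rewrite cImM.
by rewrite RintgD ?RintgZ//; exact: intgZ.
Qed.

Lemma cintB f g : cintg f -> cintg g -> cint (fun t => f t - g t) = cint f - cint g.
Proof.
move=> hf hg; rewrite -(mulN1r (cint g)) -cintZ// -cintD//; last exact: cintgZ.
by apply: eq_cint => t; rewrite mulN1r.
Qed.

Lemma cintgN f : cintg f -> cintg (fun t => - f t).
Proof.
by move=> hf; under eq_fun do rewrite -mulN1r; exact: cintgZ.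
Qed.

Lemma cint_real h : cint (fun t => (h t)%:C) = (\int[mu]_t h t)%:C.
Proof.
by apply: complex_ext; rewrite ?Re_cint ?Im_cint //= Rintegral_cst// mul0r.
Qed.

Lemma cint_affine (k s : R) f : 0 < k -> ccont f ->
  cint f = cint (fun t => k%:C * f (k * t + s)).
Proof.
move=> k0 [a b]; apply: complex_ext; rewrite ?(Re_cint, Im_cint).
  rewrite (@Rintg_affine _ k s (fun t => Re (f t)))//; apply: eq_Rintg => t.
  by rewrite cReMr mulrC.
rewrite (@Rintg_affine _ k s (fun t => Im (f t)))//; apply: eq_Rintg => t.
by rewrite cImMr mulrC.
Qed.

Lemma cint_shift (s : R) f : ccont f -> cint f = cint (fun t => f (t + s)).
Proof.
move=> cf; rewrite (@cint_affine 1 s)//.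
by apply: eq_cint => t; rewrite !mul1r.
Qed.

Lemma cint_oppr f : ccont f -> cint f = cint (fun t => f (- t)).
Proof.
move=> [a b]; apply: complex_ext; rewrite ?(Re_cint, Im_cint).
  exact: (Rintg_oppr a).
exact: (Rintg_oppr b).
Qed.

Lemma cfubini (F : R -> R -> R[i]) (g1 g2 : R -> R) :
  cmeas (fun p : R * R => F p.1 p.2) -> intg g1 -> intg g2 ->
  (forall s t, nm (F s t) <= g1 s * g2 t) ->
  [/\ cintg (fun s => cint (F s)), cintg (fun t => cint (F ^~ t)) &
   cint (fun s => cint (F s)) = cint (fun t => cint (F ^~ t))].
Proof.
move=> [a b] i1 i2 bF.
have [r1 r2 r3] := @Rfubini _ (fun s t => Re (F s t)) g1 g2 a i1 i2
  (fun s t => le_trans (ler_norm_Re _) (bF s t)).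
have [m1 m2 m3] := @Rfubini _ (fun s t => Im (F s t)) g1 g2 b i1 i2
  (fun s t => le_trans (ler_norm_Im _) (bF s t)).
split; [exact: (conj r1 m1)|exact: (conj r2 m2)|].
by apply: complex_ext; [exact: r3|exact: m3].
Qed.

Lemma cdct (f_ : nat -> R -> R[i]) f h :
  (forall n, cmeas (f_ n)) ->
  (forall t, (f_ n t : R[i]^o) @[n --> \oo] --> (f t : R[i]^o)) ->
  (forall n t, nm (f_ n t) <= h t) -> intg h ->
  cintg f /\ (cint (f_ n) : R[i]^o) @[n --> \oo] --> (cint f : R[i]^o).
Proof.
move=> mf cf fh ih.
have [r1 r2] := @Rdct _ (fun n t => Re (f_ n t)) (fun t => Re (f t)) h
  (fun n => (mf n).1) (fun t => cvgC_Re _ (cf t)) (fun n t => le_trans (ler_norm_Re _) (fh n t)) ih.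
have [m1 m2] := @Rdct _ (fun n t => Im (f_ n t)) (fun t => Im (f t)) h
  (fun n => (mf n).2) (fun t => cvgC_Im _ (cf t)) (fun n t => le_trans (ler_norm_Im _) (fh n t)) ih.
by split=> //; apply: cvgC_ReIm.
Qed.

End complex_integral.

(** * Bessel functions as exponential integrals *)

Section exponential_kernels.
Context {R : realType}.
Notation mu := (@lebesgue_measure R).
Implicit Types (c m b q u y s t : R) (w z : R[i]).

Lemma expR_expR_le c m : 0 < c -> 0 <= m ->
  exists2 K, 0 <= K & forall y, expR (- (c * expR y)) <= K * expR (- (m * y)).
Proof.
move=> c0 m0; pose n := Num.truncn m; have mn : m < n.+1%:R by exact: truncnS_gt.
have K0 : 0 <= (n.+1)`!%:R / c ^+ n.+1 by rewrite divr_ge0// exprn_ge0// ltW.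
exists (1 + (n.+1)`!%:R / c ^+ n.+1); first by rewrite addr_ge0.
move=> y; have [y0|y0] := leP 0 y; last first.
  apply: (@le_trans _ _ 1); first by rewrite expR_le1 oppr_le0 mulr_ge0 ?expR_ge0// ltW.
  rewrite -[leLHS]mulr1 ler_pM//; first by rewrite lerDl.
  by rewrite -expR0 ler_expR oppr_ge0 nmulr_lle0.
have u0 : 0 < c * expR y by rewrite mulr_gt0// expR_gt0.
have h : expR (- (c * expR y)) <= (n.+1)`!%:R / c ^+ n.+1 * expR (- (n.+1%:R * y)).
  have := expR_ge1Dxn n (ltW u0) => h.
  rewrite !expRN -[leRHS]invrK lef_pV2 ?posrE ?expR_gt0//; last first.
    by rewrite invr_gt0 mulr_gt0 ?invr_gt0 ?expR_gt0// divr_gt0// ?exprn_gt0// ltr0n fact_gt0.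
  rewrite !invfM !invrK expRM_natl; apply: le_trans h.
  rewrite exprMn; apply: (@le_trans _ _ (c ^+ n.+1 * expR y ^+ n.+1 / (n.+1)`!%:R)); last by rewrite lerDr.
  by rewrite -mulrA mulrC.
apply: le_trans h _; apply: ler_pM; rewrite ?expR_ge0//.
  by rewrite lerDr.
by rewrite ler_expR lerN2 ler_wpM2r// ltW.
Qed.

Lemma gexp_decay b c : 0 < b -> 0 < c ->
  exists C, forall t, expR (b * t - c * expR t) <= C * expR (- (b * `|t|)).
Proof.
move=> b0 c0; have [K K0 HK] := @expR_expR_le c (2 * b) c0 (mulr_ge0 (ler0n _ 2) (ltW b0)).
exists (1 + K) => t; have [t0|t0] := leP 0 t.
  apply: (@le_trans _ _ (K * expR (- (b * t)))); last first.
    by rewrite (ger0_norm t0) ler_pM2r ?expR_gt0// lerDr.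
  rewrite expRD; apply: le_trans (ler_wpM2l (expR_ge0 _) (HK t)) _.
  by rewrite mulrCA -expRD ler_wpM2l// ler_expR; lra.
apply: (@le_trans _ _ (1 * expR (b * t))).
  by rewrite mul1r ler_expR lerBlDr lerDl mulr_ge0 ?expR_ge0// ltW.
by rewrite (ltr0_norm t0) mulrN opprK ler_pM2r ?expR_gt0// lerDl.
Qed.

Lemma hexp_decay u q : 0 < q ->
  exists C, forall t, expR (u * t - expR t - q * expR (- t)) <= C * expR (- (1 * `|t|)).
Proof.
move=> q0; have m0 : 0 <= `|u| + 1 by rewrite addr_ge0.
have [K K0 HK] := @expR_expR_le 1 (`|u| + 1) ltr01 m0.
have [K' K'0 HK'] := @expR_expR_le q (`|u| + 1) q0 m0.
exists (K + K') => t; have [t0|t0] := leP 0 t.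
  apply: (@le_trans _ _ (K * expR (- (1 * t)))); last first.
    by rewrite (ger0_norm t0) ler_pM2r ?expR_gt0// lerDl.
  have h := HK t; rewrite mul1r in h.
  apply: (@le_trans _ _ (expR (u * t) * expR (- expR t))).
    by rewrite -expRD ler_expR lerBlDr lerDl mulr_ge0 ?expR_ge0// ltW.
  apply: le_trans (ler_wpM2l (expR_ge0 _) h) _.
  rewrite mulrCA -expRD ler_wpM2l// ler_expR.
  have : u * t <= `|u| * t by rewrite ler_wpM2r// ler_norm.
  lra.
apply: (@le_trans _ _ (K' * expR t)); last first.
  by rewrite (ltr0_norm t0) mul1r opprK ler_pM2r ?expR_gt0// lerDr.
apply: (@le_trans _ _ (expR (u * t) * expR (- (q * expR (- t))))).
  by rewrite -expRD ler_expR; have := expR_ge0 t; lra.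
apply: le_trans (ler_wpM2l (expR_ge0 _) (HK' (- t))) _.
rewrite mulrCA -expRD ler_wpM2l// ler_expR.
have hu : - `|u| <= u by rewrite lerNl -normrN ler_norm.
have := ler_wnM2r (ltW t0) hu.
lra.
Qed.

Lemma intg_gexp b c : 0 < b -> 0 < c -> intg (fun t => expR (b * t - c * expR t)).
Proof.
move=> b0 c0; have [C HC] := gexp_decay b0 c0.
apply: (intg_decay b0 _ (C := C)); last by move=> t; rewrite ger0_norm ?expR_ge0.
apply: continuous_measurable_fun => t.
apply: continuous_comp; last exact: continuous_expR.
apply: cvgB; apply: cvgM; [exact: cvg_cst|exact: cvg_id|exact: cvg_cst|exact: continuous_expR].
Qed.

Definition hker w q t : R[i] :=
  cexp (w * t%:C) * (expR (- expR t - q * expR (- t)))%:C.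

(* In logarithmic coordinates, Gamma(w) is Hint w 0. *)
Definition Hint w q := cint (hker w q).

Lemma nm_hker w q t : nm (hker w q t) = expR (Re w * t - expR t - q * expR (- t)).
Proof.
by rewrite /hker nmM nm_cexp nm_real ger0_norm ?expR_ge0// -expRD cReMl addrA.
Qed.

Lemma ccont_hker w q : ccont (hker w q).
Proof.
apply: ccontM.
  by apply: ccont_cexp; apply: ccontM; [exact: ccont_cst|exact: ccont_id].
apply: ccont_real => t; apply: continuous_comp; last exact: continuous_expR.
apply: cvgB; first by apply: cvgN; exact: continuous_expR.
apply: cvgM; first exact: cvg_cst.
by apply: continuous_comp; [exact: oppr_continuous|exact: continuous_expR].
Qed.

Definition hadm w q := [|| 0 < q | (q == 0) && (0 < Re w)].

Lemma hker_decay w q : hadm w q -> exists C, exists2 d, 0 < d &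
  forall t, nm (hker w q t) <= C * expR (- (d * `|t|)).
Proof.
case/orP => [q0|/andP[/eqP -> w0]].
  have [C HC] := hexp_decay (Re w) q0; exists C, 1 => // t.
  by rewrite nm_hker.
have [C HC] := gexp_decay w0 ltr01; exists C, (Re w) => // t.
by rewrite nm_hker mul0r subr0; move: (HC t); rewrite mul1r.
Qed.

Lemma cintg_hker w q : hadm w q -> cintg (hker w q).
Proof.
move=> /hker_decay[C [d d0 HC]].
apply: (@cintg_le _ _ (fun t => C * expR (- (d * `|t|)))) => //.
  exact/ccont_meas/ccont_hker.
exact: intgZ (intg_expabs d0).
Qed.

Lemma cvg_decay (f : R -> R) (C d : R) : 0 < d ->
  (forall t, `|f t| <= C * expR (- (d * `|t|))) ->
  f t @[t --> +oo] --> (0 : R) /\ f (- t) @[t --> +oo] --> (0 : R).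
Proof.
move=> d0 H.
have L : C * expR (- (d * t)) @[t --> +oo] --> (0 : R).
  by rewrite -(mulr0 C); apply: cvgM; [exact: cvg_cst|exact: cvg_expRMN].
have H1 (g : R -> R) : (forall t, `|g t| <= C * expR (- (d * `|t|))) ->
    g t @[t --> +oo] --> (0 : R).
  move=> Hg; apply/norm_cvg0P; apply: squeeze_cvgr (cvg_cst 0) L.
  near=> t; rewrite normr_ge0 /=.
  have t0 : 0 <= t by near: t; exact: nbhs_pinfty_ge.
  by have := Hg t; rewrite (ger0_norm t0).
split; apply: H1 => // t; rewrite -(normrN t); exact: H.
Unshelve. all: by end_near. Qed.

Lemma is_derive_hker_exponent u q t :
  is_derive t (1 : R) (fun t => expR (u * t - expR t - q * expR (- t)))
    ((u - expR t + q * expR (- t)) * expR (u * t - expR t - q * expR (- t))).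
Proof.
apply: is_derive_eq.
rewrite -[LHS]/(expR (u * t - expR t - q * expR (- t)) * (u * 1 - expR t - q * (expR (- t) * -1))).
by ring.
Qed.

Lemma is_derive_cis v t :
  is_derive t (1 : R) (fun t => cos (v * t)) (- v * sin (v * t)) /\
  is_derive t (1 : R) (fun t => sin (v * t)) (v * cos (v * t)).
Proof.
split; apply: is_derive_eq.
  by rewrite -[LHS]/(- sin (v * t) * (v * 1)); ring.
by rewrite -[LHS]/(cos (v * t) * (v * 1)); ring.
Qed.

Lemma Re_hker w q t : Re (hker w q t) =
  expR (Re w * t - expR t - q * expR (- t)) * cos (Im w * t).
Proof.
by rewrite /hker cReMl Re_cexp cReMl cImMl mulrAC -expRD addrA.
Qed.

Lemma Im_hker w q t : Im (hker w q t) =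
  expR (Re w * t - expR t - q * expR (- t)) * sin (Im w * t).
Proof.
by rewrite /hker cImMl Im_cexp cReMl cImMl mulrAC -expRD addrA.
Qed.

Lemma hker_shift w z q t : hker (w + z) q t = cexp (z * t%:C) * hker w q t.
Proof. by rewrite /hker mulrDl cexpD mulrA (mulrC (cexp (w * _))). Qed.

Lemma hker_shift1 w q t : hker (w + 1) q t = (expR t)%:C * hker w q t.
Proof. by rewrite hker_shift mul1r cexp_real. Qed.

Lemma hker_shiftN1 w q t : hker (w - 1) q t = (expR (- t))%:C * hker w q t.
Proof. by rewrite hker_shift mulN1r -rcN cexp_real. Qed.

Lemma hadm_shift1 w q : hadm w q -> hadm (w + 1) q.
Proof.
case/orP => [q0|/andP[q0 w0]]; apply/orP; [by left|right].
by rewrite q0 /= cReD addr_gt0.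
Qed.

Lemma hadm_shift1N w q : hadm w q -> cintg (fun t => q%:C * hker (w - 1) q t).
Proof.
case/orP => [q0|/andP[/eqP -> w0]].
  by apply/cintgZ/cintg_hker; rewrite /hadm q0.
apply: (@cintg_le _ _ (fun=> 0)).
- by apply: cmeasM; [exact: cmeas_cst|exact/ccont_meas/ccont_hker].
- by move=> t; rewrite mul0r nm0.
- exact: integrable0.
Qed.

(* Integration by parts: the integral of d/dt [exp(wt - e^t - q e^-t)] is 0. *)
Lemma Hint_ibp w q : hadm w q ->
  cint (fun t => w * hker w q t - hker (w + 1) q t + q%:C * hker (w - 1) q t) = 0.
Proof.
move=> adm.
have i1 := cintg_hker adm; have i2 := cintg_hker (hadm_shift1 adm).
have i3 := hadm_shift1N adm.
have [C [d d0 HC]] := hker_decay adm.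
have [C1 [d1 d10 HC1]] := hker_decay (hadm_shift1 adm).
have [C2 [d2 d20 HC2]] : exists C, exists2 d, 0 < d &
    forall t, nm (q%:C * hker (w - 1) q t) <= C * expR (- (d * `|t|)).
  case/orP : adm => [q0|/andP[/eqP -> w0]].
    have [C' [d' d'0 HC']] := @hker_decay (w - 1) q ltac:(by rewrite /hadm q0).
    exists (q * C'), d' => // t; rewrite nmM nm_real (gtr0_norm q0) -mulrA.
    by rewrite ler_wpM2l// ltW.
  by exists 0, 1 => // t; rewrite mul0r nm0 mul0r.
set D := Num.min d (Num.min d1 d2).
have D0 : 0 < D by rewrite !lt_min d0 d10 d20.
have C_ge0 (f : R -> R[i]) (C' d' : R) : (forall t, nm (f t) <= C' * expR (- (d' * `|t|))) -> 0 <= C'.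
  by move=> /(_ 0); rewrite normr0 mulr0 oppr0 expR0 mulr1; apply: le_trans; exact: nm_ge0.
have D_le (C' d' t : R) : 0 <= C' -> D <= d' -> C' * expR (- (d' * `|t|)) <= C' * expR (- (D * `|t|)).
  by move=> C'0 Dd; rewrite ler_wpM2l// ler_expR lerN2 ler_wpM2r.
pose g t := w * hker w q t - hker (w + 1) q t + q%:C * hker (w - 1) q t.
have gE t : g t = (w - (expR t)%:C + q%:C * (expR (- t))%:C) * hker w q t.
  by rewrite /g hker_shift1 hker_shiftN1; ring.
have cg : ccont g.
  apply: ccontD; [apply: ccontD|].
  - by apply: ccontM; [exact: ccont_cst|exact: ccont_hker].
  - have -> : (fun t => - hker (w + 1) q t) = (fun t => (- 1) * hker (w + 1) q t).
      by apply/funext => t; rewrite mulN1r.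
    by apply: ccontM; [exact: ccont_cst|exact: ccont_hker].
  - by apply: ccontM; [exact: ccont_cst|exact: ccont_hker].
have bg t : nm (g t) <= (nm w * C + C1 + C2) * expR (- (D * `|t|)).
  apply: le_trans (ler_nmD _ _) _.
  apply: le_trans (lerD (ler_nmB _ _) (lexx _)) _.
  rewrite !mulrDl nmM -mulrA; apply: lerD; first apply: lerD.
  - rewrite ler_wpM2l ?nm_ge0//; apply: le_trans (HC t) _; apply: D_le; first exact: C_ge0 HC.
    by rewrite ge_min lexx.
  - apply: le_trans (HC1 t) _; apply: D_le; first exact: C_ge0 HC1.
    by rewrite !ge_min lexx orbT.
  - apply: le_trans (HC2 t) _; apply: D_le; first exact: C_ge0 HC2.
    by rewrite !ge_min lexx !orbT.
have bh t : nm (hker w q t) <= C * expR (- (D * `|t|)).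
  apply: le_trans (HC t) _; apply: D_le; first exact: C_ge0 HC.
  by rewrite ge_min lexx.
have dR t : is_derive t (1 : R) (fun t => Re (hker w q t)) (Re (g t)).
  have [dc ds] := is_derive_cis (Im w) t.
  have := is_deriveM (is_derive_hker_exponent (Re w) q t) dc.
  have -> : (fun t => expR (Re w * t - expR t - q * expR (- t))) * (fun t => cos (Im w * t)) =
      (fun t => Re (hker w q t)).
    by apply/funext => s; rewrite Re_hker.
  move=> h; apply: is_derive_eq h _.
  rewrite gE cReM Re_hker Im_hker !(cReD, cImD, cReN, cImN, cReMr, cImMr) /=.
  by rewrite /GRing.scale /=; ring.
have dI t : is_derive t (1 : R) (fun t => Im (hker w q t)) (Im (g t)).
  have [dc ds] := is_derive_cis (Im w) t.
  have := is_deriveM (is_derive_hker_exponent (Re w) q t) ds.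
  have -> : (fun t => expR (Re w * t - expR t - q * expR (- t))) * (fun t => sin (Im w * t)) =
      (fun t => Im (hker w q t)).
    by apply/funext => s; rewrite Im_hker.
  move=> h; apply: is_derive_eq h _.
  rewrite gE cImM Re_hker Im_hker !(cReD, cImD, cReN, cImN, cReMr, cImMr) /=.
  by rewrite /GRing.scale /=; ring.
have [r1 r2] := cvg_decay D0 (fun t => le_trans (ler_norm_Re _) (bh t)).
have [m1 m2] := cvg_decay D0 (fun t => le_trans (ler_norm_Im _) (bh t)).
apply: complex_ext.
  rewrite -[RHS](subrr (0 : R)) -[LHS]/(\int[mu]_t Re (g t)).
  by apply: (FTC_line D0 cg.1 dR _ r1 r2) => t; exact: le_trans (ler_norm_Re _) (bg t).
rewrite -[RHS](subrr (0 : R)) -[LHS]/(\int[mu]_t Im (g t)).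
by apply: (FTC_line D0 cg.2 dI _ m1 m2) => t; exact: le_trans (ler_norm_Im _) (bg t).
Qed.

Lemma Hint_rec w q : 0 < q -> Hint (w + 1) q = w * Hint w q + q%:C * Hint (w - 1) q.
Proof.
move=> q0; have adm z : hadm z q by rewrite /hadm q0.
have := Hint_ibp (adm w); rewrite cintD; last 2 first.
- by apply: cintgD; [exact/cintgZ/cintg_hker|exact/cintgN/cintg_hker/hadm_shift1].
- exact/cintgZ/cintg_hker.
rewrite cintB ?cintZ//; [|exact: cintg_hker..|exact/cintgZ/cintg_hker|exact: cintg_hker].
by rewrite -!/(Hint _ _) => /eqP; rewrite addrAC subr_eq0 => /eqP.
Qed.

Lemma Hint0_rec w : 0 < Re w -> Hint (w + 1) 0 = w * Hint w 0.
Proof.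
move=> w0; have adm : hadm w 0 by rewrite /hadm eqxx w0 orbT.
have := Hint_ibp adm; under eq_cint do rewrite mul0r addr0.
rewrite cintB ?cintZ//; [|exact: cintg_hker|exact/cintgZ/cintg_hker|exact/cintg_hker/hadm_shift1].
by rewrite -!/(Hint _ _) => /eqP; rewrite subr_eq0 => /eqP.
Qed.

End exponential_kernels.

Section complex_limits.
Context {R : realType}.
Implicit Types (u v : nat -> R[i]) (l k c : R[i]).

Definition ccvg u l := (u n : R[i]^o) @[n --> \oo] --> (l : R[i]^o).

Lemma ccvg_unique u l k : ccvg u l -> ccvg u k -> l = k.
Proof. by move=> h1 h2; exact: (cvg_unique _ h1 h2). Qed.

Lemma ccvg_lim u l : ccvg u l -> limn (u : nat -> R[i]^o) = l.
Proof. by move=> h; exact: (cvg_lim _ h). Qed.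

Lemma ccvgD u v l k : ccvg u l -> ccvg v k -> ccvg (fun n => u n + v n) (l + k).
Proof.
move=> hu hv; apply: cvgC_ReIm.
  under eq_fun do rewrite cReD.
  by rewrite cReD; apply: cvgD; [exact: cvgC_Re hu|exact: cvgC_Re hv].
under eq_fun do rewrite cImD.
by rewrite cImD; apply: cvgD; [exact: cvgC_Im hu|exact: cvgC_Im hv].
Qed.

Lemma ccvgM u v l k : ccvg u l -> ccvg v k -> ccvg (fun n => u n * v n) (l * k).
Proof.
move=> hu hv; apply: cvgC_ReIm.
  under eq_fun do rewrite cReM.
  rewrite cReM; apply: cvgB; apply: cvgM.
  - exact: cvgC_Re hu.
  - exact: cvgC_Re hv.
  - exact: cvgC_Im hu.
  - exact: cvgC_Im hv.
under eq_fun do rewrite cImM.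
rewrite cImM; apply: cvgD; apply: cvgM.
- exact: cvgC_Re hu.
- exact: cvgC_Im hv.
- exact: cvgC_Im hu.
- exact: cvgC_Re hv.
Qed.

Lemma ccvg_cst c : ccvg (fun=> c) c.
Proof. by apply: cvgC_ReIm; exact: cvg_cst. Qed.

Lemma ccvg_shift u l : ccvg (fun n => u n.+1) l <-> ccvg u l.
Proof. by rewrite /ccvg -(cvg_shiftS (u : nat -> R[i]^o)). Qed.

Lemma ccvg_le u l (e : nat -> R) : (forall n, nm (u n - l) <= e n) ->
  e n @[n --> \oo] --> (0 : R) -> ccvg u l.
Proof.
move=> ue e0; apply/cvgCP.
apply: (squeeze_cvgr _ (cvg_cst 0) e0); apply: nearW => n.
by rewrite nm_ge0 /=.
Qed.

Definition csums u l := ccvg (fun n => \sum_(0 <= k < n) u k) l.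

Lemma csums_lim u l : csums u l -> limn (series (u : nat -> R[i]^o)) = l.
Proof. exact: ccvg_lim. Qed.

Lemma csums_unique u l k : csums u l -> csums u k -> l = k.
Proof. exact: ccvg_unique. Qed.

Lemma csumsD u v l k : csums u l -> csums v k -> csums (fun n => u n + v n) (l + k).
Proof.
move=> hu hv; have := ccvgD hu hv; rewrite /csums.
by under [in X in _ -> X]eq_fun do rewrite big_split.
Qed.

Lemma csumsZ c u l : csums u l -> csums (fun n => c * u n) (c * l).
Proof.
move=> hu; have := ccvgM (@ccvg_cst c) hu; rewrite /csums.
by under [in X in _ -> X]eq_fun do rewrite -big_distrr.
Qed.

Lemma csums_shift u l : csums (fun n => u n.+1) l -> csums u (u 0%N + l).
Proof.
move=> h; apply/ccvg_shift.
have := ccvgD (@ccvg_cst (u 0%N)) h; rewrite /csums.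
by under [in X in _ -> X]eq_fun do rewrite big_nat_recl//.
Qed.

Lemma nm_sum (I : Type) (r : seq I) (P : pred I) (f : I -> R[i]) :
  nm (\sum_(i <- r | P i) f i) <= \sum_(i <- r | P i) nm (f i).
Proof.
elim/big_ind2 : _ => //; first by rewrite nm0.
by move=> x1 x2 y1 y2 h1 h2; apply: le_trans (ler_nmD _ _) _; exact: lerD.
Qed.

Lemma csums_dom u (v : nat -> R) (s : R) : (forall k : nat, nm (u k) <= v k) ->
  series v @ \oo --> s -> exists2 l, csums u l & nm l <= s.
Proof.
move=> uv vs.
have v0 (k : nat) : 0 <= v k by apply: le_trans (uv k); exact: nm_ge0.
have cR (f : nat -> R) : (forall k : nat, `|f k| <= v k) -> cvgn (series f).
  move=> fv; apply: normed_cvg; apply: (series_le_cvg _ v0 fv) => //.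
  by apply/cvg_ex; exists s.
have hr := cR (fun k : nat => Re (u k)) (fun k : nat => le_trans (ler_norm_Re _) (uv k)).
have hi := cR (fun k : nat => Im (u k)) (fun k : nat => le_trans (ler_norm_Im _) (uv k)).
have h : csums u (limn (series (fun k : nat => Re (u k))) +i* limn (series (fun k : nat => Im (u k)))).
  apply: cvgC_ReIm => /=.
    under eq_fun do rewrite (big_morph (@complex.Re R) (@cReD R) (erefl _)); exact: hr.
  under eq_fun do rewrite (big_morph (@complex.Im R) (@cImD R) (erefl _)); exact: hi.
eexists; first exact: h.
set l := (_ +i* _) in h *.
have hl : nm (\sum_(0 <= k < n) u k - l) @[n --> \oo] --> (0 : R) by apply/cvgCP.
have hs : nm (\sum_(0 <= k < n) u k - l) + series v n @[n --> \oo] --> 0 + s by exact: cvgD.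
rewrite -(add0r s) -(cvg_lim _ hs)//; apply: limr_ge; first by apply/cvg_ex; eexists; exact: hs.
apply: nearW => n.
have -> : l = - (\sum_(0 <= k < n) u k - l) + \sum_(0 <= k < n) u k by rewrite opprB subrK.
apply: le_trans (ler_nmD _ _) _; rewrite nmN lerD//.
  by rewrite opprB subrK.
by apply: le_trans (nm_sum _ _ _) _; apply: ler_sum => k _; exact: uv.
Qed.

End complex_limits.

(** * The Gamma function *)

Section gamma.
Context {R : realType}.
Notation mu := (@lebesgue_measure R).
Implicit Types (w nu : R[i]) (q c s t : R).

Lemma euler_integralE w : euler_integral w = Hint w 0.
Proof.
pose f t := cpow t (w - 1) * (expR (- t))%:C.
have cln (t : R) : 0 < t -> {for t, continuous (@ln R)} by exact: continuous_ln.
have fE t : f (expR t) * (expR t)%:C = hker w 0 t.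
  rewrite /f /cpow /hker expRK mul0r subr0 mulrAC -cexp_real -cexpD; congr (cexp _ * _).
  by ring.
have cf t : 0 < t -> {for t, continuous (fun t => Re (f t))} /\
                    {for t, continuous (fun t => Im (f t))}.
  move=> t0.
  have cl : {for t, continuous (fun t => Re (w - 1) * ln t)}.
    by apply: cvgM; [exact: cvg_cst|exact: cln].
  have cl' : {for t, continuous (fun t => Im (w - 1) * ln t)}.
    by apply: cvgM; [exact: cvg_cst|exact: cln].
  have ce : {for t, continuous (fun t : R => expR (- t))}.
    by apply: continuous_comp; [exact: oppr_continuous|exact: continuous_expR].
  split.
    have -> : (fun t => Re (f t)) = (fun t => expR (Re (w - 1) * ln t) * cos (Im (w - 1) * ln t) * expR (- t)).
      by apply/funext => u; rewrite /f /cpow cReMl Re_cexp cReMl cImMl.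
    apply: cvgM => //; apply: cvgM.
      by apply: (continuous_comp cl); exact: continuous_expR.
    by apply: (continuous_comp cl'); exact: continuous_cos.
  have -> : (fun t => Im (f t)) = (fun t => expR (Re (w - 1) * ln t) * sin (Im (w - 1) * ln t) * expR (- t)).
    by apply/funext => u; rewrite /f /cpow cImMl Im_cexp cReMl cImMl.
  apply: cvgM => //; apply: cvgM.
    by apply: (continuous_comp cl); exact: continuous_expR.
  by apply: (continuous_comp cl'); exact: continuous_sin.
apply: complex_ext.
  rewrite -[LHS]/(\int[mu]_(t in `]0, +oo[) Re (f t)) -[RHS]/(\int[mu]_t Re (hker w 0 t)).
  rewrite /Rintegral (@integral_expR_subst R (fun t => Re (f t)) (fun t ht => (cf _ ht).1)); congr fine.
  by apply: eq_integral => t _; rewrite -cReMl fE.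
rewrite -[LHS]/(\int[mu]_(t in `]0, +oo[) Im (f t)) -[RHS]/(\int[mu]_t Im (hker w 0 t)).
rewrite /Rintegral (@integral_expR_subst R (fun t => Im (f t)) (fun t ht => (cf _ ht).2)); congr fine.
by apply: eq_integral => t _; rewrite -cImMl fE.
Qed.

Lemma Gamma_pos w : 0 < Re w -> Gamma w = Hint w 0.
Proof.
move=> w0; rewrite /Gamma.
have -> : Num.truncn (1 - Re w) = 0%N by apply/truncn0Pn; rewrite -ltNge; lra.
by rewrite addr0 /pochhammer big_geq// invr1 mulr1 euler_integralE.
Qed.

Lemma Gamma_strip w : -1 < Re w -> w != 0 -> Gamma w = Hint (1 + w) 0 / w.
Proof.
move=> w1 w0; have [wp|wn] := ltP 0 (Re w).
  by rewrite Gamma_pos// (addrC 1) Hint0_rec// mulrC mulKf.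
rewrite /Gamma.
have -> : Num.truncn (1 - Re w) = 1%N by apply: truncn_def; apply/andP; split; lra.
by rewrite /pochhammer big_nat1 addr0 euler_integralE (addrC 1).
Qed.

Lemma Gamma_rec w : 0 < Re w -> Gamma (w + 1) = w * Gamma w.
Proof.
by move=> w0; rewrite !Gamma_pos ?Hint0_rec// cReD /= addr_gt0.
Qed.

Lemma Gamma_pochhammer w n : 0 < Re w -> Gamma (w + n%:R) = pochhammer w n * Gamma w.
Proof.
move=> w0; elim: n => [|n IH]; first by rewrite addr0 /pochhammer big_geq// mul1r.
rewrite -natr1 addrA Gamma_rec; last by rewrite cReD -rc_nat /= ltr_wpDr ?ler0n.
by rewrite IH /pochhammer big_nat_recr//= mulrA [in RHS]mulrAC -mulrA mulrC mulrAC.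
Qed.

Definition gker w c t : R[i] := cexp (w * t%:C) * (expR (- (c * expR t)))%:C.

Lemma nm_gker w c t : nm (gker w c t) = expR (Re w * t - c * expR t).
Proof.
by rewrite /gker nmM nm_cexp nm_real ger0_norm ?expR_ge0// -expRD cReMl.
Qed.

Lemma ccont_gker w c : ccont (gker w c).
Proof.
apply: ccontM.
  by apply: ccont_cexp; apply: ccontM; [exact: ccont_cst|exact: ccont_id].
apply: ccont_real => t; apply: continuous_comp; last exact: continuous_expR.
by apply: cvgN; apply: cvgM; [exact: cvg_cst|exact: continuous_expR].
Qed.

Lemma cintg_gker w c : 0 < Re w -> 0 < c -> cintg (gker w c).
Proof.
move=> w0 c0; apply: cintg_le (intg_gexp w0 c0).
  exact/ccont_meas/ccont_gker.
by move=> t; rewrite nm_gker.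
Qed.

Lemma cint_gker w c : 0 < Re w -> 0 < c ->
  cint (gker w c) = cexp (- (w * (ln c)%:C)) * Gamma w.
Proof.
move=> w0 c0; rewrite Gamma_pos// /Hint (cint_shift (ln c) (ccont_hker w 0)).
rewrite cexpN; apply: (mulfI (cexp_neq0 (w * (ln c)%:C))).
rewrite mulrA mulfV; last exact: cexp_neq0.
rewrite mul1r -(cintZ _ (cintg_gker w0 c0)).
apply: eq_cint => t; rewrite /gker /hker mul0r subr0 expRD lnK ?posrE//.
by rewrite rcD mulrDr cexpD (mulrC (expR t)) mulrA [in RHS](mulrC (cexp (w * t%:C))).
Qed.

Lemma Hint_reflect w q : 0 < q -> Hint (- w) q = cexp (- (w * (ln q)%:C)) * Hint w q.
Proof.
move=> q0; rewrite /Hint -cintZ; last by apply: cintg_hker; rewrite /hadm q0.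
rewrite (cint_oppr (ccont_hker (- w) q)) (@cint_shift _ (- ln q)); last first.
  by apply: ccont_comp; [exact: ccont_hker|exact: oppr_continuous].
apply: eq_cint => t; rewrite /hker !opprB.
have E1 : expR (ln q - t) = q * expR (- t) by rewrite expRD lnK.
have E2 : q * expR (t - ln q) = expR t.
  by rewrite expRD expRN lnK// mulrCA mulfV ?gt_eqF// mulr1.
rewrite E1 E2 mulrA -cexpD; congr (cexp _ * (expR _)%:C); last by ring.
by rewrite rcB; ring.
Qed.

Definition rGamma (u : R) := \int[mu]_t expR (u * t - 1 * expR t).

Lemma gker_real u c t : gker u%:C c t = (expR (u * t - c * expR t))%:C.
Proof. by rewrite /gker -rcM cexp_real -rcM -expRD. Qed.

Lemma Gamma_real u : 0 < u -> Gamma u%:C = (rGamma u)%:C.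
Proof.
move=> u0; have := @cint_gker u%:C 1 u0 ltr01.
rewrite ln1 mulr0 oppr0 cexp0 mul1r => <-.
by rewrite -cint_real; apply: eq_cint => t; rewrite gker_real.
Qed.

Lemma rGamma_rec u : 0 < u -> rGamma (u + 1) = u * rGamma u.
Proof.
move=> u0; apply: complexI; rewrite rcM -!Gamma_real// ?addr_gt0// rcD Gamma_rec//.
Qed.

Lemma rGamma_ge0 u : 0 <= rGamma u.
Proof. by apply: Rintegral_ge0 => t _; exact: expR_ge0. Qed.

Lemma nm_Gamma_le w : 0 < Re w -> nm (Gamma w) <= 2 * rGamma (Re w).
Proof.
move=> w0; rewrite Gamma_pos//; apply: nm_cint_le.
- exact/ccont_meas/ccont_hker.
- by move=> t; rewrite nm_hker mul0r subr0 mul1r.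
- exact: intg_gexp.
Qed.

(* From 1 - exp(- q e^-t) <= q e^-t. *)
Lemma Hint_small w q : 0 < q -> 1 < Re w ->
  nm (Hint w q - Gamma w) <= 2 * (q * rGamma (Re w - 1)).
Proof.
move=> q0 w1; have w0 : 0 < Re w by apply: lt_trans w1.
have w1' : 0 < Re w - 1 by rewrite subr_gt0.
rewrite Gamma_pos// -cintB; last 2 first.
- by apply: cintg_hker; rewrite /hadm q0.
- by apply: cintg_hker; rewrite /hadm eqxx w0 orbT.
rewrite /rGamma -RintgZ; last exact: intg_gexp.
apply: nm_cint_le; last by apply: intgZ; exact: intg_gexp.
  apply: cmeasD; first exact/ccont_meas/ccont_hker.
  have -> : (fun t => - hker w 0 t) = (fun t => (- 1) * hker w 0 t).
    by apply/funext => t; rewrite mulN1r.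
  by apply: cmeasM; [exact: cmeas_cst|exact/ccont_meas/ccont_hker].
move=> t; rewrite /hker -mulrBr nmM nm_cexp cReMl -rcB nm_real.
set e := expR (- t).
have e0 : 0 < e by exact: expR_gt0.
rewrite mul0r subr0 expRD -[X in _ - X]mulr1 -mulrBr normrM ger0_norm ?expR_ge0//.
rewrite mulrA -expRD distrC ger0_norm; last first.
  by rewrite subr_ge0 expR_le1 oppr_le0 mulr_ge0 ?ltW.
have -> : expR ((Re w - 1) * t - 1 * expR t) = expR (Re w * t - expR t) * e.
  by rewrite -expRD; congr expR; ring.
rewrite mulrCA ler_wpM2l ?expR_ge0//.
by have := expR_ge1Dx (- (q * e)); lra.
Qed.

End gamma.

(** * The 0F1 series and the connection formula *)

Section hypergeometric.
Context {R : realType}.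
Implicit Types (a b c w z nu l : R[i]) (x q d : R) (k n j : nat).

Lemma pochhammer0 a : pochhammer a 0 = 1.
Proof. by rewrite /pochhammer big_geq. Qed.

Lemma pochhammerS a k : pochhammer a k.+1 = pochhammer a k * (a + k%:R).
Proof. by rewrite /pochhammer big_nat_recr. Qed.

Lemma pochhammerSl a k : pochhammer a k.+1 = a * pochhammer (a + 1) k.
Proof.
rewrite /pochhammer big_nat_recl// addr0; congr (_ * _).
by apply: eq_bigr => i _; rewrite -addrA -natr1 (addrC 1).
Qed.

Definition phit b q k : R[i] := (q ^+ k / k`!%:R)%:C / pochhammer b k.

(* The confluent limit function 0F1(; b; q). *)
Definition phi b q : R[i] := limn (series (phit b q : nat -> R[i]^o)).

Definition away d b := 0 < d /\ forall j, d <= nm (b + j%:R).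

Lemma away_neq0 d b j : away d b -> b + j%:R != 0.
Proof. by case=> d0 db; rewrite -nm_gt0; exact: lt_le_trans d0 (db j). Qed.

Lemma awayS d b : away d b -> away d (b + 1).
Proof.
case=> d0 db; split => // j; have := db j.+1; rewrite -natr1 (addrC j%:R) addrA//.
Qed.

Lemma pochhammer_ge d b k : away d b -> d ^+ k <= nm (pochhammer b k).
Proof.
case=> d0 db; elim: k => [|k IH]; first by rewrite expr0 pochhammer0 nm1.
rewrite pochhammerS nmM exprSr; apply: ler_pM => //; first exact/exprn_ge0/ltW.
exact: ltW.
Qed.

Lemma pochhammer_neq0 d b k : away d b -> pochhammer b k != 0.
Proof.
move=> db; rewrite -nm_gt0; apply: lt_le_trans (pochhammer_ge k db).
by case: db => d0 _; exact: exprn_gt0.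
Qed.

Lemma phitS d b q k : away d b -> 0 < q -> nm b != 0 ->
  nm (phit b q k.+1) <= d / nm b * exp_coeff (q / d) k.+1.
Proof.
move=> db q0 b0; have d0 := db.1.
rewrite /phit nmM nmV nm_real ger0_norm; last by rewrite divr_ge0// exprn_ge0// ltW.
rewrite /exp_coeff /= expr_div_n.
have pk := pochhammer_ge k (awayS db).
have -> : d / nm b * (q ^+ k.+1 / d ^+ k.+1 / (k.+1)`!%:R) =
    q ^+ k.+1 / (k.+1)`!%:R * ((nm b)^-1 * (d ^+ k)^-1).
  have fk : (k.+1)`!%:R != 0 :> R by rewrite pnatr_eq0 -lt0n fact_gt0.
  have dk : d ^+ k != 0 by rewrite gt_eqF// exprn_gt0.
  rewrite !exprS; move: fk dk; move: ((k.+1)`!%:R : R) (d ^+ k) (q ^+ k) => f D Q fk dk.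
  by field; rewrite b0 fk dk gt_eqF.
apply: ler_wpM2l; first by rewrite divr_ge0// exprn_ge0// ltW.
rewrite pochhammerSl nmM invfM ler_wpM2l ?invr_ge0 ?nm_ge0// lef_pV2 ?posrE ?exprn_gt0//.
by apply: lt_le_trans pk; exact: exprn_gt0.
Qed.

Lemma cvg_exp_coeffS x : series (fun k => exp_coeff x k.+1) @ \oo --> expR x - 1.
Proof.
have h : series (exp_coeff x) n.+1 @[n --> \oo] --> expR x.
  by have := is_cvg_series_exp_coeff x; rewrite -cvg_shiftS.
have -> : series (fun k => exp_coeff x k.+1) = (fun n => series (exp_coeff x) n.+1 - 1).
  apply/funext => n; rewrite /series /= big_nat_recl//.
  by rewrite {2}/exp_coeff /= expr0 fact0 divr1 addrC addKr.
by apply: cvgB => //; exact: cvg_cst.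
Qed.

Lemma phi_sums d b q : away d b -> 0 < q ->
  csums (phit b q) (phi b q) /\ nm (phi b q - 1) <= d / nm b * expR (q / d).
Proof.
move=> db q0; have b0 : nm b != 0 by rewrite nm_eq0 -(addr0 b) (away_neq0 0 db).
have c0 : 0 <= d / nm b by rewrite divr_ge0 ?nm_ge0// ltW//; exact: db.1.
have hs : series (fun k => d / nm b * exp_coeff (q / d) k.+1) @ \oo --> d / nm b * (expR (q / d) - 1).
  have -> : series (fun k => d / nm b * exp_coeff (q / d) k.+1) =
      (fun n => d / nm b * series (fun k => exp_coeff (q / d) k.+1) n).
    by apply/funext => n; rewrite /series /= big_distrr.
  by apply: cvgM; [exact: cvg_cst|exact: cvg_exp_coeffS].
have [l hl nl] := csums_dom (fun k => phitS k db q0 b0) hs.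
have h0 : phit b q 0 = 1 by rewrite /phit pochhammer0 expr0 fact0 divr1 divr1.
have h1 := csums_shift hl; rewrite h0 in h1.
have E : phi b q = 1 + l by rewrite /phi (csums_lim h1).
split; first by rewrite E.
rewrite E addrC addKr; apply: le_trans nl _.
by rewrite ler_wpM2l// gerDl lerN10.
Qed.

Lemma phi_rec d b q : away d b -> 0 < q ->
  phi b q = phi (b + 1) q + q%:C / (b * (b + 1)) * phi (b + 2) q.
Proof.
move=> db q0; have db1 := awayS db; have db2 := awayS db1.
have b0 := away_neq0 0 db; rewrite addr0 in b0.
have b1 := away_neq0 0 db1; rewrite addr0 in b1.
have E2 : b + 1 + 1 = b + 2 by rewrite -addrA.
rewrite E2 in db2.
have [s0 _] := phi_sums db q0; have [s1 _] := phi_sums db1 q0; have [s2 _] := phi_sums db2 q0.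
have := @csumsZ _ (q%:C / (b * (b + 1))) _ _ s2.
have sh : csums (fun k => phit b q k - phit (b + 1) q k) (phi b q - phi (b + 1) q).
  have := csumsD s0 (@csumsZ _ (-1) _ _ s1); rewrite mulN1r.
  by rewrite /csums; under [in X in X -> _]eq_fun do under eq_bigr do rewrite mulN1r.
move=> h.
have h' : csums (fun k => phit b q k.+1 - phit (b + 1) q k.+1) (q%:C / (b * (b + 1)) * phi (b + 2) q).
  have -> : (fun k => phit b q k.+1 - phit (b + 1) q k.+1) =
      (fun k => q%:C / (b * (b + 1)) * phit (b + 2) q k); last exact: h.
  apply/funext => k; rewrite /phit.
  have p2 := pochhammer_neq0 k db2.
  have e0 : pochhammer b k.+1 = b * pochhammer (b + 1) k by rewrite pochhammerSl.
  have bk := away_neq0 k db1.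
  have p1 := pochhammer_neq0 k db1.
  have e1 : pochhammer (b + 1) k.+1 = (b + 1) * pochhammer (b + 2) k by rewrite pochhammerSl E2.
  have e2 : pochhammer (b + 1) k = (b + 1) * pochhammer (b + 2) k / (b + 1 + k%:R).
    by apply: (mulIf bk); rewrite divfK// -e1 pochhammerS.
  rewrite e0 e1 e2 exprS factS natrM !rcM !rcV !rc_nat rcX.
  have k1 : k.+1%:R != 0 :> R[i] by rewrite pnatr_eq0.
  have kf : k`!%:R != 0 :> R[i] by rewrite pnatr_eq0 -lt0n fact_gt0.
  rewrite rcM rc_nat invfM.
  rewrite -[k.+1%:R]natr1 in k1 *.
  by field; rewrite b0 b1 p2 bk k1 kf.
have := @csums_shift R (fun k => phit b q k - phit (b + 1) q k) _ h'; rewrite /phit !pochhammer0 subrr add0r => h2.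
have := csums_unique sh h2 => /eqP; rewrite subr_eq addrC => /eqP; exact.
Qed.

Lemma phi_cvg1 d q (b_ : nat -> R[i]) : 0 < q -> (forall n, away d (b_ n)) ->
  (nm (b_ n))^-1 @[n --> \oo] --> (0 : R) -> ccvg (fun n => phi (b_ n) q) 1.
Proof.
move=> q0 db h0; apply: (ccvg_le (e := fun n => d * expR (q / d) * (nm (b_ n))^-1)).
  move=> n; apply: le_trans (phi_sums (db n) q0).2 _.
  by rewrite mulrAC.
by rewrite -(mulr0 (d * expR (q / d))); apply: cvgM => //; exact: cvg_cst.
Qed.

Lemma nm_inv_cvg0 (b_ : nat -> R[i]) (K : R) : (forall n, n%:R - K <= nm (b_ n)) ->
  (nm (b_ n))^-1 @[n --> \oo] --> (0 : R).
Proof.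
move=> h; apply/gtr0_cvgV0.
  near=> n; apply: lt_le_trans (h n); rewrite subr_gt0.
  by near: n; exact: nbhs_infty_gtr.
apply/cvgryPge => A; near=> n; apply: le_trans (h n); rewrite lerBrDr.
by near: n; exact: nbhs_infty_ger.
Unshelve. all: by end_near. Qed.

(* The Casoratian of y with the minimal solution
   (-q)^n phi(1 + nu + n) / (1 + nu)_n, divided by (-q)^n, is constant. *)
Lemma casoratian d q nu (y : nat -> R[i]) l : 0 < q -> -1 < Re nu -> away d (1 + nu) ->
  (forall n, y n.+2 = (nu + n.+1%:R) * y n.+1 + q%:C * y n) ->
  ccvg (fun n => y n.+1 / pochhammer (1 + nu) n) l ->
  y 1%N * phi (1 + nu) q + q%:C / (1 + nu) * y 0%N * phi (2 + nu) q = l.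
Proof.
move=> q0 nu1 db yrec yl.
pose T n := y n.+1 / pochhammer (1 + nu) n * phi (1 + nu + n%:R) q
  + q%:C * y n / pochhammer (1 + nu) n.+1 * phi (1 + nu + n.+1%:R) q.
have awn n : away d (1 + nu + n%:R).
  by elim: n => [|n IH]; rewrite ?addr0// -natr1 addrA; exact: awayS.
have TS n : T n.+1 = T n.
  rewrite /T yrec !pochhammerS.
  have P0 := pochhammer_neq0 n db; have b0 := away_neq0 n db.
  have b1 := away_neq0 n.+1 db.
  rewrite (phi_rec (awn n) q0).
  have -> : 1 + nu + n%:R + 1 = 1 + nu + n.+1%:R by rewrite -addrA natr1.
  have -> : 1 + nu + n%:R + 2 = 1 + nu + n.+2%:R by rewrite -[n.+2%:R]natr1 -natr1; ring.
  have -> : nu + n.+1%:R = 1 + nu + n%:R by rewrite -natr1; ring.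
  move: P0 b0 b1; move: (pochhammer _ n) (1 + nu + n%:R) (1 + nu + n.+1%:R) => P B B1 P0 b0 b1.
  by field; rewrite P0 b0 b1.
have T0 n : T n = T 0%N by elim: n => // n <-.
have hinv : (nm (1 + nu + n%:R))^-1 @[n --> \oo] --> (0 : R).
  apply: (nm_inv_cvg0 (K := 0)) => n; rewrite subr0; apply: le_trans (ler_norm_Re _).
  apply: le_trans (ler_norm _); rewrite !cReD -rc_nat /=; lra.
have cphi := phi_cvg1 q0 awn hinv.
have cz : ccvg (fun n => (1 + nu + n%:R)^-1) 0.
  by apply: ccvg_le hinv => n; rewrite subr0 nmV.
have czS : ccvg (fun n => (1 + nu + n.+1%:R)^-1) 0 by apply/(ccvg_shift (fun n => (1 + nu + n%:R)^-1)).
have c2 : ccvg (fun n => q%:C * y n / pochhammer (1 + nu) n.+1) 0.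
  apply/ccvg_shift.
  have -> : (fun n => q%:C * y n.+1 / pochhammer (1 + nu) n.+2) =
     (fun n => q%:C * (y n.+1 / pochhammer (1 + nu) n * ((1 + nu + n%:R)^-1 * (1 + nu + n.+1%:R)^-1))).
    apply/funext => n; rewrite !pochhammerS !invfM; ring.
  have h := ccvgM (@ccvg_cst _ q%:C) (ccvgM yl (ccvgM cz czS)).
  by rewrite !mulr0 in h.
have cphiS : ccvg (fun n => phi (1 + nu + n.+1%:R) q) 1.
  by apply/(ccvg_shift (fun n => phi (1 + nu + n%:R) q)).
have cT : ccvg T l.
  by have := ccvgD (ccvgM yl cphi) (ccvgM c2 cphiS); rewrite !mulr1 addr0.
have cT0 : ccvg T (T 0%N).
  by rewrite (_ : T = fun=> T 0%N); [exact: ccvg_cst|apply/funext].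
rewrite (ccvg_unique cT cT0) /T pochhammer0 pochhammerS pochhammer0 !addr0 divr1 mul1r.
have -> : 2 + nu = 1 + nu + 1 by ring.
by congr (_ + _ * _); exact: mulrAC.
Qed.

Lemma strip_away nu : -1 < Re nu < 1 -> nu != 0 ->
  exists d, forall n, away d (nu - n%:R) /\ away d (- nu - n%:R).
Proof.
move=> /andP[n1 n2] n0; exists (Num.min (nm nu) (1 - `|Re nu|)).
have d0 : 0 < Num.min (nm nu) (1 - `|Re nu|).
  by rewrite lt_min nm_gt0 n0 subr_gt0 ltr_norml n1.
have main (z : R[i]) (m j : nat) : nm z = nm nu -> `|Re z| = `|Re nu| ->
    Num.min (nm nu) (1 - `|Re nu|) <= nm (z - m%:R + j%:R).
  move=> nz Rz; have [->|mj] := eqVneq m j.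
    by rewrite subrK nz ge_min lexx.
  rewrite ge_min; apply/orP; right; apply: le_trans (ler_norm_Re _).
  rewrite cReD cReB -!rc_nat /=.
  have h1 : 1 <= `|j%:R - m%:R : R|.
    have [jm|jm|jm] := ltngtP j m; last by rewrite jm eqxx in mj.
      rewrite distrC ger0_norm ?subr_ge0 ?ler_nat 1?ltnW// -natrB 1?ltnW// ler1n subn_gt0//.
    by rewrite ger0_norm ?subr_ge0 ?ler_nat 1?ltnW// -natrB 1?ltnW// ler1n subn_gt0.
  rewrite -Rz -addrA (addrC (- _)).
  have := lerB_dist (j%:R - m%:R) (- Re z); rewrite opprK normrN (addrC _ (Re z)); lra.
move=> n; split; split=> // j; apply: main => //; first by rewrite nmN.
by rewrite cReN normrN.
Qed.

Lemma rGamma_shift (u : R) n : 0 < u ->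
  rGamma (u + n%:R) = (\prod_(0 <= j < n) (u + j%:R)) * rGamma u.
Proof.
move=> u0; elim: n => [|n IH]; first by rewrite addr0 big_geq// mul1r.
rewrite -natr1 addrA rGamma_rec; last by rewrite ltr_wpDr ?ler0n.
by rewrite IH big_nat_recr//= mulrA (mulrC (u + _)).
Qed.

Lemma nm_pochhammer_ge a n : 0 < Re a ->
  \prod_(0 <= j < n) (Re a + j%:R) <= nm (pochhammer a n).
Proof.
move=> a0; elim: n => [|n IH]; first by rewrite big_geq// pochhammer0 nm1.
rewrite big_nat_recr//= pochhammerS nmM; apply: ler_pM => //.
- by apply: prodr_ge0 => j _; rewrite addr_ge0 ?ler0n// ltW.
- by rewrite addr_ge0 ?ler0n// ltW.
- by apply: le_trans (ler_norm_Re _); rewrite cReD -rc_nat ler_norm.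
Qed.

Lemma Hint_pochhammer_cvg nu q : 0 < q -> -1 < Re nu ->
  ccvg (fun n => Hint (nu + n.+1%:R) q / pochhammer (1 + nu) n) (Gamma (1 + nu)).
Proof.
move=> q0 n1; set r := 1 + Re nu; have r0 : 0 < r by rewrite /r; lra.
have Rr : Re (1 + nu) = r by rewrite cReD.
have P0 n : 0 < \prod_(0 <= j < n) (r + j%:R).
  by apply: prodr_gt0 => j _; rewrite ltr_wpDr ?ler0n.
have hP n : \prod_(0 <= j < n) (r + j%:R) <= nm (pochhammer (1 + nu) n).
  by rewrite -Rr; apply: nm_pochhammer_ge; rewrite Rr.
apply/ccvg_shift.
apply: (ccvg_le (e := fun n => 2 * q * rGamma r * (r + n%:R)^-1)); last first.
  rewrite -(mulr0 (2 * q * rGamma r)); apply: cvgM; first exact: cvg_cst.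
  apply/gtr0_cvgV0.
    by apply: nearW => n; rewrite ltr_wpDr ?ler0n.
  apply/cvgryPge => A; near=> n; rewrite -lerBlDl.
  by near: n; exact: nbhs_infty_ger.
move=> n; set w := nu + n.+2%:R.
have pn0 : pochhammer (1 + nu) n.+1 != 0.
  by rewrite -nm_gt0; exact: lt_le_trans (P0 _) (hP _).
have E : Gamma w = pochhammer (1 + nu) n.+1 * Gamma (1 + nu).
  rewrite -Gamma_pochhammer ?Rr//; congr Gamma.
  by rewrite /w -[n.+2%:R]natr1; ring.
have -> : Hint w q / pochhammer (1 + nu) n.+1 - Gamma (1 + nu) =
    (Hint w q - Gamma w) / pochhammer (1 + nu) n.+1.
  by rewrite mulrBl E mulrAC mulfV// mul1r.
have Rw : Re w = r + n.+1%:R.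
  by rewrite /w cReD -rc_nat /= /r -[n.+2%:R]natr1; ring.
have w1 : 1 < Re w.
  by rewrite Rw -[n.+1%:R]natr1 addrA ltrDr ltr_wpDr ?ler0n.
rewrite nmM nmV ler_pdivrMr ?nm_gt0//; apply: le_trans (Hint_small q0 w1) _.
have -> : Re w - 1 = r + n%:R by rewrite Rw -natr1; ring.
rewrite rGamma_shift//.
have h := hP n.+1; rewrite big_nat_recr//= in h.
have rn : 0 < r + n%:R by rewrite ltr_wpDr ?ler0n.
have -> : 2 * (q * (\prod_(0 <= j < n) (r + j%:R) * rGamma r)) =
   2 * q * rGamma r * (\prod_(0 <= j < n) (r + j%:R)) by ring.
rewrite -[leRHS]mulrA; apply: ler_wpM2l.
  by rewrite mulr_ge0 ?rGamma_ge0// mulr_ge0// ltW.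
by rewrite ler_pdivlMl// mulrC.
Unshelve. all: by end_near. Qed.

Lemma phi_shift_cvg1 d nu q : 0 < q -> (forall n, away d (- nu - n%:R)) ->
  ccvg (fun n => phi (- nu - n%:R) q) 1.
Proof.
move=> q0 H; apply: (phi_cvg1 q0 H).
apply: (nm_inv_cvg0 (K := nm nu)) => n.
have := ler_nmB (- nu - n%:R) (- nu).
rewrite opprK nmN addrAC addNr add0r nmN -rc_nat nm_real ger0_norm ?ler0n//.
lra.
Qed.

(* The reduced Bessel function K_nu in terms of I_nu and I_{-nu}. *)
Lemma Hint_phi nu q : 0 < q -> -1 < Re nu < 1 -> nu != 0 ->
  Hint nu q = Gamma nu * phi (1 - nu) q
    + cexp (nu * (ln q)%:C) * Gamma (- nu) * phi (1 + nu) q.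
Proof.
move=> q0 n12 n0; have [n1 n2] := andP n12.
have [d dn] := strip_away n12 n0.
have [dnu dNnu] := dn 0%N; rewrite !subr0 in dnu dNnu.
have dp := awayS dnu; have dm := awayS dNnu; rewrite !(addrC _ 1) in dp dm.
have b1 : 1 + nu != 0 by rewrite -(addr0 (1 + nu)) (away_neq0 0 dp).
have b1' : 1 - nu != 0 by rewrite -(addr0 (1 - nu)) (away_neq0 0 dm).
have nN1 : -1 < Re (- nu) by rewrite cReN; lra.
have Hrec z n : Hint (z + n.+2%:R) q = (z + n.+1%:R) * Hint (z + n.+1%:R) q + q%:C * Hint (z + n%:R) q.
  have -> : z + n.+2%:R = z + n.+1%:R + 1 by rewrite -natr1 addrA.
  have e : z + n.+1%:R - 1 = z + n%:R by rewrite -natr1 addrA addrK.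
  by rewrite (Hint_rec _ q0) e.
have eq1 := @casoratian d q nu (fun n => Hint (nu + n%:R) q) _ q0 n1 dp (Hrec nu)
  (Hint_pochhammer_cvg q0 n1).
have eq2 := @casoratian d q (- nu) (fun n => Hint (- nu + n%:R) q) _ q0 nN1 dm (Hrec (- nu))
  (Hint_pochhammer_cvg q0 nN1).
rewrite /= !addr0 in eq1 eq2.
have dN n : away d (- nu - n%:R) by have [] := dn n.
pose M n := pochhammer nu n * phi (1 - nu - n%:R) q.
have eq3 := @casoratian d q nu M nu q0 n1 dp.
have {}eq3 : M 1%N * phi (1 + nu) q + q%:C / (1 + nu) * M 0%N * phi (2 + nu) q = nu.
  apply: eq3.
  - move=> n; rewrite /M !pochhammerS.
    have aw := dN n.+1; have := phi_rec aw q0.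
    have -> : - nu - n.+1%:R = 1 - nu - n.+2%:R by rewrite -[n.+2%:R]natr1; ring.
    have -> : 1 - nu - n.+2%:R + 1 = 1 - nu - n.+1%:R by rewrite -[n.+2%:R]natr1; ring.
    have -> : 1 - nu - n.+2%:R + 2 = 1 - nu - n%:R by rewrite -[n.+2%:R]natr1 -natr1; ring.
    move=> ->.
    have e1 : 1 - nu - n.+2%:R = - (nu + n.+1%:R) by rewrite -[n.+2%:R]natr1; ring.
    have e2 : 1 - nu - n.+1%:R = - (nu + n%:R) by rewrite -natr1; ring.
    rewrite e1 {2}e2.
    have f0 := away_neq0 n dnu; have f1 := away_neq0 n.+1 dnu.
    move: f0 f1; move: (phi _ _) (phi _ _) (pochhammer _ _) (nu + n%:R) (nu + n.+1%:R) => p1 p2 P B0 B1 f0 f1.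
    by field; rewrite f0 f1.
  - have -> : (fun n => M n.+1 / pochhammer (1 + nu) n) = (fun n => nu * phi (- nu - n%:R) q).
      apply/funext => n; rewrite /M pochhammerSl (addrC nu 1).
      have -> : 1 - nu - n.+1%:R = - nu - n%:R by rewrite -natr1; ring.
      by rewrite mulrAC mulfK// (pochhammer_neq0 n dp).
    have := ccvgM (@ccvg_cst _ nu) (phi_shift_cvg1 q0 dN).
    by rewrite mulr1.
have {eq3} : nu * (phi (1 - nu) q - q%:C / (nu * (1 - nu)) * phi (2 - nu) q) * phi (1 + nu) q
    + q%:C / (1 + nu) * phi (1 - nu) q * phi (2 + nu) q = nu.
  rewrite -[RHS]eq3 /M pochhammerS !pochhammer0 !mul1r !addr0 subr0.
  have -> : 1 - nu - 1 = - nu by ring.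
  rewrite (phi_rec dNnu q0) (addrC (- nu) 1) (addrC (- nu) 2).
  congr (_ * _ * _ + _).
  by field; rewrite n0 b1'.
have XN : cexp (nu * (ln q)%:C) != 0 by exact: cexp_neq0.
move: eq2.
have -> : Hint (- nu + 1) q = (cexp (nu * (ln q)%:C))^-1 * (q%:C * Hint (nu - 1) q).
  rewrite (_ : - nu + 1 = - (nu - 1)); last by ring.
  rewrite Hint_reflect// mulrBl mul1r opprB addrC cexpD cexpN cexp_real lnK//.
  by rewrite mulrA.
have -> : q%:C * Hint (nu - 1) q = Hint (nu + 1) q - nu * Hint nu q.
  by rewrite Hint_rec//; ring.
rewrite (Hint_reflect _ q0) cexpN.
have -> : Gamma nu = Gamma (1 + nu) / nu.
  by rewrite Gamma_strip// -Gamma_pos// cReD /=; lra.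
have -> : Gamma (- nu) = - (Gamma (1 - nu) / nu).
  by rewrite Gamma_strip ?oppr_eq0// -Gamma_pos ?invrN ?mulrN// cReD /=; lra.
move: XN b1 b1' n0 eq1.
move: (cexp _) (Hint nu q) (Hint (nu + 1) q) (phi (1 + nu) q) (phi (2 + nu) q)
  (phi (1 - nu) q) (phi (2 - nu) q) (Gamma (1 + nu)) (Gamma (1 - nu)) (q%:C)
  => X A B a a2 b' b2 G1 G2 Q XN b1 b1' n0 <- <- W.
apply: (mulfI n0).
transitivity (A * (nu * (b' - Q / (nu * (1 - nu)) * b2) * a + Q / (1 + nu) * b' * a2)).
  by rewrite W mulrC.
by field; rewrite b1 b1' n0 XN.
Qed.

End hypergeometric.

Section termwise.
Context {R : realType}.
Notation mu := (@lebesgue_measure R).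
Implicit Types (a b nu : R[i]) (x q t : R) (k n j : nat).

Definition half_away b := forall j, j.+1%:R / 2 <= nm (b + j%:R).

Lemma half_awayP b : 2^-1 <= Re b -> half_away b.
Proof.
move=> hb j; apply: le_trans (ler_norm_Re _); apply: le_trans (ler_norm _).
rewrite cReD -rc_nat /= -natr1; have := ler0n R j; lra.
Qed.

Lemma half_away_away b : half_away b -> away 2^-1 b.
Proof.
move=> hb; split; first by rewrite invr_gt0.
move=> j; apply: le_trans (hb j); rewrite -(natr1 j); have := ler0n R j; lra.
Qed.

Lemma half_away_pochhammer b k : half_away b -> k`!%:R / 2 ^+ k <= nm (pochhammer b k).
Proof.
move=> hb; elim: k => [|k IH].
  by rewrite fact0 expr0 divr1 pochhammer0 nm1.
rewrite pochhammerS nmM factS natrM exprSr.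
rewrite [leLHS](_ : _ = k`!%:R / 2 ^+ k * (k.+1%:R / 2)); last first.
  by rewrite (mulrC k.+1%:R) invfM mulrACA.
by apply: ler_pM => //; rewrite divr_ge0// exprn_ge0.
Qed.

Lemma nm_phit_le b q k : half_away b -> 0 < q ->
  nm (phit b q k) <= exp_coeff (Num.sqrt (2 * q)) k ^+ 2.
Proof.
move=> hb q0; have hp := half_away_pochhammer k hb.
have kf : 0 < k`!%:R :> R by rewrite ltr0n fact_gt0.
have p2 : 0 < 2 ^+ k :> R by rewrite exprn_gt0.
rewrite /phit nmM nmV nm_real ger0_norm; last by rewrite divr_ge0 ?exprn_ge0 ?ltW.
rewrite /exp_coeff /= expr_div_n -exprM mulnC exprM sqr_sqrtr; last by rewrite mulr_ge0 ?ltW.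
rewrite exprMn.
apply: (@le_trans _ _ (q ^+ k / k`!%:R * (2 ^+ k / k`!%:R))).
  apply: ler_wpM2l; first by rewrite divr_ge0 ?exprn_ge0 ?ltW.
  rewrite -[leRHS]invrK invfM invrK (mulrC _^-1) lef_pV2 ?posrE ?divr_gt0//.
  by apply: lt_le_trans hp; exact: divr_gt0.
by rewrite le_eqVlt; apply/orP; left; apply/eqP; rewrite expr2 invfM mulrACA (mulrC (q ^+ k)).
Qed.

Lemma sum_exp_coeff_le x n : 0 <= x -> \sum_(0 <= k < n) exp_coeff x k <= expR x.
Proof.
move=> x0; rewrite /expR.
apply: (@nondecreasing_cvgn_le _ (series (exp_coeff x))); last exact: is_cvg_series_exp_coeff.
apply/nondecreasing_seqP => m; rewrite /series /= big_nat_recr//= lerDl.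
exact: exp_coeff_ge0.
Qed.

Lemma sum_phit_le b q n : half_away b -> 0 < q ->
  nm (\sum_(0 <= k < n) phit b q k) <= expR (2 * Num.sqrt (2 * q)).
Proof.
move=> hb q0; have s0 : 0 <= Num.sqrt (2 * q) by exact: sqrtr_ge0.
apply: le_trans (nm_sum _ _ _) _.
have e0 k : 0 <= exp_coeff (Num.sqrt (2 * q)) k by exact: exp_coeff_ge0.
apply: (@le_trans _ _ ((\sum_(0 <= k < n) exp_coeff (Num.sqrt (2 * q)) k) ^+ 2)).
  apply: (@le_trans _ _ (\sum_(0 <= k < n) exp_coeff (Num.sqrt (2 * q)) k ^+ 2)).
    by apply: ler_sum => k _; exact: nm_phit_le.
  elim: n => [|n IH]; first by rewrite !big_geq// expr0n.
  rewrite !big_nat_recr//= sqrrD; apply: lerD => //.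
  apply: le_trans IH _; rewrite lerDl mulrn_wge0// mulr_ge0//.
  by apply: sumr_ge0.
rewrite -[2 * _]/(2%:R * _) expRM_natl; apply: lerXn2r; rewrite ?nnegrE ?expR_ge0//.
  exact: sumr_ge0.
exact: sum_exp_coeff_le.
Qed.

Lemma sqrt_expR_le x t : 0 < x -> 2 * Num.sqrt (2 * (x * expR t)) <= 2^-1 * expR t + 4 * x.
Proof.
move=> x0; set A := 2^-1 * expR t; set B := 4 * x.
have A0 : 0 <= A by rewrite mulr_ge0// expR_ge0.
have B0 : 0 <= B by rewrite mulr_ge0// ltW.
have -> : 2 * (x * expR t) = A * B by rewrite /A /B; field.
rewrite sqrtrM//.
have := sqr_ge0 (Num.sqrt A - Num.sqrt B).
rewrite sqrrB !sqr_sqrtr// mulr2n; lra.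
Qed.

Lemma gker_shift a z c t : gker (a + z) c t = cexp (z * t%:C) * gker a c t.
Proof. by rewrite /gker mulrDl cexpD mulrA (mulrC (cexp (a * _))). Qed.

Lemma gker_shiftn a c k t : gker (a + k%:R) c t = (expR t ^+ k)%:C * gker a c t.
Proof. by rewrite gker_shift -rc_nat -rcM cexp_real expRM_natl. Qed.

Lemma cint_sum (f : nat -> R -> R[i]) n : (forall k, cintg (f k)) ->
  cintg (fun t => \sum_(0 <= k < n) f k t) /\
  cint (fun t => \sum_(0 <= k < n) f k t) = \sum_(0 <= k < n) cint (f k).
Proof.
move=> hf; elim: n => [|n [IH1 IH2]].
  have E : (fun t => \sum_(0 <= k < 0) f k t) = (fun _ => (0 : R)%:C).
    by apply/funext => t; rewrite big_geq.
  rewrite E; split; last by rewrite cint_real Rintegral_cst// mul0r big_geq.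
  by apply: cintgP; exact: integrable0.
have E : (fun t => \sum_(0 <= k < n.+1) f k t) = (fun t => (\sum_(0 <= k < n) f k t) + f n t).
  by apply/funext => t; rewrite big_nat_recr.
rewrite E big_nat_recr//= -IH2; split; first exact: cintgD.
exact: cintD.
Qed.

Lemma cmeas_sum (f : nat -> R -> R[i]) n : (forall k, cmeas (f k)) ->
  cmeas (fun t => \sum_(0 <= k < n) f k t).
Proof.
move=> hf; elim: n => [|n IH].
  by under eq_fun do rewrite big_geq//; exact: cmeas_cst.
by under eq_fun do rewrite big_nat_recr//=; exact: cmeasD.
Qed.

Lemma hyp1F1_sums a b x : half_away b -> 0 < x ->
  csums (fun k => pochhammer a k / pochhammer b k * (x ^+ k / k`!%:R)%:C) (hyp1F1 a b x).
Proof.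
move=> hb x0; set A := nm a + 1.
have A1 : 1 <= A by rewrite lerDr nm_ge0.
have hA k : nm (pochhammer a k) <= k`!%:R * A ^+ k.
  elim: k => [|k IH]; first by rewrite pochhammer0 nm1 expr0 fact0 mulr1.
  rewrite pochhammerS nmM factS natrM exprSr [leRHS](_ : _ = (k`!%:R * A ^+ k) * (k.+1%:R * A)); last by ring.
  apply: ler_pM; rewrite ?nm_ge0//; apply: le_trans (ler_nmD _ _) _.
  rewrite -rc_nat nm_real ger0_norm ?ler0n// -natr1.
  by have := ler0n R k; rewrite /A; have := nm_ge0 a; nra.
have [l hl _] : exists2 l, csums (fun k => pochhammer a k / pochhammer b k * (x ^+ k / k`!%:R)%:C) l
    & nm l <= expR (2 * A * x).
  apply: (csums_dom (v := exp_coeff (2 * A * x))); last exact: is_cvg_series_exp_coeff.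
  move=> k; have kf : 0 < k`!%:R :> R by rewrite ltr0n fact_gt0.
  rewrite !nmM nmV nm_real ger0_norm; last by rewrite divr_ge0 ?exprn_ge0 ?ltW.
  rewrite /exp_coeff /= exprMn mulrA ler_pM2r ?invr_gt0// ler_pM2r ?exprn_gt0//.
  have hp := half_away_pochhammer k hb.
  have dp : 0 < k`!%:R / 2 ^+ k :> R by rewrite divr_gt0// exprn_gt0.
  rewrite ler_pdivrMr; last exact: lt_le_trans hp.
  apply: le_trans (hA k) _; rewrite exprMn.
  rewrite [leLHS](_ : _ = 2 ^+ k * A ^+ k * (k`!%:R / 2 ^+ k)); last first.
    have p2 : 2 ^+ k != 0 :> R by rewrite expf_neq0.
    by move: p2; move: (2 ^+ k : R) (A ^+ k) (k`!%:R : R) => P A' f p2; field.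
  by apply: ler_wpM2l => //; rewrite mulr_ge0// exprn_ge0// (le_trans _ A1).
by rewrite /hyp1F1 (csums_lim hl).
Qed.

Lemma cint_gker_phi a b x : 0 < Re a -> half_away b -> 0 < x ->
  cintg (fun t => gker a 1 t * phi b (x * expR t)) /\
  cint (fun t => gker a 1 t * phi b (x * expR t)) = Gamma a * hyp1F1 a b x.
Proof.
move=> a0 hb x0; have ab := half_away_away hb.
pose c k : R[i] := (x ^+ k / k`!%:R)%:C / pochhammer b k.
have phitE t k : gker a 1 t * phit b (x * expR t) k = c k * gker (a + k%:R) 1 t.
  by rewrite /phit /c gker_shiftn exprMn !rcM; ring.
have ik k : cintg (gker (a + k%:R) 1).
  by apply: cintg_gker => //; rewrite cReD -rc_nat /= ltr_wpDr ?ler0n.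
pose f_ n t := gker a 1 t * \sum_(0 <= k < n) phit b (x * expR t) k.
have fE n : f_ n = (fun t => \sum_(0 <= k < n) c k * gker (a + k%:R) 1 t).
  by apply/funext => t; rewrite /f_ big_distrr; apply: eq_bigr => k _; exact: phitE.
have mf n : cmeas (f_ n).
  rewrite fE; apply: cmeas_sum => k; apply: cmeasM; first exact: cmeas_cst.
  exact/ccont_meas/ccont_gker.
have cf t : ccvg (f_ ^~ t) (gker a 1 t * phi b (x * expR t)).
  have xt : 0 < x * expR t by rewrite mulr_gt0// expR_gt0.
  exact: (ccvgM (@ccvg_cst _ (gker a 1 t)) (phi_sums ab xt).1).
have bf n t : nm (f_ n t) <= expR (4 * x) * expR (Re a * t - 2^-1 * expR t).
  have xt : 0 < x * expR t by rewrite mulr_gt0// expR_gt0.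
  rewrite nmM nm_gker -expRD.
  apply: le_trans (ler_wpM2l (expR_ge0 _) (sum_phit_le n hb xt)) _.
  rewrite -expRD ler_expR; have := sqrt_expR_le t x0; lra.
have ig : intg (fun t => expR (4 * x) * expR (Re a * t - 2^-1 * expR t)).
  by apply: intgZ; apply: intg_gexp.
have [if_ cI] := cdct mf cf bf ig.
split => //.
have En n : cint (f_ n) = Gamma a * \sum_(0 <= k < n) (pochhammer a k / pochhammer b k * (x ^+ k / k`!%:R)%:C).
  rewrite fE (cint_sum n (fun k => cintgZ (c k) (ik k))).2 mulr_sumr.
  apply: eq_bigr => k _; rewrite (cintZ _ (ik k)) cint_gker//; last first.
    by rewrite cReD -rc_nat /= ltr_wpDr ?ler0n.
  by rewrite ln1 mulr0 oppr0 cexp0 mul1r Gamma_pochhammer// /c; ring.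
have h1 : ccvg (fun n => cint (f_ n)) (cint (fun t => gker a 1 t * phi b (x * expR t))) by exact: cI.
have h2 : ccvg (fun n => cint (f_ n)) (Gamma a * hyp1F1 a b x).
  have := ccvgM (@ccvg_cst _ (Gamma a)) (@hyp1F1_sums a b x hb x0).
  by rewrite (_ : (fun n => cint (f_ n)) = (fun n => Gamma a * \sum_(0 <= k < n) (pochhammer a k / pochhammer b k * (x ^+ k / k`!%:R)%:C))) //; apply/funext.
exact: ccvg_unique h1 h2.
Qed.

Definition Iab a nu x := cint (fun t => gker a 1 t * Hint (- nu) (x * expR t)).

Lemma Iab_hyp1F1 a nu x : 0 < Re a -> 0 < Re (a - nu) -> nu != 0 ->
  - 2^-1 <= Re nu <= 2^-1 -> 0 < x ->
  Iab a nu x = Gamma a * Gamma (- nu) * hyp1F1 a (1 + nu) x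
    + cexp (- (nu * (ln x)%:C)) * Gamma nu * Gamma (a - nu) * hyp1F1 (a - nu) (1 - nu) x.
Proof.
move=> a0 an0 nu0 /andP[n1 n2] x0.
have h1 : half_away (1 + nu) by apply: half_awayP; rewrite cReD /=; lra.
have h2 : half_away (1 - nu) by apply: half_awayP; rewrite cReB /=; lra.
have [i1 I1] := cint_gker_phi a0 h1 x0; have [i2 I2] := cint_gker_phi an0 h2 x0.
set C := cexp (- (nu * (ln x)%:C)).
have E t : gker a 1 t * Hint (- nu) (x * expR t) =
    Gamma (- nu) * (gker a 1 t * phi (1 + nu) (x * expR t))
    + C * Gamma nu * (gker (a - nu) 1 t * phi (1 - nu) (x * expR t)).
  have xt : 0 < x * expR t by rewrite mulr_gt0// expR_gt0.
  rewrite (Hint_phi xt); last 2 first.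
  - by rewrite cReN; lra.
  - by rewrite oppr_eq0.
  rewrite !opprK lnM ?posrE ?expR_gt0// expRK gker_shift rcD.
  have -> : - nu * ((ln x)%:C + t%:C) = - (nu * (ln x)%:C) + - nu * t%:C by ring.
  rewrite cexpD -/C; ring.
rewrite /Iab (eq_cint E) cintD; [|exact: cintgZ|exact: cintgZ].
by rewrite (cintZ _ i1) (cintZ _ i2) I1 I2; ring.
Qed.

Lemma double_fact_half j : (2 * j)`!%:R = 4 ^+ j * j`!%:R * pochhammer 2^-1 j :> R[i].
Proof.
elim: j => [|j IH]; first by rewrite muln0 fact0 expr0 pochhammer0 !mulr1.
rewrite mulnS !factS !natrM IH pochhammerS exprS.
rewrite -!natr1 natrM.
by field.
Qed.

Lemma double_fact_half3 j : (2 * j).+1`!%:R = 4 ^+ j * j`!%:R * pochhammer (1 + 2^-1) j :> R[i].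
Proof.
elim: j => [|j IH]; first by rewrite muln0 fact0 expr0 pochhammer0 !mulr1.
rewrite (_ : (2 * j.+1).+1 = (2 * j).+3)%N; last by rewrite mulnS.
rewrite (factS (2 * j).+2) (factS (2 * j).+1) (factS j) pochhammerS exprS.
move: ((2 * j).+1)`! IH => F IH; rewrite !natrM IH.
rewrite -!natr1 natrM.
by field.
Qed.

Lemma expR_phi q : 0 < q ->
  (expR (- (2 * Num.sqrt q)))%:C = phi 2^-1 q - (2 * Num.sqrt q)%:C * phi (1 + 2^-1) q.
Proof.
move=> q0; set s := 2 * Num.sqrt q.
have s2 : s ^+ 2 = 4 * q by rewrite exprMn sqr_sqrtr ?ltW//; ring.
clearbody s.
have hf (b : R[i]) : 2^-1 <= Re b -> away 2^-1 b by move=> /half_awayP/half_away_away.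
have r2 : Re (2^-1 : R[i]) = 2^-1 by rewrite -rc_nat -rcV.
have [s1 _] := phi_sums (hf 2^-1 ltac:(by rewrite r2)) q0.
have [s3 _] := phi_sums (hf (1 + 2^-1) ltac:(by rewrite cReD r2 /=; lra)) q0.
have hs := csumsD s1 (@csumsZ _ (- s%:C) _ _ s3).
rewrite mulNr in hs.
apply: (ccvg_unique _ hs).
have he : series (exp_coeff (- s)) @ \oo --> expR (- s) by exact: is_cvg_series_exp_coeff.
have he2 : series (exp_coeff (- s)) (2 * n)%N @[n --> \oo] --> expR (- s).
  apply: (cvg_comp _ _ _ he); apply/cvgnyPge => A; near=> n.
  rewrite (@leq_trans n)//; last by rewrite leq_pmull.
  by near: n; exact: nbhs_infty_ge.
pose u n : R := series (exp_coeff (- s)) (2 * n)%N.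
have hu : ccvg (fun n => (u n)%:C) (expR (- s))%:C by exact: (@cvgC_real _ _ _ _ u _ he2).
suff E : (fun n => (u n)%:C) =
    (fun n => \sum_(0 <= k < n) (phit 2^-1 q k + - s%:C * phit (1 + 2^-1) q k)).
  by rewrite E in hu; exact: hu.
rewrite /u {u hu}.
apply/funext; elim=> [|n IH]; first by rewrite muln0 /series /= !big_geq.
rewrite [RHS]big_nat_recr//= -IH (_ : 2 * n.+1 = (2 * n).+2)%N ?mulnS//.
rewrite (seriesSr _ (2 * n).+1) (seriesSr _ (2 * n)) -addrA rcD rcD; congr (_ + _).
have e1 : exp_coeff (- s) (2 * n) = q ^+ n * 4 ^+ n / (2 * n)`!%:R.
  by rewrite /exp_coeff /= exprM sqrrN s2 exprMn (mulrC (4 ^+ n)).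
have e2 : exp_coeff (- s) (2 * n).+1 = - s * (q ^+ n * 4 ^+ n) / (2 * n).+1`!%:R.
  by rewrite /exp_coeff /= exprS exprM sqrrN s2 exprMn (mulrC (4 ^+ n)).
rewrite e1 e2 !rcM !rcV !rc_nat double_fact_half double_fact_half3 /phit !rcM !rcV !rc_nat rcN !rcX rc_nat.
have f0 : n`!%:R != 0 :> R[i] by rewrite pnatr_eq0 -lt0n fact_gt0.
have f4 : 4 ^+ n != 0 :> R[i] by rewrite expf_neq0// pnatr_eq0.
have p1 := pochhammer_neq0 n (hf 2^-1 ltac:(by rewrite r2)).
have p2 := pochhammer_neq0 n (hf (1 + 2^-1) ltac:(by rewrite cReD r2 /=; lra)).
move: f0 f4 p1 p2; move: (n`!%:R : R[i]) (4 ^+ n : R[i]) (pochhammer _ _) (pochhammer _ _) (q%:C ^+ n) (s%:C)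
  => f F P1 P2 Q S f0 f4 p1 p2.
by field; rewrite f0 f4 p1 p2.
Unshelve. all: by end_near. Qed.

Lemma Gamma_Nhalf : Gamma (- 2^-1) = - 2 * Gamma (2^-1 : R[i]).
Proof.
have r2 : Re (2^-1 : R[i]) = 2^-1 by rewrite -rc_nat -rcV.
have n0 : (2^-1 : R[i]) != 0 by rewrite invr_eq0 pnatr_eq0.
rewrite Gamma_strip ?oppr_eq0//; last by rewrite cReN r2; lra.
have -> : 1 + - 2^-1 = 2^-1 :> R[i] by field.
by rewrite -Gamma_pos ?r2// invrN invrK mulrN mulNr mulrC.
Qed.

Lemma Hint_half q : 0 < q -> Hint 2^-1 q = Gamma 2^-1 * (expR (- (2 * Num.sqrt q)))%:C.
Proof.
move=> q0; have r2 : Re (2^-1 : R[i]) = 2^-1 by rewrite -rc_nat -rcV.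
have n0 : (2^-1 : R[i]) != 0 by rewrite invr_eq0 pnatr_eq0.
rewrite Hint_phi//; last by rewrite r2; lra.
have -> : 1 - 2^-1 = 2^-1 :> R[i] by field.
rewrite expR_phi// Gamma_Nhalf.
have -> : cexp (2^-1 * (ln q)%:C) = (Num.sqrt q)%:C.
  rewrite -rc_nat -rcV -rcM cexp_real; congr (_%:C).
  have h : 0 <= expR (2^-1 * ln q) by exact: expR_ge0.
  apply/eqP; rewrite -(@eqrXn2 _ 2)// ?sqrtr_ge0// sqr_sqrtr ?ltW// -expRM_natl mulrA mulfV//.
  by rewrite mul1r lnK.
rewrite rcM rc_nat; ring.
Qed.

End termwise.

(** * Two evaluations of a double integral *)

Section double_integrals.
Context {R : realType}.
Notation mu := (@lebesgue_measure R).
Implicit Types (a nu : R[i]) (x s t r al tau : R).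

Lemma cintg_real (f : R -> R) : intg f -> cintg (fun t => (f t)%:C).
Proof. by move=> fi; apply: cintgP; [exact: fi|exact: integrable0]. Qed.

Lemma cfubini_eq (F : R -> R -> R[i]) (G : R -> R[i]) (g1 g2 : R -> R) :
  cmeas (fun p : R * R => F p.1 p.2) -> intg g1 -> intg g2 ->
  (forall s t, nm (F s t) <= g1 s * g2 t) -> (forall t, cint (F ^~ t) = G t) ->
  [/\ cintg (fun s => cint (F s)), cintg G & cint (fun s => cint (F s)) = cint G].
Proof.
move=> mF i1 i2 FL /funext <-; exact: (cfubini mF i1 i2 FL).
Qed.

Lemma measurable_fstM (f : R -> R) : measurable_fun setT f ->
  measurable_fun setT (fun p : R * R => f p.1).
Proof. by move=> mf; exact: (measurableT_comp mf measurable_fst). Qed.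

Lemma measurable_sndM (f : R -> R) : measurable_fun setT f ->
  measurable_fun setT (fun p : R * R => f p.2).
Proof. by move=> mf; exact: (measurableT_comp mf measurable_snd). Qed.

Lemma cmeas_fst (f : R -> R[i]) : cmeas f -> cmeas (fun p : R * R => f p.1).
Proof. by move=> [h1 h2]; split; [exact: (measurable_fstM h1)|exact: (measurable_fstM h2)]. Qed.

Lemma cmeas_snd (f : R -> R[i]) : cmeas f -> cmeas (fun p : R * R => f p.2).
Proof. by move=> [h1 h2]; split; [exact: (measurable_sndM h1)|exact: (measurable_sndM h2)]. Qed.

Lemma cint_reflect_shift (f : R -> R[i]) s : ccont f ->
  cint f = cint (fun r => f (s - r)).
Proof.
move=> cf; rewrite (cint_oppr cf) (@cint_shift _ (- s)).
  by apply: eq_cint => r; rewrite opprD opprK addrC.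
by apply: ccont_comp; [exact: cf|exact: oppr_continuous].
Qed.

Definition Jker a nu x r : R[i] :=
  cexp (nu * r%:C + (nu - a) * (ln (1 + expR (- r)))%:C) * (expR (- (x * expR r)))%:C.

(* Gamma(a) Psi(a, 1 + nu; x) by Laplace's integral, in the variable r = ln t. *)
Definition Jint a nu x := cint (Jker a nu x).

Lemma nm_Jker_le a nu x r : 0 < Re (a - nu) -> nm (Jker a nu x r) <= expR (Re a * r - x * expR r).
Proof.
move=> an0; have AN : 0 < Re a - Re nu by move: an0; rewrite cReB.
rewrite /Jker nmM nm_cexp nm_real ger0_norm ?expR_ge0// -expRD ler_expR.
rewrite cReD !cReMl cReB.
have : - r <= ln (1 + expR (- r)).
  by rewrite -{1}(expRK (- r)) ler_ln ?posrE ?addr_gt0 ?expR_gt0// lerDr.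
by move=> /(ler_wpM2l (ltW AN)); lra.
Qed.

Lemma ccont_Jker a nu x : ccont (Jker a nu x).
Proof.
apply: ccontM; last first.
  apply: ccont_real => t; apply: continuous_comp; last exact: continuous_expR.
  by apply: cvgN; apply: cvgM; [exact: cvg_cst|exact: continuous_expR].
apply: ccont_cexp; apply: ccontD; first by apply: ccontM; [exact: ccont_cst|exact: ccont_id].
apply: ccontM; first exact: ccont_cst.
apply: ccont_real => t; apply: (@continuous_comp _ _ _ (fun r : R => 1 + expR (- r)) (@ln R)).
  apply: cvgD; first exact: cvg_cst.
  by apply: continuous_comp; [exact: oppr_continuous|exact: continuous_expR].
by apply: continuous_ln; rewrite addr_gt0// expR_gt0.
Qed.

Lemma cintg_Jker a nu x : 0 < Re a -> 0 < Re (a - nu) -> 0 < x -> cintg (Jker a nu x).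
Proof.
move=> a0 an0 x0; apply: cintg_le (intg_gexp a0 x0); first exact/ccont_meas/ccont_Jker.
by move=> r; exact: nm_Jker_le.
Qed.

Lemma Iab_Jint a nu x : 0 < Re a -> 0 < Re (a - nu) -> 0 < x ->
  Iab a nu x = Gamma (a - nu) * Jint a nu x.
Proof.
move=> a0 an0 x0; set A := Re a; set N := Re nu.
have AN : 0 < A - N by move: an0; rewrite cReB.
pose F s r := gker (a - nu) (1 + expR (- r)) s * (cexp (nu * r%:C) * (expR (- (x * expR r)))%:C).
have E1 s : gker a 1 s * Hint (- nu) (x * expR s) = cint (F s).
  have xs : 0 < x * expR s by rewrite mulr_gt0// expR_gt0.
  rewrite /Hint (cint_reflect_shift s (ccont_hker _ _)).
  have i1 : cintg (fun r => hker (- nu) (x * expR s) (s - r)).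
    have [C [d d0 HC]] := @hker_decay _ (- nu) (x * expR s) ltac:(by rewrite /hadm xs).
    have bb r : nm (hker (- nu) (x * expR s) (s - r)) <= C * expR (d * `|s|) * expR (- (d * `|r|)).
      apply: le_trans (HC (s - r)) _; rewrite -mulrA -expRD.
      have C0 : 0 <= C.
        by have := HC 0; rewrite normr0 mulr0 oppr0 expR0 mulr1; apply: le_trans; exact: nm_ge0.
      apply: ler_wpM2l => //; rewrite ler_expR.
      have : `|r| <= `|s - r| + `|s|.
        have -> : `|r| = `|s - (s - r)| by rewrite opprB addrC subrK.
        by rewrite [leRHS]addrC; exact: ler_normB.
      by move=> h; have := ler_wpM2l (ltW d0) h; lra.
    apply: (cintg_le _ bb); last exact: intgZ (intg_expabs d0).
    apply: ccont_meas; apply: ccont_comp; first exact: ccont_hker.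
    by move=> t; apply: cvgB; [exact: cvg_cst|exact: cvg_id].
  rewrite -(cintZ _ i1); apply: eq_cint => r.
  rewrite /F /gker /hker opprB.
  have -> : x * expR s * expR (r - s) = x * expR r.
    by rewrite -mulrA -expRD addrC subrK.
  have -> : - nu * (s - r)%:C = - (nu * s%:C) + nu * r%:C by rewrite rcB; ring.
  have -> : (a - nu) * s%:C = a * s%:C + - (nu * s%:C) by ring.
  rewrite !cexpD.
  have -> : expR (- ((1 + expR (- r)) * expR s)) = expR (- (1 * expR s)) * expR (- expR (s - r)).
    by rewrite -expRD; congr expR; rewrite (expRD s); ring.
  have -> : expR (- expR (s - r) - x * expR r) = expR (- expR (s - r)) * expR (- (x * expR r)).
    by rewrite -expRD.
  by rewrite !rcM; ring.
rewrite /Iab (eq_cint E1).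
set m := (A - N + Num.max 0 (- N)) / 2.
have mN : 0 < N + m by rewrite /m; case: (leP 0 (- N)) => h; move: a0 AN; rewrite -/A; lra.
have mA : 0 < A - N - m by rewrite /m; case: (leP 0 (- N)) => h; move: a0 AN; rewrite -/A; lra.
have m0 : 0 <= m by rewrite /m; case: (leP 0 (- N)) => h; move: a0 AN; rewrite -/A; lra.
clearbody m.
have [K K0 HK] := @expR_expR_le _ 1 m ltr01 m0.
have mF : cmeas (fun p : R * R => F p.1 p.2).
  apply: cmeasM.
    apply: cmeasM.
      exact: (cmeas_fst (f := fun s => cexp ((a - nu) * s%:C))
        (ccont_meas (ccont_cexp (ccontM (@ccont_cst _ (a - nu)) (@ccont_id R))))).
    apply: cmeas_real; apply: measurableT_comp => //; apply: measurableT_comp => //.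
    apply: measurable_funM.
      apply: (@measurable_sndM (fun r => 1 + expR (- r))).
      apply: continuous_measurable_fun => t; apply: cvgD; first exact: cvg_cst.
      by apply: continuous_comp; [exact: oppr_continuous|exact: continuous_expR].
    exact: (@measurable_fstM expR).
  apply: (cmeas_snd (f := fun r => cexp (nu * r%:C) * (expR (- (x * expR r)))%:C)).
  exact/ccont_meas/ccont_gker.
have bF s r : nm (F s r) <=
    K * expR ((A - N - m) * s - 1 * expR s) * expR ((N + m) * r - x * expR r).
  rewrite /F nmM nm_gker cReB -/A -/N nmM nm_cexp cReMl -/N nm_real ger0_norm ?expR_ge0//.
  have := HK (s - r); rewrite mul1r => h.
  have -> : expR ((A - N) * s - (1 + expR (- r)) * expR s) * (expR (N * r) * expR (- (x * expR r)))
    = expR (- expR (s - r)) * expR ((A - N) * s - 1 * expR s + N * r - x * expR r).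
    by rewrite -!expRD; congr expR; rewrite (expRD s); ring.
  apply: le_trans (ler_wpM2r (expR_ge0 _) h) _.
  rewrite -!mulrA -!expRD le_eqVlt; apply/predU1P; left.
  by congr (_ * expR _); ring.
have [_ _ ->] := cfubini mF (intgZ K (intg_gexp mA ltr01)) (intg_gexp mN x0) bF.
rewrite /Jint.
have E2 r : cint (F ^~ r) = Gamma (a - nu) * Jker a nu x r.
  have r1 : 0 < 1 + expR (- r) by rewrite addr_gt0// expR_gt0.
  have i1 := cintg_gker an0 r1.
  transitivity (cint (fun s => (cexp (nu * r%:C) * (expR (- (x * expR r)))%:C) *
      gker (a - nu) (1 + expR (- r)) s)).
    by apply: eq_cint => s; rewrite /F mulrC.
  rewrite (cintZ _ i1) cint_gker// /Jker cexpD.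
  have -> : - ((a - nu) * (ln (1 + expR (- r)))%:C) = (nu - a) * (ln (1 + expR (- r)))%:C by ring.
  ring.
rewrite (eq_cint E2) cintZ//; exact: cintg_Jker.
Qed.

Lemma expR_half_le al : 0 < al -> exists2 C, 0 <= C & forall y s, 0 < y ->
  expR (al * s - expR s - y * expR (s / 2))
    <= C * expR (- (al * ln y)) * expR (al / 2 * s - 1 * expR s).
Proof.
move=> al0; have [K K0 HK] := @expR_expR_le _ 1 al ltr01 (ltW al0).
exists K => // y s y0.
have h := HK (ln y + s / 2); rewrite mul1r expRD lnK// in h.
have -> : expR (al * s - expR s - y * expR (s / 2)) =
   expR (- (y * expR (s / 2))) * expR (al * s - 1 * expR s).
  by rewrite -expRD; congr expR; ring.
apply: le_trans (ler_wpM2r (expR_ge0 _) h) _.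
by rewrite -!mulrA -!expRD; apply: ler_wpM2l => //; rewrite ler_expR; lra.
Qed.

Definition rG al y := \int[mu]_s expR (al * s - expR s - y * expR (s / 2)).

Lemma intg_rG al y : 0 < al -> 0 < y ->
  intg (fun s => expR (al * s - expR s - y * expR (s / 2))).
Proof.
move=> al0 y0; have [C C0 HC] := expR_half_le al0.
have h0 : 0 < al / 2 by rewrite divr_gt0.
apply: intg_le (intgZ (C * expR (- (al * ln y))) (intg_gexp h0 ltr01)).
  apply: continuous_measurable_fun => t; apply: continuous_comp; last exact: continuous_expR.
  apply: cvgB; first apply: cvgB; [|exact: continuous_expR|].
    by apply: cvgM; [exact: cvg_cst|exact: cvg_id].
  apply: cvgM; first exact: cvg_cst.
  apply: continuous_comp; last exact: continuous_expR.
  by apply: cvgM; [exact: cvg_id|exact: cvg_cst].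
by move=> s; rewrite ger0_norm ?expR_ge0//; exact: HC.
Qed.

Definition xcosh x r := 2 * Num.sqrt x * cosh (r / 2).

Lemma cosh_ge r : expR `|r| / 2 <= cosh r.
Proof.
rewrite /cosh ler_pM2r ?invr_gt0//; have [r0|r0] := leP 0 r.
  by rewrite (ger0_norm r0) lerDl expR_ge0.
by rewrite (ltr0_norm r0) lerDr expR_ge0.
Qed.

Lemma cosh_gt0 r : 0 < cosh r.
Proof. by apply: lt_le_trans (cosh_ge r); rewrite divr_gt0// expR_gt0. Qed.

Lemma xcosh_gt0 x r : 0 < x -> 0 < xcosh x r.
Proof.
by move=> x0; rewrite /xcosh mulr_gt0 ?cosh_gt0// mulr_gt0// sqrtr_gt0.
Qed.

Lemma xcosh_ge x r : 0 < x -> Num.sqrt x * expR (`|r| / 2) <= xcosh x r.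
Proof.
move=> x0; have := cosh_ge (r / 2); rewrite normrM (ger0_norm (_ : 0 <= 2^-1))// => h.
have := ler_wpM2l (sqrtr_ge0 x) h; rewrite /xcosh; lra.
Qed.

Lemma expR_xcosh_le al x : 0 < al -> 0 < x -> exists2 C, 0 <= C & forall r s,
  expR (al * s - expR s - xcosh x r * expR (s / 2))
    <= C * expR (- (al / 2 * `|r|)) * expR (al / 2 * s - 1 * expR s).
Proof.
move=> al0 x0; have [C C0 HC] := expR_half_le al0.
exists (C * expR (- (al * ln (Num.sqrt x)))); first by rewrite mulr_ge0 ?expR_ge0.
move=> r s; apply: le_trans (HC _ s (xcosh_gt0 r x0)) _.
apply: ler_wpM2r; first exact: expR_ge0.
rewrite -mulrA -expRD; apply: ler_wpM2l => //; rewrite ler_expR.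
have sx : 0 < Num.sqrt x by rewrite sqrtr_gt0.
have : ln (Num.sqrt x * expR (`|r| / 2)) <= ln (xcosh x r).
  have p1 : 0 < Num.sqrt x * expR (`|r| / 2) by rewrite mulr_gt0// expR_gt0.
  by rewrite ler_ln ?posrE ?xcosh_gt0//; exact: (xcosh_ge r x0).
rewrite lnM ?posrE ?expR_gt0// expRK => /(ler_wpM2l (ltW al0)); lra.
Qed.

Lemma continuous_cosh : continuous (@cosh R).
Proof.
move=> t; apply: cvgM; last exact: cvg_cst.
apply: cvgD; first exact: continuous_expR.
by apply: continuous_comp; [exact: oppr_continuous|exact: continuous_expR].
Qed.

Lemma continuous_xcosh x : continuous (xcosh x).
Proof.
move=> t; apply: cvgM; first exact: cvg_cst.
apply: (@continuous_comp _ _ _ (fun r : R => r / 2) (@cosh R)); last exact: continuous_cosh.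
by apply: cvgM; [exact: cvg_id|exact: cvg_cst].
Qed.

Definition iR t : R[i] := 0 +i* t.

Lemma iRM s t : iR (s * t) = iR s * t%:C.
Proof. by apply: complex_ext; rewrite ?cReMl ?cImMl /= ?mul0r. Qed.

(* Substituting (r - s - ln x) / 2 in H symmetrizes its exponent:
   the integrand becomes e^(al s - e^s - xcosh x r e^(s/2)) e^(i tau r). *)
Lemma Iab_fourier al tau x : 0 < al -> 0 < x ->
  cintg (fun r => cexp (iR (tau * r)) * (rG al (xcosh x r))%:C) /\
  Iab (al%:C + iR tau) (iR (2 * tau)) x =
   2^-1 * cexp (- (iR tau * (ln x)%:C)) * cint (fun r => cexp (iR (tau * r)) * (rG al (xcosh x r))%:C).
Proof.
move=> al0 x0; set C0 := cexp (- (iR tau * (ln x)%:C)).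
pose F s r : R[i] := cexp (iR (tau * r)) * (expR (al * s - expR s - xcosh x r * expR (s / 2)))%:C.
have [C Cge HC] := expR_xcosh_le al0 x0.
have h0 : 0 < al / 2 by rewrite divr_gt0.
have mF : cmeas (fun p : R * R => F p.1 p.2).
  apply: cmeasM.
    apply: (cmeas_snd (f := fun r => cexp (iR (tau * r)))).
    apply: ccont_meas; apply: ccont_cexp.
    have -> : (fun t => iR (tau * t)) = (fun t => iR tau * t%:C) by apply/funext => t; exact: iRM.
    by apply: ccontM; [exact: ccont_cst|exact: ccont_id].
  apply: cmeas_real; apply: measurableT_comp => //; apply: measurable_funB.
    apply: (@measurable_fstM (fun s => al * s - expR s)).
    by apply: measurable_funB => //; apply: measurable_funM.
  apply: measurable_funM.
    apply: (@measurable_sndM (xcosh x)); apply: continuous_measurable_fun; exact: continuous_xcosh.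
  apply: (@measurable_fstM (fun s => expR (s / 2))); apply: measurableT_comp => //.
  exact: measurable_funM.
have nF s r : nm (F s r) = expR (al * s - expR s - xcosh x r * expR (s / 2)).
  by rewrite /F nmM nm_cexp nm_real ger0_norm ?expR_ge0//= expR0 mul1r.
have bF s r : nm (F s r) <= expR (al / 2 * s - 1 * expR s) * (C * expR (- (al / 2 * `|r|))).
  by rewrite nF [leRHS]mulrC; exact: HC.
have E2 r : cint (F ^~ r) = cexp (iR (tau * r)) * (rG al (xcosh x r))%:C.
  have iG : cintg (fun s => (expR (al * s - expR s - xcosh x r * expR (s / 2)))%:C).
    exact: (cintg_real (intg_rG al0 (xcosh_gt0 r x0))).
  by rewrite /F (cintZ _ iG) cint_real.
have [i1 i2 <-] := cfubini_eq mF (intg_gexp h0 ltr01) (intgZ C (intg_expabs h0)) bF E2.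
split; first exact: i2.
rewrite -(cintZ _ i1) /Iab; apply: eq_cint => s.
have xs : 0 < x * expR s by rewrite mulr_gt0// expR_gt0.
rewrite /Hint (cint_oppr (ccont_hker _ _)) (@cint_affine _ (2^-1) (- ((s + ln x) / 2))) ?invr_gt0//; last first.
  by apply: ccont_comp; [exact: ccont_hker|exact: oppr_continuous].
have iF : cintg (F s).
  apply: (cintg_le _ (bF s)); last exact: intgZ (intgZ C (intg_expabs h0)).
  apply: ccont_meas; apply: ccontM.
    apply: ccont_cexp.
    have -> : (fun t => iR (tau * t)) = (fun t => iR tau * t%:C) by apply/funext => t; exact: iRM.
    by apply: ccontM; [exact: ccont_cst|exact: ccont_id].
  apply: ccont_real => r; apply: continuous_comp; last exact: continuous_expR.
  apply: cvgB; first exact: cvg_cst.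
  by apply: cvgM; [exact: continuous_xcosh|exact: cvg_cst].
have key r : (2^-1)%:C * hker (- iR (2 * tau)) (x * expR s) (- (2^-1 * r - (s + ln x) / 2)) =
    2^-1 * C0 * (cexp (- (iR tau * s%:C)) * (expR (- (al * s - expR s)))%:C) * F s r.
  set e := - (2^-1 * r - (s + ln x) / 2).
  rewrite /hker /F rcV rc_nat.
  have -> : - iR (2 * tau) * e%:C = - (iR tau * (ln x)%:C) + - (iR tau * s%:C) + iR (tau * r).
    by apply: complex_ext; rewrite /e !(cReD, cImD, cReN, cImN, cReMl, cImMl) /=; lra.
  rewrite !cexpD -/C0.
  have -> : expR (- expR e - x * expR s * expR (- e)) =
      expR (- (al * s - expR s)) * expR (al * s - expR s - xcosh x r * expR (s / 2)).
    rewrite -expRD; congr expR.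
    have sx : expR (ln x / 2) = Num.sqrt x.
      apply/eqP; rewrite -(@eqrXn2 _ 2)// ?expR_ge0 ?sqrtr_ge0// sqr_sqrtr ?ltW//.
      by rewrite -expRM_natr divfK// lnK.
    have e1 : expR e = Num.sqrt x * expR (s / 2) * expR (- (r / 2)).
      by rewrite -sx -!expRD; congr expR; rewrite /e; lra.
    have e2 : x * expR s * expR (- e) = Num.sqrt x * expR (s / 2) * expR (r / 2).
      rewrite -{1}(lnK x0) -sx -!expRD; congr expR; rewrite /e; lra.
    by rewrite e1 e2 /xcosh /cosh; field.
  rewrite rcM; ring.
rewrite (eq_cint key) (cintZ _ iF) /gker mulrDl (cexpD (al%:C * _)) -rcM cexp_real cexpN.
have -> : (expR (- (al * s - expR s)))%:C = ((expR (al * s))%:C * (expR (- (1 * expR s)))%:C)^-1 :> R[i].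
  by rewrite -rcM -expRD -rcV -expRN mul1r.
set X := cexp (iR tau * s%:C); set Y := (expR (al * s))%:C; set Z := (expR (- (1 * expR s)))%:C.
have X0 : X != 0 by exact: cexp_neq0.
have Y0 : Y != 0 by rewrite rc_neq0 gt_eqF ?expR_gt0.
have Z0 : Z != 0 by rewrite rc_neq0 gt_eqF ?expR_gt0.
move: (cint (F s)) => I; field; by rewrite X0 Y0 Z0.
Qed.

Lemma Iab_half al w : 0 < al -> 0 < w ->
  Iab al%:C (- 2^-1) w = Gamma 2^-1 * (rG al (2 * Num.sqrt w))%:C.
Proof.
move=> al0 w0.
have y0 : 0 < 2 * Num.sqrt w by rewrite mulr_gt0// sqrtr_gt0.
have iG : cintg (fun s => (expR (al * s - expR s - 2 * Num.sqrt w * expR (s / 2)))%:C).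
  exact: (cintg_real (intg_rG al0 y0)).
rewrite /rG -cint_real -(cintZ _ iG).
rewrite /Iab; apply: eq_cint => s.
have ws : 0 < w * expR s by rewrite mulr_gt0// expR_gt0.
rewrite opprK Hint_half// gker_real mulrCA -rcM -expRD; congr (_ * (expR _)%:C).
have -> : Num.sqrt (w * expR s) = Num.sqrt w * expR (s / 2).
  rewrite sqrtrM ?ltW//; congr (_ * _).
  apply/eqP; rewrite -(@eqrXn2 _ 2)// ?expR_ge0 ?sqrtr_ge0// sqr_sqrtr ?expR_ge0//.
  by rewrite -expRM_natr divfK.
by rewrite mul1r mulrA.
Qed.

(* Both sides are the integral of e^(s/2 + al r) exp(- e^s - e^(r - s)). *)
Lemma Gamma_duplication al : 0 < al ->
  Gamma al%:C * Gamma (al%:C + 2^-1) =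
  2 * (expR (- (2 * al * ln 2)))%:C * Gamma 2^-1 * Gamma (2 * al)%:C.
Proof.
move=> al0.
have r2 : Re (2^-1 : R[i]) = 2^-1 by rewrite -rc_nat -rcV.
pose F s r : R[i] := gker 2^-1 1 s * gker al%:C (expR (- s)) r.
have [K1 K10 H1] := @expR_expR_le _ 1 (al / 2) ltr01 (ltW (divr_gt0 al0 (ltr0n _ 2))).
have h32 : 0 < 3 * al / 2 by lra.
have [K2 K20 H2] := @expR_expR_le _ 1 (3 * al / 2) ltr01 (ltW h32).
have h2 : 0 < al / 2 by lra.
pose g s := K1 * expR ((2^-1 + al / 2) * s - 1 * expR s) + K2 * expR ((2^-1 + 3 * al / 2) * s - 1 * expR s).
have ig : intg g by apply: intgD; apply: intgZ; apply: intg_gexp => //; lra.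
have nF s r : nm (F s r) = expR (2^-1 * s - 1 * expR s + al * r) * expR (- (1 * expR (r - s))).
  rewrite /F nmM !nm_gker r2 -!expRD; congr expR; have -> : Re al%:C = al by [].
  rewrite (addrC (- s)); ring.
have bF s r : nm (F s r) <= g s * expR (- (al / 2 * `|r|)).
  rewrite nF /g mulrDl.
  have [r0|r0] := leP 0 r.
    apply: (@le_trans _ _ (K2 * expR ((2^-1 + 3 * al / 2) * s - 1 * expR s) * expR (- (al / 2 * r)))); last first.
      by rewrite (ger0_norm r0) lerDr; apply: mulr_ge0; [apply: mulr_ge0 => //; exact: expR_ge0|exact: expR_ge0].
    apply: le_trans (ler_wpM2l (expR_ge0 _) (H2 (r - s))) _.
    rewrite (mulrCA (expR _) K2) -(mulrA K2) -!expRD; apply: ler_wpM2l => //; rewrite ler_expR; lra.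
  apply: (@le_trans _ _ (K1 * expR ((2^-1 + al / 2) * s - 1 * expR s) * expR (- (al / 2 * - r)))); last first.
    by rewrite (ltr0_norm r0) lerDl; apply: mulr_ge0; [apply: mulr_ge0 => //; exact: expR_ge0|exact: expR_ge0].
  apply: le_trans (ler_wpM2l (expR_ge0 _) (H1 (r - s))) _.
  rewrite (mulrCA (expR _) K1) -(mulrA K1) -!expRD; apply: ler_wpM2l => //; rewrite ler_expR; lra.
have mF : cmeas (fun p : R * R => F p.1 p.2).
  apply: cmeasM; first exact: (cmeas_fst (ccont_meas (ccont_gker 2^-1 1))).
  apply: cmeasM.
    exact: (cmeas_snd (f := fun r => cexp (al%:C * r%:C))
        (ccont_meas (ccont_cexp (ccontM (@ccont_cst _ al%:C) (@ccont_id R))))).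
  apply: cmeas_real; apply: measurableT_comp => //; apply: measurableT_comp => //.
  apply: measurable_funM.
    apply: (@measurable_fstM (fun s => expR (- s))).
    apply: continuous_measurable_fun => t.
    by apply: continuous_comp; [exact: oppr_continuous|exact: continuous_expR].
  exact: (@measurable_sndM expR).
have half0 : 0 < Re (al%:C + 2^-1) by rewrite cReD r2 /= addr_gt0.
have E1 s : cint (F s) = Gamma al%:C * gker (al%:C + 2^-1) 1 s.
  have iG : cintg (gker al%:C (expR (- s))) := @cintg_gker R al%:C _ al0 (expR_gt0 _).
  rewrite /F (cintZ _ iG) (@cint_gker R al%:C _ al0 (expR_gt0 _)) expRK rcN mulrN opprK addrC gker_shift mulrCA; ring.
have E2 r : cint (F ^~ r) = Gamma 2^-1 * gker al%:C 0 r * (expR (- (2 * expR (r / 2))))%:C.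
  have er : 0 < expR r by exact: expR_gt0.
  have -> : cint (F ^~ r) = cint (fun s => gker al%:C 0 r * hker 2^-1 (expR r) s).
    apply: eq_cint => s; rewrite /F /gker /hker mul0r oppr0 expR0 mulr1 mulrCA; congr (_ * _).
    rewrite -mulrA; congr (_ * _); rewrite -rcM -expRD mul1r (mulrC (expR r)); done.
  have iH : cintg (hker 2^-1 (expR r)) by apply: cintg_hker; rewrite /hadm er.
  rewrite (cintZ _ iH) -/(Hint _ _) Hint_half// mulrCA -[RHS]mulrA; congr (_ * (_ * (expR (- (2 * _)))%:C)).
  apply/eqP; rewrite -(@eqrXn2 _ 2)// ?expR_ge0 ?sqrtr_ge0// sqr_sqrtr ?expR_ge0//.
  by rewrite -expRM_natr divfK.
have [_ _] := cfubini_eq mF ig (intg_expabs h2) bF E2.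
rewrite (eq_cint E1) (cintZ _ (cintg_gker half0 ltr01)) cint_gker// ln1 mulr0 oppr0 cexp0 mul1r => ->.
have cc : ccont (fun r => Gamma 2^-1 * gker al%:C 0 r * (expR (- (2 * expR (r / 2))))%:C).
  apply: ccontM; first by apply: ccontM; [exact: ccont_cst|exact: ccont_gker].
  apply: ccont_real => t; apply: continuous_comp; last exact: continuous_expR.
  apply: cvgN; apply: cvgM; first exact: cvg_cst.
  apply: continuous_comp; last exact: continuous_expR.
  by apply: cvgM; [exact: cvg_id|exact: cvg_cst].
rewrite (@cint_affine _ 2 0 _ _ cc)//.
have a20 : 0 < Re (2 * al)%:C by rewrite /= mulr_gt0.
have i2 : cintg (gker (2 * al)%:C 2) by apply: cintg_gker.
have key r : (2 : R)%:C * (Gamma 2^-1 * gker al%:C 0 (2 * r + 0) * (expR (- (2 * expR ((2 * r + 0) / 2))))%:C)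
   = 2 * Gamma 2^-1 * gker (2 * al)%:C 2 r.
  rewrite addr0 /gker mul0r oppr0 expR0 mulr1 rc_nat (mulrC 2 r) mulfK//.
  have -> : al%:C * (r * 2)%:C = (2 * al)%:C * r%:C :> R[i] by rewrite -!rcM; congr _%:C; ring.
  ring.
rewrite (eq_cint key) (cintZ _ i2) cint_gker// -rcM -rcN cexp_real; ring.
Qed.

End double_integrals.

(** * Closed forms for Whittaker and parabolic cylinder functions *)

Section values.
Context {R : realType}.
Notation mu := (@lebesgue_measure R).
Implicit Types (a c nu w z : R[i]) (x s t r al tau : R).

Lemma le_of_eq s t : s = t -> s <= t. Proof. by move=> ->. Qed.

Lemma lipschitz1 (f df : R -> R) : (forall t, is_derive t 1 f (df t)) ->
  (forall t, `|df t| <= 1) -> forall s t, `|f t - f s| <= `|t - s|.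
Proof.
move=> dfP df1.
have H s t : s <= t -> `|f t - f s| <= `|t - s|.
  move=> st; have [|d _ ->] := @MVT_segment R f df s t st (fun u _ => dfP u).
    by apply: continuous_subspaceT => u; exact: (is_derive_continuous dfP).
  by rewrite normrM ler_piMl.
move=> s t; have [st|/ltW ts] := leP s t; first exact: H.
by rewrite distrC (distrC t); exact: H.
Qed.

Lemma norm_sin_le t : `|sin t| <= `|t|.
Proof.
have := @lipschitz1 (@sin R) (@cos R) (fun t => is_derive_sin t) _ 0 t.
by rewrite sin0 !subr0; apply=> u; rewrite ler_norml cos_geN1 cos_le1.
Qed.

Lemma norm_cosB1_le t : `|cos t - 1| <= `|t|.
Proof.
have := @lipschitz1 (@cos R) (fun u => - sin u) (fun t => is_derive_cos t) _ 0 t.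
by rewrite cos0 !subr0; apply=> u; rewrite normrN ler_norml sin_geN1 sin_le1.
Qed.

Lemma norm_expRB1_le t : `|expR t - 1| <= `|t| * expR `|t|.
Proof.
have [t0|t0] := leP 0 t.
  rewrite ger0_norm; last by rewrite subr_ge0 -expR0 ler_expR.
  have := ler_wpM2l (expR_ge0 t) (expR_ge1Dx (- t)).
  rewrite -expRD subrr expR0 mulrDr mulr1 (ger0_norm t0); lra.
have e1 : expR t <= 1 by rewrite -expR0 ler_expR ltW.
rewrite ler0_norm ?subr_le0// opprB.
have h1 := expR_ge1Dx t.
have h2 : 1 <= expR `|t| by rewrite -expR0 ler_expR.
by have := ler_wpM2l (normr_ge0 t) h2; rewrite mulr1; rewrite {1}ltr0_norm//; lra.
Qed.

Lemma nm_cexpB1_le z : nm (cexp z - 1) <= 3 * nm z * expR (nm z).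
Proof.
apply: le_trans (nm_le _) _; rewrite cReB cImB Re_cexp Im_cexp /= subr0.
set p := Re z; set q := Im z; have hp := ler_norm_Re z; have hq := ler_norm_Im z.
have E1 : expR p <= expR (nm z) by rewrite ler_expR; apply: le_trans hp; exact: ler_norm.
have E2 : expR `|p| <= expR (nm z) by rewrite ler_expR.
have n0 := nm_ge0 z; have e0 := expR_ge0 p.
have A1 : `|expR p * cos q - 1| <= nm z * expR (nm z) + nm z * expR (nm z).
  have -> : expR p * cos q - 1 = expR p * (cos q - 1) + (expR p - 1) by ring.
  apply: le_trans (ler_normD _ _) _; apply: lerD.
    rewrite normrM (ger0_norm e0) mulrC; apply: ler_pM => //; exact: le_trans (norm_cosB1_le q) hq.
  by apply: le_trans (norm_expRB1_le p) _; apply: ler_pM => //; exact: expR_ge0.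
have A2 : `|expR p * sin q| <= nm z * expR (nm z).
  rewrite normrM (ger0_norm e0) mulrC; apply: ler_pM => //; exact: le_trans (norm_sin_le q) hq.
lra.
Qed.

Lemma cint_cexp_lipschitz (f : R -> R[i]) (phi g : R -> R) d : 0 < d ->
  ccont f -> continuous phi -> intg g ->
  (forall t, nm (f t) * expR (d * `|phi t|) <= g t) ->
  exists K, forall nu, nm nu <= d / 2 ->
    nm (cint (fun t => cexp (nu * (phi t)%:C) * f t) - cint f) <= K * nm nu.
Proof.
move=> d0 cf cp ig H; exists (2 * (6 / d * \int[mu]_t g t)) => nu nud.
have i0 : cintg f.
  apply: (cintg_le (ccont_meas cf) _ ig) => t; apply: le_trans (H t).
  rewrite ler_peMr ?nm_ge0// -expR0 ler_expR mulr_ge0// ltW//.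
have c1 : ccont (fun t => cexp (nu * (phi t)%:C) * f t).
  apply: ccontM => //; apply: ccont_cexp; apply: ccontM; first exact: ccont_cst.
  exact: ccont_real.
have nup t : nm (nu * (phi t)%:C) <= d / 2 * `|phi t|.
  by rewrite nmM nm_real; apply: ler_wpM2r.
have i1 : cintg (fun t => cexp (nu * (phi t)%:C) * f t).
  apply: (cintg_le (ccont_meas c1) _ ig) => t; apply: le_trans (H t).
  rewrite nmM mulrC; apply: ler_wpM2l; first exact: nm_ge0.
  rewrite nm_cexp ler_expR; apply: le_trans (ler_norm _) _; apply: le_trans (ler_norm_Re _) _.
  apply: le_trans (nup t) _; apply: ler_wpM2r => //; lra.
rewrite -cintB//.
have B t : nm (cexp (nu * (phi t)%:C) * f t - f t) <= (nm nu * (6 / d)) * g t.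
  rewrite -{2}(mul1r (f t)) -mulrBl nmM.
  apply: (@le_trans _ _ (nm nu * (6 / d) * (nm (f t) * expR (d * `|phi t|)))); last first.
    apply: ler_wpM2l => //; rewrite mulr_ge0 ?nm_ge0//; apply: divr_ge0 => //; exact: ltW.
  rewrite [leRHS]mulrCA mulrC; apply: ler_wpM2l; first exact: nm_ge0.
  apply: le_trans (nm_cexpB1_le _) _.
  have e1 : `|phi t| <= 2 / d * expR (d / 2 * `|phi t|).
    have := expR_ge1Dx (d / 2 * `|phi t|).
    have := @ler_wpM2l _ (2 / d) _ (1 + d / 2 * `|phi t|) (expR (d / 2 * `|phi t|)).
    have -> : 2 / d * (1 + d / 2 * `|phi t|) = 2 / d + `|phi t| by field; rewrite gt_eqF.
    have d2 : 0 < 2 / d by rewrite divr_gt0.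
    by move=> h h'; move: (h (ltW d2) h'); lra.
  have e2 : expR (nm (nu * (phi t)%:C)) <= expR (d / 2 * `|phi t|) by rewrite ler_expR.
  rewrite nmM nm_real in e2 *.
  have -> : d * `|phi t| = d / 2 * `|phi t| + d / 2 * `|phi t| by field.
  rewrite expRD.
  apply: (@le_trans _ _ (3 * (nm nu * (2 / d * expR (d / 2 * `|phi t|))) * expR (d / 2 * `|phi t|))).
    apply: ler_pM => //; rewrite ?expR_ge0 ?mulr_ge0 ?nm_ge0//.
    by rewrite ler_pM2l//; apply: ler_wpM2l => //; exact: nm_ge0.
  by apply: le_of_eq; field; rewrite gt_eqF.
have ib : intg (fun t => nm nu * (6 / d) * g t) by exact: intgZ.
apply: le_trans (nm_cint_le _ B ib) _.
  by apply: cmeasD; [exact: ccont_meas|under eq_fun do rewrite -mulN1r; apply: cmeasM; [exact: ccont_meas (ccont_cst _)|exact: ccont_meas]].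
rewrite RintgZ//; apply: le_of_eq; ring.
Qed.

Lemma rGamma_gt0 t : 0 < t -> 0 < rGamma t.
Proof.
move=> t0; have ig := intg_gexp t0 ltr01; rewrite /rGamma /Rintegral; apply: fine_gt0.
have /integrableP[/= mf _] := ig.
apply/andP; split; last first.
  by have := integrable_lty measurableT ig.
have mI : measurable `[0, 1 : R]%classic by exact: measurable_itv.
have h1 : (0 < \int[mu]_(s in `[0%R, 1%R]) (expR (- expR 1))%:E)%E.
  by rewrite integral_cst//= lebesgue_measure_itv/= lte_fin ltr01 sube0 mule1 lte_fin expR_gt0.
have h2 : (\int[mu]_(s in `[0%R, 1%R]) (expR (t * s - 1 * expR s))%:E <= \int[mu]_s (expR (t * s - 1 * expR s))%:E)%E.
  by apply: ge0_subset_integral => // s _; rewrite lee_fin expR_ge0.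
apply: lt_le_trans h1 (le_trans _ h2).
apply: ge0_le_integral => //.
- exact: measurable_funTS.
- move=> s /=; rewrite in_itv /= => /andP[s0 s1]; rewrite lee_fin ler_expR.
  have : expR s <= expR 1 by rewrite ler_expR.
  have := mulr_ge0 (ltW t0) s0; lra.
Qed.

Lemma Jker_phi a nu x r :
  Jker a nu x r = cexp (nu * (r + ln (1 + expR (- r)))%:C) * Jker a 0 x r.
Proof.
rewrite /Jker mulrA -cexpD; congr (cexp _ * _); rewrite rcD; ring.
Qed.

Lemma Jint_lipschitz al x : 0 < al -> 0 < x -> exists K, forall nu, nm nu <= 2^-1 ->
  nm (Jint al%:C nu x - Jint al%:C 0 x) <= K * nm nu.
Proof.
move=> al0 x0; pose phi r : R := r + ln (1 + expR (- r)).
have cphi : continuous phi.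
  move=> t; apply: cvgD; first exact: cvg_id.
  apply: (@continuous_comp _ _ _ (fun r : R => 1 + expR (- r)) (@ln R)).
    apply: cvgD; first exact: cvg_cst.
    by apply: continuous_comp; [exact: oppr_continuous|exact: continuous_expR].
  by apply: continuous_ln; rewrite addr_gt0// expR_gt0.
have E r : expR (phi r) = 1 + expR r.
  by rewrite /phi expRD lnK ?posrE ?addr_gt0 ?expR_gt0// mulrDr mulr1 -expRD subrr expR0 addrC.
have phi0 r : 0 <= phi r.
  by rewrite -ler_expR E expR0 lerDl expR_ge0.
pose g r := expR (al * r - x * expR r) + expR ((al + 1) * r - x * expR r).
have ig : intg g by apply: intgD; apply: intg_gexp => //; lra.
have H t : nm (Jker al%:C 0 x t) * expR (1 * `|phi t|) <= g t.
  rewrite mul1r (ger0_norm (phi0 t)) E mulrDr mulr1 /g.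
  have h := @nm_Jker_le R al%:C 0 x t ltac:(by rewrite subr0).
  apply: lerD => //; apply: le_trans (ler_wpM2r (expR_ge0 _) h) _.
  by rewrite -expRD ler_expR /=; lra.
have [K HK] := cint_cexp_lipschitz ltr01 (ccont_Jker al%:C 0 x) cphi ig H.
exists K => nu nun; rewrite mul1r in HK; have := HK nu nun.
by rewrite /Jint (eq_cint (Jker_phi al%:C nu x)).
Qed.

Lemma Gamma_lipschitz al : 0 < al -> exists K, forall nu, nm nu <= al / 4 ->
  nm (Gamma (al%:C - nu) - Gamma al%:C) <= K * nm nu.
Proof.
move=> al0; have al2 : 0 < al / 2 by lra.
pose g t := expR (al / 2 * t - 1 * expR t) + expR (3 * al / 2 * t - 1 * expR t).
have ig : intg g by apply: intgD; apply: intg_gexp => //; lra.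
have H t : nm (gker al%:C 1 t) * expR (al / 2 * `|- t|) <= g t.
  rewrite nm_gker normrN /= -expRD; have [t0|t0] := leP 0 t.
    apply: (@le_trans _ _ (expR (3 * al / 2 * t - 1 * expR t))); last by rewrite lerDr expR_ge0.
    by rewrite (ger0_norm t0) ler_expR; lra.
  apply: (@le_trans _ _ (expR (al / 2 * t - 1 * expR t))); last by rewrite lerDl expR_ge0.
  by rewrite (ltr0_norm t0) ler_expR; lra.
have [K HK] := cint_cexp_lipschitz al2 (ccont_gker al%:C 1) (@oppr_continuous R R^o) ig H.
exists K => nu nun.
have n4 : nm nu <= al / 2 / 2 by lra.
have := HK nu n4; rewrite (@cint_gker R al%:C 1 al0 ltr01) ln1 mulr0 oppr0 cexp0 mul1r.
have an0 : 0 < Re (al%:C - nu).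
  by rewrite cReB /=; have := ler_norm (Re nu); have := ler_norm_Re nu; lra.
have <- : cint (gker (al%:C - nu) 1) = Gamma (al%:C - nu).
  by rewrite (cint_gker an0 ltr01) ln1 mulr0 oppr0 cexp0 mul1r.
congr (nm (_ - _) <= _); apply: eq_cint => t.
by rewrite gker_shift rcN mulrN mulNr.
Qed.

Lemma tricomi_generic_Iab a nu x : 0 < Re a -> 0 < Re (a - nu) -> nu != 0 ->
  - 2^-1 <= Re nu <= 2^-1 -> 0 < x -> Gamma a != 0 -> Gamma (a - nu) != 0 ->
  tricomi_generic a (nu + 1) x = Iab a nu x / (Gamma a * Gamma (a - nu)).
Proof.
move=> a0 an0 nu0 n12 x0 G1 G2; rewrite Iab_hyp1F1// /tricomi_generic /cpow.
have -> : 1 - (nu + 1) = - nu by ring.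
have -> : nu + 1 - 1 = nu by ring.
have -> : a - (nu + 1) + 1 = a - nu by ring.
have -> : 2 - (nu + 1) = 1 - nu by ring.
rewrite (addrC nu 1) mulNr; field; by rewrite G1 G2.
Qed.

(* For c = 1, tricomi is a limit; it is read off Jint, which is continuous in nu. *)
Lemma tricomi_one al x : 0 < al -> 0 < x ->
  Gamma al%:C * tricomi al%:C 1 x = Jint al%:C 0 x.
Proof.
move=> al0 x0.
have G0 : Gamma al%:C != 0 by rewrite Gamma_real// rc_neq0 gt_eqF ?rGamma_gt0.
have near_neq : \forall c' \near (1 : R[i]^o)^', c' != 1.
  by rewrite near_withinE; apply: nearW.
have [K1 H1] := Jint_lipschitz al0 x0; have [K2 H2] := Gamma_lipschitz al0.
suff L : (tricomi_generic al%:C c' x : R[i]^o) @[c' --> (1 : R[i]^o)^'] --> (Jint al%:C 0 x / Gamma al%:C : R[i]^o).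
  rewrite /tricomi; case: asboolP => [_|[]]; last by exists 1; rewrite rmorph1.
  by rewrite (cvg_lim _ L)// mulrC divfK.
have N1 : nm (c' - 1) @[c' --> (1 : R[i]^o)^'] --> (0 : R).
  by apply/cvgCP; exact: cvg_within.
have gG : 0 < nm (Gamma al%:C) by rewrite nm_gt0.
have K20 : 0 < `|K2| + 1 by rewrite ltr_wpDl.
have near_lt e : 0 < e -> \forall c' \near (1 : R[i]^o)^', nm (c' - 1) < e.
  move=> e0; exact: (cvgr_lt _ N1 _ e0).
apply/cvgCP.
suff H : \forall c' \near (1 : R[i]^o)^', 0 <= nm (tricomi_generic al%:C c' x - Jint al%:C 0 x / Gamma al%:C)
    <= K1 / nm (Gamma al%:C) * nm (c' - 1).
  apply: (squeeze_cvgr H); first exact: cvg_cst.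
  by rewrite -(mulr0 (K1 / nm (Gamma al%:C))); apply: cvgM => //; exact: cvg_cst.
near=> c'; rewrite nm_ge0 /=.
have c1 : c' != 1 by near: c'; exact: near_neq.
have h2 : nm (c' - 1) < 2^-1 by near: c'; apply: near_lt; rewrite invr_gt0.
have h4 : nm (c' - 1) < al / 4 by near: c'; apply: near_lt; rewrite divr_gt0.
have hG : nm (c' - 1) < nm (Gamma al%:C) / (`|K2| + 1).
  by near: c'; apply: near_lt; rewrite divr_gt0.
have [nu E] : exists nu, c' = nu + 1 by exists (c' - 1); rewrite subrK.
rewrite E addrK in h2 h4 hG *.
have nu0 : nu != 0 by apply: contra c1 => /eqP n0; rewrite E n0 add0r.
have Rn : `|Re nu| <= nm nu := ler_norm_Re nu.
have [R1 R2] : - nm nu <= Re nu /\ Re nu <= nm nu by apply/andP; rewrite -ler_norml.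
have a0 : 0 < Re (al%:C - nu) by rewrite cReB /=; lra.
have G2 : Gamma (al%:C - nu) != 0.
  apply/eqP => G2; have := H2 nu (ltW h4); rewrite G2 sub0r nmN leNgt => /negP; apply.
  rewrite ltr_pdivlMr// in hG; apply: le_lt_trans hG; rewrite mulrC; apply: ler_wpM2l; first exact: nm_ge0.
  by apply: le_trans (ler_norm _) _; rewrite lerDl.
rewrite tricomi_generic_Iab//; last by apply/andP; split; lra.
rewrite Iab_Jint//.
have -> : Gamma (al%:C - nu) * Jint al%:C nu x / (Gamma al%:C * Gamma (al%:C - nu)) - Jint al%:C 0 x / Gamma al%:C =
  (Jint al%:C nu x - Jint al%:C 0 x) / Gamma al%:C by field; rewrite G0 G2.
rewrite nmM nmV mulrAC; apply: ler_wpM2r; first by rewrite invr_ge0 ltW.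
exact: H1 (ltW h2).
Unshelve. all: by end_near.
Qed.

Lemma conjcM z w : (z * w)^*%C = z^*%C * w^*%C.
Proof. exact: (rmorphM (@conjc R)). Qed.

Lemma cint_conj (f : R -> R[i]) : cintg f -> cint (fun t => (f t)^*%C) = (cint f)^*%C.
Proof.
move=> [h1 h2]; apply: complex_ext; rewrite ?(Re_cint, Im_cint).
  by apply: eq_Rintegral => t _; case: (f t).
transitivity (- Im (cint f)); last by case: (cint f).
by rewrite Im_cint -RintgN//; apply: eq_Rintegral => t _; case: (f t).
Qed.

Lemma Gamma_conj w : 0 < Re w -> Gamma w^*%C = (Gamma w)^*%C.
Proof.
move=> w0; have w0' : 0 < Re w^*%C by move: w0; case: w.
have E v : 0 < Re v -> Gamma v = cint (gker v 1).
  by move=> v0; rewrite (cint_gker v0 ltr01) ln1 mulr0 oppr0 cexp0 mul1r.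
rewrite !E// -cint_conj; last exact: cintg_gker w0 ltr01.
apply: eq_cint => t; rewrite /gker.
by rewrite conjcM cexp_conj conjcM !conjc_real.
Qed.

Lemma normc2_Gamma_tricomi al tau x : 0 < al -> 0 < x ->
  `|Gamma (al +i* tau)| ^+ 2 * tricomi (al%:C + iR tau) (2 * iR tau + 1) x =
  Iab (al%:C + iR tau) (iR (2 * tau)) x.
Proof.
move=> al0 x0.
have aE : al +i* tau = al%:C + iR tau by apply: complex_ext; rewrite ?cReD ?cImD /=; ring.
have a0 : 0 < Re (al%:C + iR tau) by rewrite cReD /= addr0.
have -> : 2 * iR tau = iR (2 * tau) by rewrite mulrC -rc_nat -iRM mulrC.
rewrite sqr_normc aE -(Gamma_conj a0).
have cE : (al%:C + iR tau)^*%C = al%:C + iR tau - iR (2 * tau).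
  by apply: complex_ext; rewrite ?cReB ?cImB ?cReD ?cImD /=; ring.
have b0 : 0 < Re (al%:C + iR tau - iR (2 * tau)) by rewrite -cE /= addr0.
rewrite cE; have [t0|t0] := eqVneq tau 0.
  have -> : iR (2 * tau) = 0 by rewrite t0 mulr0.
  rewrite t0 (_ : iR 0 = 0)// !addr0 subr0 add0r -mulrA tricomi_one//.
  by rewrite Iab_Jint ?subr0.
have i0 : iR (2 * tau) != 0 by rewrite eq_complex /= negb_and mulf_neq0 ?orbT.
have gE : tricomi (al%:C + iR tau) (iR (2 * tau) + 1) x =
    tricomi_generic (al%:C + iR tau) (iR (2 * tau) + 1) x.
  rewrite /tricomi; case: asboolP => // -[m /(congr1 (@complex.Im R))].
  by rewrite cImD /= addr0 -(rmorph_int (@real_complex R)) /= => /eqP; rewrite mulf_eq0 (negbTE t0) pnatr_eq0.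
rewrite gE.
have [G0|G0] := eqVneq (Gamma (al%:C + iR tau)) 0.
  rewrite Iab_Jint// -cE Gamma_conj// G0 conjc0 !mul0r//.
rewrite tricomi_generic_Iab//=; last first.
- by rewrite -cE Gamma_conj// conjc_eq0.
- by apply/andP; split; rewrite ?oppr_le0 invr_ge0.
rewrite mulrC divfK// mulf_neq0//.
by rewrite -cE Gamma_conj// conjc_eq0.
Qed.

End values.

Section kernel.
Context {R : realType}.
Notation mu := (@lebesgue_measure R).
Implicit Types (x y s t r u v al be p m z : R).

Lemma rG_ge0 be y : 0 <= rG be y.
Proof. by apply: Rintegral_ge0 => t _; exact: expR_ge0. Qed.

Lemma rG_le be p : 0 <= p < 2 * be -> exists2 C, 0 <= C & forall y, 0 < y ->
  rG be y <= C * expR (- (p * ln y)).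
Proof.
move=> /andP[p0 pb]; have [K K0 HK] := @expR_expR_le _ 1 p ltr01 p0.
have b0 : 0 < be by lra.
have b2 : 0 < be - p / 2 by lra.
have ig := intg_gexp b2 ltr01.
exists (K * \int[mu]_s expR ((be - p / 2) * s - 1 * expR s)).
  by rewrite mulr_ge0//; apply: Rintegral_ge0 => t _; exact: expR_ge0.
move=> y y0; rewrite mulrAC -RintgZ//; apply: Rintg_le => [||s].
- exact: intg_rG.
- exact: intgZ.
have h := HK (ln y + s / 2); rewrite mul1r expRD lnK// in h.
have -> : expR (be * s - expR s - y * expR (s / 2)) =
   expR (- (y * expR (s / 2))) * expR (be * s - 1 * expR s).
  by rewrite -expRD; congr expR; ring.
apply: le_trans (ler_wpM2r (expR_ge0 _) h) _.
by rewrite -!mulrA -!expRD; apply: ler_wpM2l => //; rewrite ler_expR; lra.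
Qed.

Lemma expRN_lipschitz u v : 0 <= u -> 0 <= v -> `|expR (- u) - expR (- v)| <= `|u - v|.
Proof.
have H s t : 0 <= s -> s <= t -> `|expR (- s) - expR (- t)| <= `|s - t|.
  move=> s0 st; rewrite ger0_norm; last by rewrite subr_ge0 ler_expR lerN2.
  rewrite ler0_norm ?subr_le0// opprB.
  have -> : expR (- s) - expR (- t) = expR (- s) * (1 - expR (s - t)).
    by rewrite mulrBr mulr1 -expRD; congr (_ - expR _); ring.
  have e1 : expR (- s) <= 1 by rewrite -expR0 ler_expR oppr_le0.
  have e2 : 1 - expR (s - t) <= t - s by have := expR_ge1Dx (s - t); lra.
  have e3 : 0 <= 1 - expR (s - t) by rewrite subr_ge0 -expR0 ler_expR; lra.
  by apply: le_trans e2; rewrite ler_piMl.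
move=> u0 v0; have [uv|/ltW vu] := leP u v; first exact: H.
by rewrite distrC (distrC u); exact: H.
Qed.

Lemma rG_lipschitz be p : 0 <= p < 2 * be + 1 -> 0 < be -> exists2 C, 0 <= C & forall m u v,
  0 < m -> m <= u -> m <= v -> `|rG be u - rG be v| <= C * expR (- (p * ln m)) * `|u - v|.
Proof.
move=> hp b0; have [|C C0 HC] := @rG_le (be + 2^-1) p; first by rewrite mulrDr divff.
exists C => // m u v m0 mu_ mv; have u0 := lt_le_trans m0 mu_; have v0 := lt_le_trans m0 mv.
have iu := intg_rG b0 u0; have iv := intg_rG b0 v0.
have b2 : 0 < be + 2^-1 by lra.
have im := intg_rG b2 m0.
rewrite /rG -RintgB//.
apply: (@le_trans _ _ (`|u - v| * rG (be + 2^-1) m)); last first.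
  by rewrite mulrC; apply: ler_wpM2r => //; exact: HC.
rewrite /rG -RintgZ//; apply: Rintg_norm; [|exact: intgZ|].
  by apply: measurable_funB; exact: intg_meas.
move=> s; set q := expR (s / 2); have q0 : 0 < q by exact: expR_gt0.
have -> : expR (be * s - expR s - u * q) - expR (be * s - expR s - v * q) =
   expR (be * s - expR s - m * q) * (expR (- ((u - m) * q)) - expR (- ((v - m) * q))).
  by rewrite mulrBr -!expRD; congr (expR _ - expR _); ring.
rewrite normrM (ger0_norm (expR_ge0 _)).
have uq : 0 <= (u - m) * q by rewrite mulr_ge0 ?(ltW q0)// subr_ge0.
have vq : 0 <= (v - m) * q by rewrite mulr_ge0 ?(ltW q0)// subr_ge0.
apply: le_trans (ler_wpM2l (expR_ge0 _) (expRN_lipschitz uq vq)) _.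
have -> : (u - m) * q - (v - m) * q = (u - v) * q by ring.
rewrite normrM (gtr0_norm q0) mulrCA; apply: ler_wpM2l => //.
by rewrite /q -expRD ler_expR; lra.
Qed.

Lemma cosh_lipschitz u v : `|cosh u - cosh v| <= `|u - v| * expR `|u - v| * expR `|v|.
Proof.
have H s t : `|expR s - expR t| <= `|s - t| * expR `|s - t| * expR `|t|.
  have -> : expR s - expR t = (expR (s - t) - 1) * expR t.
    by rewrite mulrBl mul1r -expRD subrK.
  rewrite normrM (ger0_norm (expR_ge0 t)); apply: ler_pM => //; first exact: norm_expRB1_le.
  by rewrite ler_expR ler_norm.
have h1 := H u v; have := H (- u) (- v); rewrite normrN -opprD normrN => h2.
have -> : cosh u - cosh v = ((expR u - expR v) + (expR (- u) - expR (- v))) / 2.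
  by rewrite /cosh; field.
rewrite normrM (ger0_norm (_ : 0 <= 2^-1))//.
have := ler_normD (expR u - expR v) (expR (- u) - expR (- v)); lra.
Qed.

Definition Gk al x r := rG al (xcosh x r).

Lemma Gk_le al x : 0 < al -> 0 < x -> exists2 C, 0 <= C & forall r,
  `|Gk al x r| <= C * expR (- (al / 2 * `|r|)).
Proof.
move=> al0 x0; have [|C C0 HC] := @rG_le al al; first by apply/andP; split; lra.
exists (C * expR (- (al * ln (Num.sqrt x)))); first by rewrite mulr_ge0 ?expR_ge0.
move=> r; rewrite /Gk ger0_norm ?rG_ge0//; apply: le_trans (HC _ (xcosh_gt0 r x0)) _.
rewrite -mulrA -expRD; apply: ler_wpM2l => //; rewrite ler_expR.
have sx : 0 < Num.sqrt x by rewrite sqrtr_gt0.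
have : ln (Num.sqrt x * expR (`|r| / 2)) <= ln (xcosh x r).
  have p1 : 0 < Num.sqrt x * expR (`|r| / 2) by rewrite mulr_gt0// expR_gt0.
  by rewrite ler_ln ?posrE ?xcosh_gt0//; exact: (xcosh_ge r x0).
rewrite lnM ?posrE ?expR_gt0// expRK => /(ler_wpM2l (ltW al0)); lra.
Qed.

Lemma Gk_lipschitz al x L : 0 < al -> 0 < x -> 0 < L -> exists2 C, 0 <= C & forall r s,
  `|r - s| <= L -> `|Gk al x r - Gk al x s| <= C * `|r - s| * expR (- (al / 2 * `|r|)).
Proof.
move=> al0 x0 L0; have [|//|C C0 HC] := @rG_lipschitz al (al + 1); first by apply/andP; split; lra.
have sx : 0 < Num.sqrt x by rewrite sqrtr_gt0.
pose k := C * expR (- ((al + 1) * (ln (Num.sqrt x) - L / 2))) * (Num.sqrt x * expR L).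
exists k; first by rewrite /k !mulr_ge0 ?expR_ge0 ?sqrtr_ge0.
move=> r s rs; rewrite /Gk.
pose m := Num.sqrt x * expR ((`|r| - L) / 2).
have m0 : 0 < m by rewrite mulr_gt0// expR_gt0.
have rs' : `|r| - L <= `|s|.
  by have := ler_normD (r - s) s; rewrite subrK; lra.
have m1 : m <= xcosh x r.
  apply: le_trans (xcosh_ge r x0); apply: ler_wpM2l (sqrtr_ge0 _) _ _ _.
  by rewrite ler_expR; lra.
have m2 : m <= xcosh x s.
  apply: le_trans (xcosh_ge s x0); apply: ler_wpM2l (sqrtr_ge0 _) _ _ _.
  by rewrite ler_expR; lra.
apply: le_trans (HC _ _ _ m0 m1 m2) _.
have X : `|xcosh x r - xcosh x s| <= Num.sqrt x * expR L * `|r - s| * expR (`|r| / 2).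
  rewrite /xcosh -mulrBr normrM (ger0_norm (mulr_ge0 (ler0n _ 2) (sqrtr_ge0 x))).
  have := cosh_lipschitz (s / 2) (r / 2); have hd : `|s / 2 - r / 2| = `|r - s| * 2^-1.
    by rewrite distrC -mulrBl normrM (ger0_norm (_ : 0 <= 2^-1)).
  rewrite (distrC (cosh _)) hd normrM (ger0_norm (_ : 0 <= 2^-1))// => h.
  have e1 : expR (`|r - s| * 2^-1) <= expR L by rewrite ler_expR; lra.
  apply: le_trans (ler_wpM2l _ h) _; first by rewrite mulr_ge0// sqrtr_ge0.
  have -> : 2 * Num.sqrt x * (`|r - s| * 2^-1 * expR (`|r - s| * 2^-1) * expR (`|r| * 2^-1)) =
    Num.sqrt x * `|r - s| * expR (`|r| / 2) * expR (`|r - s| * 2^-1) by field.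
  have -> : Num.sqrt x * expR L * `|r - s| * expR (`|r| / 2) = 
    Num.sqrt x * `|r - s| * expR (`|r| / 2) * expR L by ring.
  by apply: ler_wpM2l => //; rewrite !mulr_ge0 ?expR_ge0 ?sqrtr_ge0.
apply: le_trans (ler_wpM2l _ X) _; first by rewrite mulr_ge0 ?expR_ge0.
have lm : ln m = ln (Num.sqrt x) + (`|r| - L) / 2.
  by rewrite /m lnM ?posrE ?expR_gt0// expRK.
rewrite lm /k.
have -> : - (al / 2 * `|r|) = - ((al + 1) * (`|r| / 2)) + `|r| / 2 by field.
have -> : - ((al + 1) * (ln (Num.sqrt x) + (`|r| - L) / 2)) =
   - ((al + 1) * (ln (Num.sqrt x) - L / 2)) - ((al + 1) * (`|r| / 2)) by field.
rewrite !expRD; apply: le_of_eq; ring.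
Qed.

Lemma continuous_Gk al x : 0 < al -> 0 < x -> continuous (Gk al x).
Proof.
move=> al0 x0 r; have [C C0 HC] := Gk_lipschitz al0 x0 ltr01.
apply/cvgrPdist_le => e e0.
have C1 : 0 < C + 1 by lra.
near=> s.
have d1 : `|r - s| <= 1 by near: s; apply: cvgr_dist_le => //; exact: cvg_id.
have d2 : `|r - s| <= e / (C + 1) by near: s; apply: cvgr_dist_le; [exact: cvg_id|rewrite divr_gt0].
apply: le_trans (HC _ _ d1) _.
rewrite ler_pdivlMr// in d2; apply: le_trans d2; rewrite mulrC.
have e1 : expR (- (al / 2 * `|r|)) <= 1.
  by rewrite -expR0 ler_expR oppr_le0 mulr_ge0// divr_ge0// ltW.
apply: (@le_trans _ _ (1 * (C * `|r - s|))); first by apply: ler_wpM2r => //; rewrite mulr_ge0.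
by rewrite mul1r mulrC; apply: ler_wpM2l => //; lra.
Unshelve. all: by end_near.
Qed.

Lemma Gk_even al x r : Gk al x (- r) = Gk al x r.
Proof. by rewrite /Gk /xcosh mulNr /cosh opprK (addrC (expR (- _))). Qed.

Lemma intg_Gk al x : 0 < al -> 0 < x -> intg (Gk al x).
Proof.
move=> al0 x0; have [C C0 HC] := Gk_le al0 x0; have a2 : 0 < al / 2 by lra.
apply: (intg_decay a2 _ HC); apply: continuous_measurable_fun; exact: continuous_Gk.
Qed.

Lemma continuous_cosM t : continuous (fun r : R => cos (t * r)).
Proof.
move=> r; apply: (@continuous_comp _ _ _ (fun r : R => t * r) (@cos R)); last exact: continuous_cos.
by apply: cvgM; [exact: cvg_cst|exact: cvg_id].
Qed.

Lemma continuous_sinM t : continuous (fun r : R => sin (t * r)).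
Proof.
move=> r; apply: (@continuous_comp _ _ _ (fun r : R => t * r) (@sin R)); last exact: continuous_sin.
by apply: cvgM; [exact: cvg_cst|exact: cvg_id].
Qed.

Lemma iR_cexp t : cexp (iR t) = cos t +i* sin t.
Proof. by apply: complex_ext; rewrite ?Re_cexp ?Im_cexp /= expR0 mul1r. Qed.

Lemma cint_even (f : R -> R) t : continuous f -> (forall r, f (- r) = f r) -> intg f ->
  cintg (fun r => cexp (iR (t * r)) * (f r)%:C) /\
  cint (fun r => cexp (iR (t * r)) * (f r)%:C) = (\int[mu]_r (cos (t * r) * f r))%:C.
Proof.
move=> cf ef fi.
have E1 r : Re (cexp (iR (t * r)) * (f r)%:C) = cos (t * r) * f r by rewrite iR_cexp cReMl.
have E2 r : Im (cexp (iR (t * r)) * (f r)%:C) = sin (t * r) * f r by rewrite iR_cexp cImMl.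
have cs : continuous (fun r : R => sin (t * r) * f r).
  by move=> r; apply: cvgM; [exact: continuous_sinM|exact: cf].
have cc : continuous (fun r : R => cos (t * r) * f r).
  by move=> r; apply: cvgM; [exact: continuous_cosM|exact: cf].
have i1 : intg (fun r => cos (t * r) * f r).
  apply: intg_le (intg_norm fi); first exact: continuous_measurable_fun.
  by move=> r; rewrite normrM ler_piMl// ler_norml cos_geN1 cos_le1.
have i2 : intg (fun r => sin (t * r) * f r).
  apply: intg_le (intg_norm fi); first exact: continuous_measurable_fun.
  by move=> r; rewrite normrM ler_piMl// ler_norml sin_geN1 sin_le1.
split; first by apply: cintgP; [rewrite (funext E1)|rewrite (funext E2)].
apply: complex_ext.
  by rewrite Re_cint (eq_Rintg E1).
rewrite Im_cint (eq_Rintg E2) /= Rintg_odd// => r.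
by rewrite mulrN sinN ef mulNr.
Qed.

Lemma whittaker_Gk m tau x : m < 2^-1 -> 0 < x ->
  `|Gamma ((2^-1 - m) +i* tau)| ^+ 2 * whittakerW m%:C (0 +i* tau) x =
  (expR (- x / 2) * Num.sqrt x / 2 * \int[mu]_r (cos (tau * r) * Gk (2^-1 - m) x r))%:C.
Proof.
move=> m2 x0; have al0 : 0 < 2^-1 - m by lra.
have [_ E] := cint_even tau (continuous_Gk al0 x0) (Gk_even (2^-1 - m) x) (intg_Gk al0 x0).
have [_ F] := Iab_fourier tau al0 x0.
rewrite /whittakerW -/(iR tau).
have -> : 2^-1 + iR tau - m%:C = (2^-1 - m)%:C + iR tau by rewrite rcB rcV rc_nat; ring.
rewrite mulrCA (normc2_Gamma_tricomi tau al0 x0) F E.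
rewrite /cpow mulrDl cexpD cexpN.
have -> : 2^-1 * (ln x)%:C = (2^-1 * ln x)%:C by rewrite rcM rcV rc_nat.
have -> : cexp (2^-1 * ln x)%:C = (Num.sqrt x)%:C.
  rewrite cexp_real; congr _%:C; apply/eqP; rewrite -(@eqrXn2 _ 2)// ?expR_ge0 ?sqrtr_ge0// sqr_sqrtr ?ltW//.
  by rewrite -expRM_natr mulrC mulrA mulfV// mul1r lnK.
have e0 := cexp_neq0 (iR tau * (ln x)%:C).
rewrite !rcM rcV rc_nat; field; exact: e0.
Qed.

Lemma Iab_kummer a nu x : 0 < Re a -> 0 < Re (a - nu) -> nu != 0 ->
  - 2^-1 <= Re nu <= 2^-1 -> 0 < x ->
  Iab a nu x = cexp (- (nu * (ln x)%:C)) * Iab (a - nu) (- nu) x.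
Proof.
move=> a0 an0 nu0 n12 x0; rewrite !Iab_hyp1F1//; last first.
- by rewrite cReN; apply/andP; split; have /andP[] := n12; lra.
- by rewrite oppr_eq0.
- by rewrite opprK subrK.
rewrite !opprK subrK mulNr opprK cexpN; field; exact: cexp_neq0.
Qed.

Lemma cpow_real x r : cpow x r%:C = (expR (r * ln x))%:C.
Proof. by rewrite /cpow -rcM cexp_real. Qed.

Lemma half_not_int (k : int) : (2^-1 + 1 : R[i]) <> k%:~R.
Proof.
move=> /(congr1 (fun c => c * 2)); rewrite mulrDl mul1r mulVf ?pnatr_eq0// => E.
have : (3 : int) = k * 2.
  by apply: (@intr_inj R[i]); rewrite rmorphM /= -E.
by move=> /(congr1 (fun j => (j %% 2)%Z)); rewrite modzMl.
Qed.

Lemma parabolicD_rG m z : m < 2^-1 -> 0 < z ->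
  Gamma (1 - 2 * m)%:C * parabolicD (2 * m - 1)%:C z =
  (expR (- ((m + 2^-1) * ln 2)) * expR (- (z ^+ 2 / 4)) * rG (2^-1 - m) (Num.sqrt 2 * z))%:C.
Proof.
move=> m2 z0; set al := 2^-1 - m; have al0 : 0 < al by rewrite /al; lra.
set w := z ^+ 2 / 2; have w0 : 0 < w by rewrite divr_gt0// exprn_gt0.
have h0 : (2^-1 : R[i]) != 0 by rewrite invr_eq0 pnatr_eq0.
have h2 : (2^-1 : R[i]) = (2^-1)%:C by rewrite rcV rc_nat.
have h4 : (4^-1 : R[i]) = (4^-1)%:C by rewrite rcV rc_nat.
have r2 : Re (2^-1 : R[i]) = 2^-1 by rewrite h2.
have a2 : 0 < Re (al%:C + 2^-1) by rewrite cReD r2 /=; lra.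
have aE : al%:C + 2^-1 - 2^-1 = al%:C by rewrite addrK.
have a1 : 0 < Re (al%:C + 2^-1 - 2^-1) by rewrite aE.
have rh : - 2^-1 <= Re (2^-1 : R[i]) <= 2^-1 by rewrite r2; apply/andP; split; lra.
have gneq u : 0 < u -> Gamma u%:C != 0 by move=> u0; rewrite Gamma_real// rc_neq0 gt_eqF ?rGamma_gt0.
have G1 : Gamma al%:C != 0 by exact: gneq.
have G2 : Gamma (al%:C + 2^-1) != 0 by rewrite h2 -rcD; apply: gneq; lra.
have G3 : Gamma (2 * al)%:C != 0 by apply: gneq; lra.
have G4 : Gamma (2^-1 : R[i]) != 0 by rewrite h2; apply: gneq; rewrite invr_gt0.
have K := Iab_kummer a2 a1 h0 rh w0.
have e : cexp (- (2^-1 * (ln w)%:C)) = (expR (- (2^-1 * ln w)))%:C by rewrite h2 -rcM -rcN cexp_real.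
rewrite e aE (Iab_half al0 w0) in K.
have D := Gamma_duplication al0.
have sw : 2 * Num.sqrt w = Num.sqrt 2 * z.
  apply/eqP; rewrite -(@eqrXn2 _ 2)// ?mulr_ge0 ?sqrtr_ge0// ?(ltW z0)//.
  by rewrite !exprMn !sqr_sqrtr ?(ltW w0)//; apply/eqP; rewrite /w; field.
rewrite sw in K.
have T : Gamma (2 * al)%:C * tricomi (al%:C + 2^-1) (2^-1 + 1) w =
    (expR (- (2^-1 * ln w)) * rG al (Num.sqrt 2 * z) * expR (2 * al * ln 2) / 2)%:C.
  rewrite /tricomi; case: asboolP => [[k /half_not_int]//|_].
  have G1' : Gamma (al%:C + 2^-1 - 2^-1) != 0 by rewrite aE.
  have Q := tricomi_generic_Iab a2 a1 h0 rh w0 G2 G1'.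
  rewrite aE (mulrC (Gamma (al%:C + 2^-1)) (Gamma al%:C)) D K in Q.
  rewrite Q {Q K D}.
  have -> u v y : (u * v * y / 2)%:C = u%:C * v%:C * y%:C / 2 :> R[i] by rewrite !rcM rcV rc_nat.
  have -> : (expR (2 * al * ln 2))%:C = ((expR (- (2 * al * ln 2)))%:C)^-1 :> R[i] by rewrite -rcV -expRN opprK.
  have E0 : (expR (- (2 * al * ln 2)))%:C != 0 :> R[i] by rewrite rc_neq0 gt_eqF// expR_gt0.
  move: (expR (- (2 * al * ln 2)))%:C E0 => X X0.
  by field; rewrite X0 G4 G3.
rewrite /parabolicD /whittakerW -/w.
have -> : 1 - 2 * m = 2 * al by rewrite /al; field.
have -> : (2 * m - 1)%:C / 2 + 4^-1 = (m - 4^-1)%:C :> R[i].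
  by rewrite h4 h2 -rcM -rcD; congr _%:C; field.
have -> : 4^-1 + 2^-1 = (3 / 4)%:C :> R[i] by rewrite h4 h2 -rcD; congr _%:C; field.
have -> : 2^-1 + 4^-1 - (m - 4^-1)%:C = al%:C + 2^-1 :> R[i].
  by rewrite h4 h2 -!rcD -rcB; congr _%:C; rewrite /al; field.
have -> : 2 * 4^-1 + 1 = 2^-1 + 1 :> R[i] by congr (_ + 1); field.
rewrite !cpow_real.
move: T; set T := tricomi _ _ _; set G := Gamma _ => T_E.
have -> A B C D' : G * (A * B * (C * D' * T)) = A * B * (C * D') * (G * T) by move=> *; ring.
rewrite T_E -!rcM; congr _%:C.
have lw : ln w = 2 * ln z - ln 2.
  by rewrite /w lnM ?posrE ?exprn_gt0// lnV ?posrE// lnXn// mulr_natl.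
rewrite /powR gt_eqF// lw.
have -> : forall a b c d e f g : R, a * b * (c * d) * (e * f * g / 2) = a * b * d * e * g / 2 * c * f by move=> *; field.
rewrite -!expRD.
have -> : forall X Y Z : R, X / 2 * Y * Z = expR (- ln 2) * X * Y * Z.
  by move=> X Y Z; rewrite expRN lnK ?posrE//; ring.
rewrite -!expRD; congr (expR _ * _).
by rewrite /al /w; field.
Qed.

Lemma parabolicD_Gk m x r : m < 2^-1 -> 0 < x ->
  Gamma (1 - 2 * m)%:C * ((expR (x * sinh (r / 2) ^+ 2 / 2))%:C
    * parabolicD (2 * m - 1)%:C (Num.sqrt (2 * x) * cosh (r / 2))) =
  (expR (- ((m + 2^-1) * ln 2)) * expR (- x / 2) * Gk (2^-1 - m) x r)%:C.
Proof.
move=> m2 x0; have z0 : 0 < Num.sqrt (2 * x) * cosh (r / 2).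
  by rewrite mulr_gt0 ?cosh_gt0// sqrtr_gt0 mulr_gt0.
rewrite mulrCA (parabolicD_rG m2 z0) -rcM /Gk /xcosh.
have -> : Num.sqrt 2 * (Num.sqrt (2 * x) * cosh (r / 2)) = 2 * Num.sqrt x * cosh (r / 2).
  by rewrite sqrtrM// !mulrA -expr2 sqr_sqrtr.
rewrite (exprMn 2 (Num.sqrt (2 * x))) sqr_sqrtr; last by rewrite mulr_ge0// ltW.
have -> (a b c d : R) : a * (b * c * d) = b * (a * c) * d by ring.
congr (_ * _ * _)%:C; rewrite -expRD; congr expR.
have : cosh (r / 2) ^+ 2 - sinh (r / 2) ^+ 2 = 1.
  rewrite /cosh /sinh expRN; field; rewrite gt_eqF ?expR_gt0//.
move: (cosh (r / 2)) (sinh (r / 2)) => p q h.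
have -> : p ^+ 2 = 1 + q ^+ 2 by rewrite -h subrK.
by field.
Qed.

End kernel.

(** * Fourier inversion *)

Section fourier.
Context {R : realType}.
Notation mu := (@lebesgue_measure R).
Implicit Types (x y s t r u v al b e d C K m z tau : R) (f H : R -> R).

Lemma measurable_oneDsqrV : measurable_fun setT (fun t : R => (1 + t ^+ 2)^-1).
Proof. exact: (continuous_measurable_fun (@continuous_oneDsqrV R)). Qed.

Lemma oneDsqrV_ge0 t : 0 <= (1 + t ^+ 2)^-1.
Proof. by rewrite invr_ge0 addr_ge0// sqr_ge0. Qed.

Lemma Rintg_oneDsqr : intg (fun t => (1 + t ^+ 2)^-1) /\ \int[mu]_t (1 + t ^+ 2)^-1 = pi.
Proof.
have c := @continuous_oneDsqrV R.
have E : (\int[mu]_t ((1 + t ^+ 2)^-1)%:E = pi%:E)%E.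
  rewrite (@ge0_symfun_integralT R (fun t => (1 + t ^+ 2)^-1))//.
  - rewrite set_ge0_itv (integral0y_oneDsqr R) -EFinM; congr (_%:E).
    by rewrite mulrC divfK.
  - by move=> t; exact: oneDsqrV_ge0.
  - by move=> t; rewrite /= sqrrN.
split; last by rewrite /Rintegral E.
apply/integrableP; split; first by apply: measurable_EFin; exact: measurable_oneDsqrV.
under eq_integral do rewrite /= ger0_norm ?oneDsqrV_ge0//.
by rewrite E ltry.
Qed.

Lemma norm_cos_le1 t : `|cos t| <= 1.
Proof. by rewrite ler_norml cos_geN1 cos_le1. Qed.

Lemma norm_sin_le1 t : `|sin t| <= 1.
Proof. by rewrite ler_norml sin_geN1 sin_le1. Qed.

Lemma Rintg_laplace_cos e s : 0 < e ->
  \int[mu]_t (expR (- (e * `|t|)) * cos (t * s)) = 2 * e / (e ^+ 2 + s ^+ 2).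
Proof.
move=> e0; have q0 : 0 < e ^+ 2 + s ^+ 2 by rewrite ltr_wpDr ?sqr_ge0// exprn_gt0.
have ccos : continuous (fun t => cos (t * s)).
  by move=> t; apply: (@continuous_comp _ _ _ (fun r : R => r * s) (@cos R)); [apply: cvgM; [exact: cvg_id|exact: cvg_cst]|exact: continuous_cos].
have cf : continuous (fun t => expR (- (e * `|t|)) * cos (t * s)).
  by move=> t; apply: cvgM; [exact: continuous_expabs|exact: ccos].
have bf t : `|expR (- (e * `|t|)) * cos (t * s)| <= 1 * expR (- (e * `|t|)).
  by rewrite normrM mulrC (ger0_norm (expR_ge0 _)); apply: ler_wpM2r; rewrite ?expR_ge0// ler_norml cos_geN1 cos_le1.
rewrite (Rintg_even e0 cf _ bf); last by move=> t; rewrite normrN mulNr cosN.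
pose g t := expR (- e * t) * cos (t * s).
have -> : \int[mu]_(t in `[0, +oo[) (expR (- (e * `|t|)) * cos (t * s)) = \int[mu]_(t in `[0, +oo[) g t.
  apply: eq_Rintegral => t; rewrite inE /= in_itv /= andbT => t0.
  by rewrite /g (ger0_norm t0) mulNr.
pose F t := expR (- e * t) * (s * sin (t * s) - e * cos (t * s)) / (e ^+ 2 + s ^+ 2).
have dF t : is_derive t (1 : R) F (g t).
  have d0 : is_derive t (1 : R) (fun t => t * s) s.
    by apply: is_derive_eq; rewrite /GRing.scale /= mulr0 add0r mulr1.
  have d1 : is_derive t (1 : R) (fun t => sin (t * s)) (cos (t * s) * s).
    exact: (@is_derive1_comp _ (@sin R) (fun t : R => t * s) _ _ _ (is_derive_sin _) d0).
  have d2 : is_derive t (1 : R) (fun t => cos (t * s)) (- sin (t * s) * s).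
    exact: (@is_derive1_comp _ (@cos R) (fun t : R => t * s) _ _ _ (is_derive_cos _) d0).
  have d3 := is_derive_expRM (- e) t.
  rewrite /F; apply: is_derive_eq; rewrite /GRing.scale /= /g; field; by rewrite gt_eqF.
have l0 : F t @[t --> +oo] --> (0 : R).
  pose B := (`|s| + e) / (e ^+ 2 + s ^+ 2).
  have b t : `|F t| <= B * expR (- (e * t)).
    rewrite /F -mulrA normrM (ger0_norm (expR_ge0 _)) mulNr mulrC; apply: ler_wpM2r; first exact: expR_ge0.
    rewrite normrM (gtr0_norm (_ : 0 < _^-1)) ?invr_gt0//; apply: ler_wpM2r; first by rewrite invr_ge0 ltW.
    apply: le_trans (ler_normB _ _) _; rewrite !normrM (gtr0_norm e0); apply: lerD.
      by rewrite ler_piMr// norm_sin_le1.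
    by rewrite ler_piMr ?norm_cos_le1// ltW.
  have l : B * expR (- (e * t)) @[t --> +oo] --> (0 : R).
    by rewrite -(mulr0 B); apply: cvgM; [exact: cvg_cst|exact: cvg_expRMN].
  apply: (@squeeze_cvgr _ _ _ _ (fun t => - (B * expR (- (e * t)))) (fun t => B * expR (- (e * t)))) => //.
    by apply: nearW => t; rewrite -ler_norml.
  by rewrite -oppr0; exact: cvgN.
have cg : continuous g.
  move=> t; apply: cvgM; last exact: ccos.
  apply: continuous_comp; last exact: continuous_expR.
  by apply: cvgM; [exact: cvg_cst|exact: cvg_id].
have bg t : 0 <= t -> `|g t| <= 1 * expR (- (e * t)).
  by move=> t0; rewrite /g normrM mulrC (ger0_norm (expR_ge0 _)) mulNr; apply: ler_wpM2r; rewrite ?expR_ge0// ler_norml cos_geN1 cos_le1.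
have [_ ->] := FTC_half e0 cg dF bg l0.
rewrite /F mulr0 expR0 mul0r sin0 cos0; field; by rewrite gt_eqF.
Qed.

Lemma cvg_harmonic_scale s : harmonic n * s @[n --> \oo] --> (0 : R).
Proof. by rewrite -(mul0r s); apply: cvgM; [exact: cvg_harmonic|exact: cvg_cst]. Qed.

(* Abel summation: the factor exp(- e|t|) turns the integral over t into a
   Poisson kernel. *)
Lemma Rintg_cos_inversion H C d K : 0 < d -> continuous H ->
  (forall s, `|H s| <= C * expR (- (d * `|s|))) ->
  (forall t, `|\int[mu]_s (cos (t * s) * H s)| <= K * (1 + t ^+ 2)^-1) ->
  intg (fun t => \int[mu]_s (cos (t * s) * H s)) /\
  \int[mu]_t (\int[mu]_s (cos (t * s) * H s)) = 2 * pi * H 0.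
Proof.
move=> d0 cH bH bK; set h := fun t => \int[mu]_s (cos (t * s) * H s).
have C0 : 0 <= C.
  by have := bH 0; rewrite normr0 mulr0 oppr0 expR0 mulr1; apply: le_trans.
have [iq eq_pi] := Rintg_oneDsqr.
have iK := intgZ K iq.
have mF e : measurable_fun setT (fun p : R * R => expR (- (e * `|p.1|)) * cos (p.1 * p.2) * H p.2).
  apply: measurable_funM; last first.
    by apply: (@measurable_sndM R H); exact: continuous_measurable_fun.
  apply: measurable_funM.
    apply: (@measurable_fstM R (fun t => expR (- (e * `|t|)))).
    apply: continuous_measurable_fun; exact: continuous_expabs.
  apply: (measurableT_comp (continuous_measurable_fun (@continuous_cos R))).
  apply: measurable_funM; first exact: measurable_fst.
  exact: measurable_snd.
have bF e t s : `|expR (- (e * `|t|)) * cos (t * s) * H s| <= expR (- (e * `|t|)) * (C * expR (- (d * `|s|))).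
  rewrite !normrM (ger0_norm (expR_ge0 _)) -mulrA; apply: ler_wpM2l; first exact: expR_ge0.
  by apply: le_trans (bH s); rewrite ler_piMl// norm_cos_le1.
have fub e : 0 < e -> intg (fun t => expR (- (e * `|t|)) * h t) /\
    \int[mu]_t (expR (- (e * `|t|)) * h t) = \int[mu]_s (2 * (1 + s ^+ 2)^-1 * H (e * s)).
  move=> e0.
  have [i1 _ E] := @Rfubini R (fun t s => expR (- (e * `|t|)) * cos (t * s) * H s) _ _ (mF e)
    (intg_expabs e0) (intgZ C (intg_expabs d0)) (bF e).
  have ic t : intg (fun s => cos (t * s) * H s).
    apply: (intg_le _ _ (intgZ C (intg_expabs d0))).
      apply: continuous_measurable_fun => s; apply: cvgM; last exact: cH.
      exact: continuous_cosM.
    by move=> s; apply: le_trans (bH s); rewrite normrM ler_piMl// norm_cos_le1.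
  have E1 t : \int[mu]_s (expR (- (e * `|t|)) * cos (t * s) * H s) = expR (- (e * `|t|)) * h t.
    by rewrite /h -RintgZ//; apply: eq_Rintg => s; rewrite mulrA.
  have E2 s : \int[mu]_t (expR (- (e * `|t|)) * cos (t * s) * H s) = 2 * e / (e ^+ 2 + s ^+ 2) * H s.
    rewrite -Rintg_laplace_cos// mulrC -RintgZ; first by apply: eq_Rintg => t; rewrite mulrC.
    apply: (intg_le _ _ (intg_expabs e0)).
      apply: continuous_measurable_fun => t; apply: cvgM; first exact: continuous_expabs.
      apply: (@continuous_comp _ _ _ (fun r : R => r * s) (@cos R)); last exact: continuous_cos.
      by apply: cvgM; [exact: cvg_id|exact: cvg_cst].
    by move=> t; rewrite normrM (ger0_norm (expR_ge0 _)) ler_piMr ?norm_cos_le1// expR_ge0.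
  split; first exact: eq_intg E1 i1.
  rewrite -(eq_Rintg E1) E (eq_Rintg E2) (@Rintg_affine _ e 0)//; last first.
    move=> s; apply: cvgM; last exact: cH.
    apply: cvgM; first exact: cvg_cst.
    apply: cvgV; first by rewrite gt_eqF// ltr_wpDr ?sqr_ge0// exprn_gt0.
    by apply: cvgD; [exact: cvg_cst|exact: (@exprn_continuous R 2)].
  apply: eq_Rintg => s; rewrite addr0; field.
  by rewrite !gt_eqF// ltr_wpDr ?sqr_ge0// exprn_gt0.
have mh : measurable_fun setT h.
  have [i1 _] := fub 1 ltr01.
  have -> : h = (fun t => expR (1 * `|t|) * (expR (- (1 * `|t|)) * h t)).
    by apply/funext => t; rewrite mulrA -expRD subrr expR0 mul1r.
  apply: measurable_funM; last exact: intg_meas.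
  apply: continuous_measurable_fun => t; apply: continuous_comp; last exact: continuous_expR.
  by apply: cvgM; [exact: cvg_cst|exact: norm_continuous].
have ih : intg h by apply: intg_le mh bK iK.
split=> //.
pose e n : R := harmonic n.
have e0 n : 0 < e n by rewrite /e /= invr_gt0 ltr0n.
have ex1 n t : expR (- (e n * `|t|)) <= 1.
  by rewrite -expR0 ler_expR oppr_le0 mulr_ge0// ltW.
have c1 t : expR (- (e n * `|t|)) * h t @[n --> \oo] --> h t.
  rewrite -{2}(mul1r (h t)); apply: cvgM; last exact: cvg_cst.
  rewrite -expR0 -oppr0.
  apply: (@cvg_comp _ _ _ (fun n => - (e n * `|t|)) (@expR R)); last exact: continuous_expR.
  by apply: cvgN; exact: cvg_harmonic_scale.
have b1 n t : `|expR (- (e n * `|t|)) * h t| <= `|h t|.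
  by rewrite normrM (ger0_norm (expR_ge0 _)) ler_piMl.
have [_ L1] := @Rdct R (fun n t => expR (- (e n * `|t|)) * h t) h (fun t => `|h t|)
  (fun n => intg_meas (fub _ (e0 n)).1) c1 b1 (intg_norm ih).
have m2 n : measurable_fun setT (fun s => 2 * (1 + s ^+ 2)^-1 * H (e n * s)).
  apply: measurable_funM; first by apply: measurable_funM => //; exact: measurable_oneDsqrV.
  apply: continuous_measurable_fun => t; apply: (@continuous_comp _ _ _ (fun r : R => e n * r) H); last exact: cH.
  by apply: cvgM; [exact: cvg_cst|exact: cvg_id].
have c2 t : 2 * (1 + t ^+ 2)^-1 * H (e n * t) @[n --> \oo] --> 2 * (1 + t ^+ 2)^-1 * H 0.
  apply: cvgM; first exact: cvg_cst.
  by apply: (@cvg_comp _ _ _ (fun n => e n * t) H); [exact: cvg_harmonic_scale|exact: cH].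
have HC s : `|H s| <= C.
  apply: le_trans (bH s) _; rewrite ler_piMr// -expR0 ler_expR oppr_le0 mulr_ge0// ltW//.
have b2 n t : `|2 * (1 + t ^+ 2)^-1 * H (e n * t)| <= 2 * C * (1 + t ^+ 2)^-1.
  rewrite !normrM (ger0_norm (oneDsqrV_ge0 t)) (ger0_norm (_ : 0 <= 2))// [leRHS]mulrAC.
  by apply: ler_wpM2l => //; rewrite mulr_ge0// oneDsqrV_ge0.
have [_ L2] := @Rdct R (fun n s => 2 * (1 + s ^+ 2)^-1 * H (e n * s)) (fun s => 2 * (1 + s ^+ 2)^-1 * H 0)
  (fun s => 2 * C * (1 + s ^+ 2)^-1) m2 c2 b2 (intgZ _ iq).
have L3 : \int[mu]_t (expR (- (e n * `|t|)) * h t) @[n --> \oo] --> \int[mu]_s (2 * (1 + s ^+ 2)^-1 * H 0).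
  by under eq_fun do rewrite (fub _ (e0 _)).2; exact: L2.
rewrite (cvg_unique _ L1 L3)//.
transitivity (\int[mu]_s ((2 * H 0) * (1 + s ^+ 2)^-1)); first by apply: eq_Rintg => s; ring.
by rewrite RintgZ// eq_pi; ring.
Qed.

Lemma intg_bounded_cos (f : R -> R) t : continuous f -> intg f -> intg (fun s => cos (t * s) * f s).
Proof.
move=> cf fi; apply: (intg_le _ _ (intg_norm fi)).
  by apply: continuous_measurable_fun => s; apply: cvgM; [exact: continuous_cosM|exact: cf].
by move=> s; rewrite normrM ler_piMl// norm_cos_le1.
Qed.

Lemma intg_bounded_sin (f : R -> R) t : continuous f -> intg f -> intg (fun s => sin (t * s) * f s).
Proof.
move=> cf fi; apply: (intg_le _ _ (intg_norm fi)).
  by apply: continuous_measurable_fun => s; apply: cvgM; [exact: continuous_sinM|exact: cf].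
by move=> s; rewrite normrM ler_piMl// norm_sin_le1.
Qed.

Lemma Rintg_shift f s : continuous f -> \int[mu]_t f t = \int[mu]_t f (t + s).
Proof.
move=> cf; rewrite (@Rintg_affine _ 1 s)//; apply: eq_Rintg => t; by rewrite mul1r mulr1.
Qed.

Lemma Rintg_cos_shift f t s : continuous f -> (forall r, f (- r) = f r) -> intg f ->
  \int[mu]_r (cos (t * r) * f (r + s)) = cos (t * s) * \int[mu]_r (cos (t * r) * f r).
Proof.
move=> cf ef fi.
have i1 := intg_bounded_cos t cf fi; have i2 := intg_bounded_sin t cf fi.
have cc : continuous (fun r => cos (t * (r - s)) * f r).
  move=> r; apply: cvgM; last exact: cf.
  apply: (@continuous_comp _ _ _ (fun r : R => r - s) (fun r => cos (t * r))); last exact: continuous_cosM.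
  by apply: cvgB; [exact: cvg_id|exact: cvg_cst].
rewrite (_ : \int[mu]_r (cos (t * r) * f (r + s)) = \int[mu]_r (cos (t * (r - s)) * f r)); last first.
  by rewrite (Rintg_shift s cc); apply: eq_Rintg => r; rewrite addrK.
have E r : cos (t * (r - s)) * f r = cos (t * s) * (cos (t * r) * f r) + sin (t * s) * (sin (t * r) * f r).
  by rewrite mulrBr cosB; ring.
have o2 : \int[mu]_r (sin (t * r) * f r) = 0.
  apply: Rintg_odd => //.
    by move=> r; apply: cvgM; [exact: continuous_sinM|exact: cf].
  by move=> r; rewrite mulrN sinN ef mulNr.
by rewrite (eq_Rintg E) RintgD ?RintgZ ?o2 ?mulr0 ?addr0//; exact: intgZ.
Qed.

Lemma fourier_inversion f C d K x : 0 < d -> continuous f -> (forall r, f (- r) = f r) ->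
  (forall s, `|f s| <= C * expR (- (d * `|s|))) ->
  (forall t, `|\int[mu]_s (cos (t * s) * f s)| <= K * (1 + t ^+ 2)^-1) ->
  intg (fun t => cos (t * x) * \int[mu]_s (cos (t * s) * f s)) /\
  \int[mu]_t (cos (t * x) * \int[mu]_s (cos (t * s) * f s)) = 2 * pi * f x.
Proof.
move=> d0 cf ef bf bK; have fi := intg_decay d0 (continuous_measurable_fun cf) bf.
have C0 : 0 <= C.
  by have := bf 0; rewrite normr0 mulr0 oppr0 expR0 mulr1; apply: le_trans.
pose H s := f (s + x).
have cH : continuous H.
  move=> s; apply: (@continuous_comp _ _ _ (fun s : R => s + x) f); last exact: cf.
  by apply: cvgD; [exact: cvg_id|exact: cvg_cst].
have bH s : `|H s| <= C * expR (d * `|x|) * expR (- (d * `|s|)).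
  apply: le_trans (bf _) _; rewrite -mulrA -expRD; apply: ler_wpM2l => //.
  rewrite ler_expR; have := ler_normB (s + x) x; rewrite addrK => /(ler_wpM2l (ltW d0)); lra.
have E t := Rintg_cos_shift t x cf ef fi.
have bHK t : `|\int[mu]_s (cos (t * s) * H s)| <= K * (1 + t ^+ 2)^-1.
  by rewrite E normrM; apply: le_trans (bK t); rewrite ler_piMl// norm_cos_le1.
have [i1 i2] := Rintg_cos_inversion d0 cH bH bHK.
have -> : f x = H 0 by rewrite /H add0r.
rewrite -i2; split; last by apply: eq_Rintg => t; rewrite E.
by apply: eq_intg i1 => t; exact: E.
Qed.

Lemma norm_cosB_le s t : `|cos t - cos s| <= `|t - s|.
Proof.
apply: (@lipschitz1 R (@cos R) (fun u => - sin u) (fun t => is_derive_cos t)) => u.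
by rewrite normrN norm_sin_le1.
Qed.

Lemma continuous_cos_transform f C d : 0 < d -> continuous f ->
  (forall s, `|f s| <= C * expR (- (d * `|s|))) ->
  continuous (fun t => \int[mu]_s (cos (t * s) * f s)).
Proof.
move=> d0 cf bf; have fi := intg_decay d0 (continuous_measurable_fun cf) bf.
have C0 : 0 <= C.
  by have := bf 0; rewrite normr0 mulr0 oppr0 expR0 mulr1; apply: le_trans.
have d2 : 0 < d / 2 by lra.
pose g s := C * (2 / d) * expR (- (d / 2 * `|s|)).
have ig : intg g by apply: intgZ; exact: intg_expabs.
have sg s : `|s| * `|f s| <= g s.
  apply: le_trans (ler_wpM2l (normr_ge0 s) (bf s)) _.
  have e1 : `|s| <= 2 / d * expR (d / 2 * `|s|).
    have h := expR_ge1Dx (d / 2 * `|s|).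
    have d3 : 0 < 2 / d by rewrite divr_gt0.
    have := ler_wpM2l (ltW d3) h.
    have -> : 2 / d * (1 + d / 2 * `|s|) = 2 / d + `|s| by field; rewrite gt_eqF.
    lra.
  rewrite mulrCA /g -mulrA; apply: ler_wpM2l => //.
  apply: le_trans (ler_wpM2r (expR_ge0 _) e1) _.
  by rewrite -(mulrA (2 / d)) -expRD; apply: ler_wpM2l; [rewrite divr_ge0// ltW|rewrite ler_expR; lra].
have lip u v : `|\int[mu]_s (cos (u * s) * f s) - \int[mu]_s (cos (v * s) * f s)| <= `|u - v| * \int[mu]_s g s.
  have i1 := intg_bounded_cos u cf fi; have i2 := intg_bounded_cos v cf fi.
  rewrite -RintgB// -RintgZ//; apply: Rintg_norm; [exact: intg_meas (intgB i1 i2)|exact: intgZ|].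
  move=> s; rewrite -mulrBl normrM; apply: (@le_trans _ _ (`|u - v| * (`|s| * `|f s|))); last first.
    by apply: ler_wpM2l.
  rewrite mulrA; apply: ler_wpM2r => //; apply: le_trans (norm_cosB_le _ _) _.
  by rewrite -mulrBl normrM.
move=> t; apply/cvgrPdist_le => e e0.
have I0 : 0 <= \int[mu]_s g s.
  by apply: Rintegral_ge0 => s _; rewrite mulr_ge0 ?expR_ge0// mulr_ge0// divr_ge0// ltW.
have I1 : 0 < \int[mu]_s g s + 1 by lra.
near=> u.
have h : `|t - u| <= e / (\int[mu]_s g s + 1).
  by near: u; apply: cvgr_dist_le; [exact: cvg_id|rewrite divr_gt0].
apply: le_trans (lip _ _) _; rewrite ler_pdivlMr// in h; apply: le_trans h.
by apply: ler_wpM2l => //; rewrite lerDl.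
Unshelve. all: by end_near.
Qed.

Lemma nm_Gamma_decay al tau : 0 < al ->
  nm (Gamma (al%:C + iR tau)) <= 2 * rGamma (al + 2) / (al ^+ 2 + tau ^+ 2).
Proof.
move=> al0; set a := al%:C + iR tau.
have a0 : Re a = al by rewrite /a cReD /= addr0.
have ai : Im a = tau by rewrite /a cImD /= add0r.
clearbody a.
have q0 : 0 < al ^+ 2 + tau ^+ 2 by rewrite ltr_wpDr ?sqr_ge0// exprn_gt0.
have ar : 0 < Re a by rewrite a0.
have a1r : 0 < Re (a + 1) by rewrite cReD a0 /= addr_gt0.
have G : Gamma (a + 1 + 1) = (a + 1) * a * Gamma a by rewrite !Gamma_rec// mulrA.
have nsq (z : R[i]) : nm z ^+ 2 = Re z ^+ 2 + Im z ^+ 2.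
  by case: z => p q; rewrite /nm /= sqr_sqrtr// addr_ge0// sqr_ge0.
have na : nm a ^+ 2 = al ^+ 2 + tau ^+ 2 by rewrite nsq a0 ai.
have na1 : nm a <= nm (a + 1).
  rewrite -(@ler_pXn2r _ 2)// ?nnegrE ?nm_ge0// !nsq cReD cImD a0 ai /= addr0 lerD2r.
  by rewrite ler_pXn2r// ?nnegrE; lra.
have B : nm (Gamma (a + 1 + 1)) <= 2 * rGamma (al + 2).
  have -> : al + 2 = Re (a + 1 + 1) by rewrite !cReD a0 /=; ring.
  by apply: nm_Gamma_le; rewrite !cReD a0 /=; lra.
rewrite ler_pdivlMr//; apply: le_trans B; rewrite G (nmM _ (Gamma a)) (nmM (a + 1)) [leLHS]mulrC; apply: ler_wpM2r; first exact: nm_ge0.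
by rewrite -na expr2; apply: ler_wpM2r => //; exact: nm_ge0.
Qed.

Lemma Gk_transform_le al x : 0 < al -> 0 < x -> exists K, forall t,
  `|\int[mu]_s (cos (t * s) * Gk al x s)| <= K * (1 + t ^+ 2)^-1.
Proof.
move=> al0 x0.
pose M := 2 * \int[mu]_r expR (al * r - x * expR r).
pose Q := 1 + (al ^+ 2)^-1.
exists (2 * (2 * rGamma (al + 2)) * M * Q) => t.
have M0 : 0 <= M by rewrite mulr_ge0//; apply: Rintegral_ge0 => r _; exact: expR_ge0.
have [_ E] := cint_even t (continuous_Gk al0 x0) (Gk_even al x) (intg_Gk al0 x0).
have [_ F] := Iab_fourier t al0 x0.
have a0 : 0 < Re (al%:C + iR t) by rewrite cReD /= addr0.
have b_eq : al%:C + iR t - iR (2 * t) = al%:C + iR (- t).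
  by apply: complex_ext; rewrite ?cReB ?cImB ?cReD ?cImD /=; ring.
have b0 : 0 < Re (al%:C + iR t - iR (2 * t)) by rewrite b_eq cReD /= addr0.
have H := F; rewrite (Iab_Jint a0 b0 x0) b_eq E in H.
have n2 : nm (2^-1 : R[i]) = 2^-1 by rewrite -rc_nat -rcV nm_real ger0_norm.
have := congr1 nm H; rewrite (nmM (Gamma _)) (nmM (2^-1 * _)) (nmM 2^-1) n2 nm_cexp nm_real.
have -> : Re (- (iR t * (ln x)%:C)) = 0 by rewrite cReN cReMl /= mul0r oppr0.
rewrite expR0 mulr1 => {}H.
have J : nm (Jint (al%:C + iR t) (iR (2 * t)) x) <= M.
  apply: nm_cint_le; [exact: ccont_meas (ccont_Jker _ _ _)| |exact: intg_gexp].
  by move=> r; apply: le_trans (nm_Jker_le _ _ b0) _; rewrite cReD /= addr0.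
have D := @nm_Gamma_decay al (- t) al0; rewrite sqrrN in D.
have q0 : 0 < al ^+ 2 + t ^+ 2 by rewrite ltr_wpDr ?sqr_ge0// exprn_gt0.
have q1 : 0 < 1 + t ^+ 2 by rewrite ltr_wpDr ?sqr_ge0.
have qq : (al ^+ 2 + t ^+ 2)^-1 <= Q * (1 + t ^+ 2)^-1.
  rewrite ler_pdivlMr// ler_pdivrMl// /Q.
  have -> : (al ^+ 2 + t ^+ 2) * (1 + (al ^+ 2)^-1) = al ^+ 2 + 1 + t ^+ 2 + t ^+ 2 / al ^+ 2.
    by field; rewrite gt_eqF.
  have := sqr_ge0 al; have : 0 <= t ^+ 2 / al ^+ 2 by rewrite divr_ge0 ?sqr_ge0.
  lra.
have -> : `|\int[mu]_s (cos (t * s) * Gk al x s)| = 2 * (nm (Gamma (al%:C + iR (- t))) * nm (Jint (al%:C + iR t) (iR (2 * t)) x)).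
  by rewrite H; field.
apply: (@le_trans _ _ (2 * (2 * rGamma (al + 2) / (al ^+ 2 + t ^+ 2) * M))).
  by apply: ler_wpM2l => //; apply: ler_pM => //; exact: nm_ge0.
rewrite (_ : 2 * (2 * rGamma (al + 2) / (al ^+ 2 + t ^+ 2) * M) = 2 * (2 * rGamma (al + 2)) * M * (al ^+ 2 + t ^+ 2)^-1); last by ring.
have k0 : 0 <= 2 * (2 * rGamma (al + 2)) * M.
  by apply: mulr_ge0 => //; apply: mulr_ge0 => //; apply: mulr_ge0 => //; exact: rGamma_ge0.
exact: le_trans (ler_wpM2l k0 qq) (le_of_eq (mulrA _ _ _)).
Qed.

End fourier.

(** * Poisson summation *)

Section poisson.
Context {R : realType}.
Notation mu := (@lebesgue_measure R).
Implicit Types (x y s t r u v w a b d C K L : R) (f h F : R -> R) (n m N M : nat).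

Lemma norm_sinD_npi x n : `|sin (x + n%:R * pi)| = `|sin x|.
Proof.
elim: n => [|n IH]; first by rewrite mul0r addr0.
by rewrite -natr1 mulrDl mul1r addrA sinDpi normrN.
Qed.

Lemma norm_sinD_zpi x (k : int) : `|sin (x + k%:~R * pi)| = `|sin x|.
Proof.
case: k => n; first exact: norm_sinD_npi.
by rewrite -[in RHS](subrK (n.+1%:R * pi) x) norm_sinD_npi NegzE mulrNz mulNr.
Qed.

Lemma sin_2npi n : sin (2 * pi * n%:R) = 0 :> R.
Proof.
elim: n => [|n IH]; first by rewrite mulr0 sin0.
have -> : 2 * pi * n.+1%:R = 2 * pi * n%:R + pi *+ 2 :> R by rewrite -natr1; ring.
by rewrite sinD2pi.
Qed.

Lemma cos_2npi n : cos (2 * pi * n%:R) = 1 :> R.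
Proof.
elim: n => [|n IH]; first by rewrite mulr0 cos0.
have -> : 2 * pi * n.+1%:R = 2 * pi * n%:R + pi *+ 2 :> R by rewrite -natr1; ring.
by rewrite cosD2pi.
Qed.

Lemma norm_sin_ge t : `|t| <= pi / 2 -> `|t| / 2 <= `|sin t|.
Proof.
have H u : 0 <= u <= pi / 2 -> u / 2 <= `|sin u|.
  move=> /andP[u0 u2]; apply: le_trans (ler_norm _).
  have h1 : 0 <= u / 2 by rewrite divr_ge0.
  have h2 : {within `[0, u / 2], continuous (@sin R)}.
    by apply: continuous_subspaceT => v; exact: continuous_sin.
  have [c] := MVT_segment h1 (fun v _ => is_derive_sin v) h2.
  rewrite in_itv /= => /andP[c0 cu]; rewrite sin0 !subr0 => E.
  have p0 := pi_ge0 R.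
  have cc : cos (u / 2) <= cos c.
    by rewrite leNgt ltr_cos ?in_itv /= -?leNgt//; apply/andP; split; lra.
  have c1 : 0 <= cos (u / 2) by apply: cos_ge0_pihalf; apply/andP; split; lra.
  have -> : u = u / 2 + u / 2 by field.
  have -> : (u / 2 + u / 2) / 2 = u / 2 by field.
  rewrite sinD E.
  have e1 : cos (u / 2) * (u / 2) <= cos c * (u / 2) by apply: ler_wpM2r; lra.
  have e2 := ler_wpM2r c1 e1.
  have e3 : cos (u / 2 + u / 2) = 2 * cos (u / 2) ^+ 2 - 1 by rewrite cosD; have := cos2Dsin2 (u / 2); lra.
  have e4 : 0 <= cos (u / 2 + u / 2).
    by apply: cos_ge0_pihalf; apply/andP; split; lra.
  have e5 : u / 2 * 1 <= u / 2 * (2 * cos (u / 2) ^+ 2) by apply: ler_wpM2l; lra.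
  lra.
move=> tp; have [t0|/ltW t0] := leP 0 t.
  by rewrite (ger0_norm t0) in tp *; apply: H; rewrite t0.
by rewrite (ler0_norm t0) in tp *; rewrite -(normrN (sin t)) -sinN; apply: H; rewrite oppr_ge0 t0.
Qed.

Definition dirichlet t m : R := 1 + 2 * \sum_(k < m) cos (2 * k.+1%:R * t).

Lemma dirichlet_sin t m : dirichlet t m * sin t = sin ((2 * m%:R + 1) * t).
Proof.
rewrite /dirichlet; elim: m => [|m IH]; first by rewrite big_ord0 mulr0 addr0 mul1r; congr sin; ring.
rewrite big_ord_recr /= mulrDr addrA mulrDl IH.
have -> : (2 * m%:R + 1) * t = 2 * m.+1%:R * t - t by rewrite -natr1; ring.
have -> : (2 * m.+1%:R + 1) * t = 2 * m.+1%:R * t + t by ring.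
rewrite sinB sinD; ring.
Qed.

Lemma fejer_sin t N : (\sum_(m < N) dirichlet t m) * sin t ^+ 2 = sin (N%:R * t) ^+ 2.
Proof.
elim: N => [|N IH]; first by rewrite big_ord0 !mul0r sin0 expr0n.
rewrite big_ord_recr /= mulrDl IH expr2 mulrA dirichlet_sin.
have key p q : sin q ^+ 2 + sin (p + q) * sin (p - q) = sin p ^+ 2 :> R.
  rewrite sinD sinB.
  have := cos2Dsin2 p; have := cos2Dsin2 q; move: (cos p) (cos q) (sin p) (sin q) => c c' z z' h1 h2.
  have -> : (z * c' + c * z') * (z * c' - c * z') = z ^+ 2 * c' ^+ 2 - c ^+ 2 * z' ^+ 2 by ring.
  have -> : c' ^+ 2 = 1 - z' ^+ 2 by rewrite -h1; ring.
  have -> : c ^+ 2 = 1 - z ^+ 2 by rewrite -h2; ring.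
  ring.
rewrite -(key (N.+1%:R * t) (N%:R * t)) -natr1; congr (_ + sin _ * sin _); ring.
Qed.

Lemma norm_sinM_le t n : `|sin (n%:R * t)| <= n%:R * `|sin t|.
Proof.
elim: n => [|n IH]; first by rewrite !mul0r sin0 normr0.
rewrite -natr1 !mulrDl !mul1r sinD; apply: le_trans (ler_normD _ _) _.
rewrite !normrM; apply: lerD.
  by apply: le_trans IH; rewrite ler_piMr// norm_cos_le1.
by rewrite ler_piMl// norm_cos_le1.
Qed.

Definition fejer t N : R := N.+1%:R^-1 * \sum_(m < N.+1) dirichlet t m.

Lemma fejer_le1 t N : `|fejer t N * sin t| <= 1.
Proof.
have [s0|s0] := eqVneq (sin t) 0; first by rewrite s0 mulr0 normr0.
have N0 : 0 < N.+1%:R :> R by rewrite ltr0n.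
have E : fejer t N * sin t * sin t = N.+1%:R^-1 * sin (N.+1%:R * t) ^+ 2.
  by rewrite -fejer_sin /fejer; ring.
have n0 : 0 < `|sin t| by rewrite normr_gt0.
rewrite -(ler_pM2r n0) mul1r -normrM E normrM normrX (gtr0_norm (_ : 0 < N.+1%:R^-1)) ?invr_gt0//.
rewrite ler_pdivrMl//; apply: le_trans (norm_sinM_le t N.+1).
by rewrite expr2 ler_piMl// norm_sin_le1.
Qed.

Lemma fejer_cvg0 t : fejer t N * sin t @[N --> \oo] --> (0 : R).
Proof.
have [s0|s0] := eqVneq (sin t) 0.
  by under eq_fun do rewrite s0 mulr0; exact: cvg_cst.
have n0 : 0 < `|sin t| by rewrite normr_gt0.
have b N : `|fejer t N * sin t| <= harmonic N * `|sin t|^-1.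
  have N0 : 0 < N.+1%:R :> R by rewrite ltr0n.
  have E : fejer t N * sin t * sin t = N.+1%:R^-1 * sin (N.+1%:R * t) ^+ 2.
    by rewrite -fejer_sin /fejer; ring.
  rewrite ler_pdivlMr// -normrM E normrM normrX (gtr0_norm (_ : 0 < N.+1%:R^-1)) ?invr_gt0//=.
  by rewrite ler_piMr ?invr_ge0// expr_le1// norm_sin_le1.
have l : harmonic N * `|sin t|^-1 @[N --> \oo] --> (0 : R) by exact: cvg_harmonic_scale.
apply: (@squeeze_cvgr _ _ _ _ (fun N => - (harmonic N * `|sin t|^-1)) (fun N => harmonic N * `|sin t|^-1)) => //.
  by apply: nearW => N; rewrite -ler_norml.
by rewrite -oppr0; exact: cvgN.
Qed.

Definition node L r : R := L * (Num.floor (r / L + 2^-1))%:~R.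

Lemma node_dist L r : 0 < L -> `|r - node L r| <= L / 2.
Proof.
move=> L0; have := floor_itv (r / L + 2^-1); rewrite /node intrD.
move: (Num.floor _)%:~R => k /andP[k1 k2].
have h1 := ler_wpM2l (ltW L0) k1; have h2 := ler_wpM2l (ltW L0) (ltW k2).
have e : L * (r / L + 2^-1) = r + L / 2 by field; rewrite gt_eqF.
rewrite e in h1 h2; rewrite ler_norml; apply/andP; split; lra.
Qed.

Lemma node_cell L r (k : int) : 0 < L -> L * (k%:~R - 2^-1) <= r < L * (k%:~R + 2^-1) ->
  node L r = L * k%:~R.
Proof.
move=> L0 /andP[r1 r2]; rewrite /node; congr (_ * _%:~R); apply: floor_def.
rewrite intrD /= -(ler_pM2l L0) -(ltr_pM2l L0).
have -> : L * (r / L + 2^-1) = r + L / 2 by field; rewrite gt_eqF.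
apply/andP; split; lra.
Qed.

Lemma measurable_node L : 0 < L -> measurable_fun setT (node L).
Proof.
move=> L0; apply: measurable_funM => //; apply: nondecreasing_measurable => // s t st.
by rewrite ler_int; apply: le_floor; rewrite lerD2r ler_pM2r ?invr_gt0.
Qed.

Lemma norm_sin_node L r : 0 < L -> `|r - node L r| <= 2 * L / pi * `|sin (pi * r / L)|.
Proof.
move=> L0; have p0 := pi_gt0 R; have nd := node_dist r L0.
have E : pi * r / L = pi * (r - node L r) / L + (Num.floor (r / L + 2^-1))%:~R * pi.
  by rewrite /node; field; rewrite gt_eqF.
rewrite E norm_sinD_zpi; set u := r - node L r in nd *.
have pl : 0 < pi / L by rewrite divr_gt0.
have nu : `|pi * u / L| = pi / L * `|u|.
  by rewrite mulrAC normrM (gtr0_norm pl).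
have h : `|pi * u / L| <= pi / 2.
  have := ler_wpM2l (ltW pl) nd; rewrite nu.
  by have -> : pi / L * (L / 2) = pi / 2 by field; rewrite gt_eqF.
have := norm_sin_ge h; rewrite nu => h'.
have lp : 0 <= 2 * L / pi by rewrite divr_ge0 ?mulr_ge0// ltW.
have := ler_wpM2l lp h'.
have key (p v : R) : 0 < p -> 2 * L / p * (p / L * v / 2) = v.
  by move=> q0; field; rewrite (gt_eqF q0) (gt_eqF L0).
by rewrite (key _ _ p0).
Qed.

Lemma Rintg_itv_FTC h F a b : a < b -> continuous h ->
  (forall t, is_derive t (1 : R) F (h t)) ->
  mu.-integrable `[a, b[ (EFin \o h) /\ \int[mu]_(t in `[a, b[) h t = F b - F a.
Proof.
move=> ab ch dF; have cF := is_derive_continuous dF.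
have i1 : mu.-integrable `[a, b] (EFin \o h).
  apply: continuous_compact_integrable; first exact: segment_compact.
  exact: continuous_subspaceT.
have i2 : mu.-integrable `[a, b[ (EFin \o h).
  by apply: integrableS i1 => //; exact: subset_itv_co_cc.
split=> //; rewrite Rintegral_itv_bndo_bndc// /Rintegral (@continuous_FTC2 R h F a b ab)//.
- exact: continuous_subspaceT.
- split => [t _||].
  + by have [] := dF t.
  + exact: cvg_at_right_filter (cF a).
  + exact: cvg_at_left_filter (cF b).
- by move=> t _; rewrite (is_derive_derive1 dF).
Qed.

Lemma Rintg_cell L f h F (k : int) : 0 < L -> continuous h ->
  (forall t, is_derive t (1 : R) F (h t)) ->
  \int[mu]_(t in `[L * (k%:~R - 2^-1), L * (k%:~R + 2^-1)[) (f (node L t) * h t) =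
  f (L * k%:~R) * (F (L * (k%:~R + 2^-1)) - F (L * (k%:~R - 2^-1))).
Proof.
move=> L0 ch dF.
have ab : L * (k%:~R - 2^-1) < L * (k%:~R + 2^-1) by rewrite ltr_pM2l//; lra.
have [ih <-] := Rintg_itv_FTC ab ch dF.
rewrite -RintegralZl//; apply: eq_Rintegral => t; rewrite inE /= in_itv /= => tk.
by rewrite (node_cell L0 tk).
Qed.

Lemma Rintg_itv_cat f a b c : intg f -> a <= b -> b <= c ->
  \int[mu]_(t in `[a, c[) f t = \int[mu]_(t in `[a, b[) f t + \int[mu]_(t in `[b, c[) f t.
Proof.
move=> fi ab bc.
rewrite (@itv_bndbnd_setU _ _ _ (BLeft b)) ?bnd_simp// Rintegral_setU//=.
- by apply: integrableS fi => //; exact: measurableU.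
- apply/disj_setPS => t [/=]; rewrite 2!in_itv/= => /andP[_ tb] /andP[bt _].
  by move: (lt_le_trans tb bt); rewrite ltxx.
Qed.

Definition cells L M : set R := `[- (L * (M%:R + 2^-1)), L * (M%:R + 2^-1)[%classic.

Lemma cvg_cells L f : 0 < L -> intg f ->
  \int[mu]_(t in cells L M) f t @[M --> \oo] --> \int[mu]_t f t.
Proof.
move=> L0 fi.
have mc M : measurable (cells L M) by exact: measurable_itv.
have b M t : `|(f \_ (cells L M)) t| <= `|f t|.
  by rewrite patchE; case: ifPn => // _; rewrite normr0.
have c t : (f \_ (cells L M)) t @[M --> \oo] --> f t.
  apply: cvg_near_cst.
  near=> M; rewrite patchE; case: ifPn => // /negP; case; rewrite inE /cells /= in_itv /=.
  have hM : `|t| / L <= M%:R.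
    by near: M; exact: nbhs_infty_ger.
  rewrite ler_pdivrMr// in hM.
  have := ler_norm t; have := ler_norm (- t); rewrite normrN => h1 h2.
  apply/andP; split; nra.
have m M : measurable_fun setT (f \_ (cells L M)).
  apply/(measurable_restrictT _ (mc M)); apply: measurable_funTS; exact: intg_meas fi.
have [_] := Rdct m c b (intg_norm fi).
by under eq_fun do rewrite -Rintegral_mkcond.
Unshelve. all: by end_near.
Qed.

Lemma Rintg_cells L f h F M : 0 < L -> continuous h -> intg (fun t => f (node L t) * h t) ->
  (forall t, is_derive t (1 : R) F (h t)) ->
  \int[mu]_(t in cells L M) (f (node L t) * h t) =
  f 0 * (F (L * 2^-1) - F (L * - 2^-1)) +
  \sum_(k < M) (f (L * k.+1%:R) * (F (L * (k.+1%:R + 2^-1)) - F (L * (k.+1%:R - 2^-1))) +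
    f (- (L * k.+1%:R)) * (F (L * (- k.+1%:R + 2^-1)) - F (L * (- k.+1%:R - 2^-1)))).
Proof.
move=> L0 ch ig dF; elim: M => [|M IH].
  rewrite big_ord0 addr0.
  have := Rintg_cell f 0 L0 ch dF; rewrite mulr0 /= !add0r => <-.
  by rewrite /cells add0r mulrN.
have p0 := mulr_ge0 (ltW L0) (ler0n R M).
have l2 : 0 < L * 2^-1 by rewrite mulr_gt0// invr_gt0.
have zN : (- M.+1%:Z)%:~R = - M.+1%:R :> R by rewrite rmorphN.
have zP : M.+1%:Z%:~R = M.+1%:R :> R by [].
have A := Rintg_cell f (- M.+1%:Z) L0 ch dF; have B := Rintg_cell f M.+1%:Z L0 ch dF.
rewrite !zN in A; rewrite !zP in B.
rewrite big_ord_recr /= addrA -IH /cells.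
have m1 : M.+1%:R = M%:R + 1 :> R by rewrite -natr1.
have e1 : - (L * (M.+1%:R + 2^-1)) = L * (- M.+1%:R - 2^-1) by ring.
have e2 : - (L * (M%:R + 2^-1)) = L * (- M.+1%:R + 2^-1) by rewrite m1; field.
have e3 : L * (M%:R + 2^-1) = L * (M.+1%:R - 2^-1) by rewrite m1; field.
rewrite mulrN in A; rewrite e1 e2 e3 -A -B.
have M0 := ler0n R M.
rewrite (@Rintg_itv_cat _ _ (L * (- M.+1%:R + 2^-1)))//; last 2 first.
- by rewrite ler_pM2l//; lra.
- by rewrite ler_pM2l// m1; lra.
rewrite (@Rintg_itv_cat _ _ (L * (M.+1%:R - 2^-1)))//; last 2 first.
- by rewrite ler_pM2l// m1; lra.
- by rewrite ler_pM2l//; lra.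
by rewrite [LHS]addrC -addrA.
Qed.

Lemma intg_node L f C d h : 0 < L -> 0 < d -> continuous f -> continuous h ->
  (forall t, `|h t| <= 1) -> (forall s, `|f s| <= C * expR (- (d * `|s|))) ->
  intg (fun t => f (node L t) * h t).
Proof.
move=> L0 d0 cf ch bh bf.
have C0 : 0 <= C.
  by have := bf 0; rewrite normr0 mulr0 oppr0 expR0 mulr1; apply: le_trans.
apply: (intg_le _ _ (intgZ (C * expR (d * (L / 2))) (intg_expabs d0))).
  apply: measurable_funM; last exact: continuous_measurable_fun.
  exact: (measurableT_comp (continuous_measurable_fun cf) (measurable_node L0)).
move=> t; rewrite normrM; apply: (@le_trans _ _ `|f (node L t)|); first by rewrite ler_piMr.
apply: le_trans (bf _) _; rewrite -mulrA -expRD; apply: ler_wpM2l => //; rewrite ler_expR.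
have nd := node_dist t L0; have := ler_normD (t - node L t) (node L t); rewrite subrK => h1.
have := ler_wpM2l (ltW d0) h1; have := ler_wpM2l (ltW d0) nd; lra.
Qed.

Lemma Rintg_node_cos L f C d n : 0 < L -> 0 < d -> continuous f ->
  (forall s, `|f s| <= C * expR (- (d * `|s|))) ->
  \int[mu]_t (f (node L t) * cos (2 * pi * n.+1%:R / L * t)) = 0.
Proof.
move=> L0 d0 cf bf; set w := 2 * pi * n.+1%:R / L.
have w0 : 0 < w by rewrite divr_gt0// mulr_gt0// mulr_gt0// pi_gt0.
have cc := @continuous_cosM R w.
have ig := intg_node L0 d0 cf cc (fun t => norm_cos_le1 _) bf.
pose F t := w^-1 * sin (w * t).
have dF t : is_derive t (1 : R) F (cos (w * t)).
  have d1 : is_derive t (1 : R) (fun t => w * t) w.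
    by apply: is_derive_eq; rewrite /GRing.scale /= mulr1.
  have d2 : is_derive t (1 : R) (fun t => sin (w * t)) (cos (w * t) * w).
    exact: (@is_derive1_comp _ (@sin R) (fun t : R => w * t) _ _ _ (is_derive_sin _) d1).
  rewrite /F; apply: is_derive_eq; rewrite /GRing.scale /=; field; by rewrite gt_eqF.
have per u : F (L * (u + 2^-1)) = F (L * (u - 2^-1)).
  rewrite /F; congr (_ * _).
  have -> : w * (L * (u + 2^-1)) = w * (L * (u - 2^-1)) + 2 * pi * n.+1%:R.
    rewrite /w; move: (pi : R) n.+1%:R => p q; field; by rewrite gt_eqF.
  by rewrite sinD cos_2npi sin_2npi mulr1 mulr0 addr0.
have E M : \int[mu]_(t in cells L M) (f (node L t) * cos (w * t)) = 0.
  rewrite (Rintg_cells M L0 cc ig dF).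
  have := per 0; rewrite !add0r => ->; rewrite subrr mulr0 add0r.
  by apply: big1 => k _; rewrite !per !subrr !mulr0 addr0.
have h1 := cvg_cells L0 ig.
have h2 : (fun M => \int[mu]_(t in cells L M) (f (node L t) * cos (w * t))) @ \oo --> (0 : R).
  by rewrite (funext E); exact: cvg_cst.
exact: (cvg_unique _ h1 h2).
Qed.

Lemma cvg_node_sum L f C d : 0 < L -> 0 < d -> continuous f -> (forall r, f (- r) = f r) ->
  (forall s, `|f s| <= C * expR (- (d * `|s|))) ->
  L * (f 0 + 2 * \sum_(k < M) f (L * k.+1%:R)) @[M --> \oo] --> \int[mu]_t f (node L t).
Proof.
move=> L0 d0 cf ef bf.
have cc : continuous (fun _ : R => 1 : R) by move=> t; exact: cvg_cst.
have ig := intg_node L0 d0 cf cc (fun t => ltac:(by rewrite normr1)) bf.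
have dF t : is_derive t (1 : R) id 1 by exact: is_derive_id.
have h1 := cvg_cells L0 ig.
rewrite (eq_Rintg (fun t => mulr1 (f (node L t)))) in h1.
rewrite (_ : (fun M => _) = (fun M => \int[mu]_(t in cells L M) (f (node L t) * 1)))//.
apply/funext => M; rewrite (Rintg_cells M L0 cc ig dF) /=.
have E k : f (L * k.+1%:R) * (L * (k.+1%:R + 2^-1) - L * (k.+1%:R - 2^-1)) +
    f (- (L * k.+1%:R)) * (L * (- k.+1%:R + 2^-1) - L * (- k.+1%:R - 2^-1)) = 2 * L * f (L * k.+1%:R).
  by rewrite ef; field.
under [X in _ = _ + X]eq_bigr do rewrite E.
by rewrite -mulr_sumr; field.
Qed.

Lemma cvg_inv_sqr_series K a : 0 < a -> 0 <= K ->
  cvgn (series (fun n => K * (1 + (a * n.+1%:R) ^+ 2)^-1)).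
Proof.
move=> a0 K0.
pose u n : R := harmonic n - harmonic n.+1.
have uE n : u n = (n.+1%:R * n.+2%:R)^-1.
  have n1 : 0 < n.+1%:R :> R by rewrite ltr0n.
  rewrite /u /= -[n.+2%:R]natr1; field; rewrite gt_eqF//= gt_eqF// ltr_wpDr//.
have u0 n : 0 <= u n by rewrite uE invr_ge0 mulr_ge0.
have su n : series u n = 1 - harmonic n.
  rewrite /series /=; elim: n => [|n IH]; first by rewrite big_geq// invr1 subrr.
  by rewrite big_nat_recr//= IH /u /=; ring.
have cu : cvgn (series u).
  rewrite (funext su); apply: is_cvgB; first exact: is_cvg_cst.
  by apply/cvg_ex; exists 0; exact: cvg_harmonic.
pose Q := K * (2 / a ^+ 2).
apply: (@series_le_cvg R _ (fun n => Q * u n)).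
- by move=> n; rewrite mulr_ge0// oneDsqrV_ge0.
- by move=> n; rewrite mulr_ge0// mulr_ge0// divr_ge0// sqr_ge0.
- move=> n; rewrite /Q -mulrA; apply: ler_wpM2l => //; rewrite uE.
  have n1 : 0 < n.+1%:R :> R by rewrite ltr0n.
  have n1' : 1 <= n.+1%:R :> R by rewrite ler1n.
  have n2 : n.+2%:R = n.+1%:R + 1 :> R by rewrite natr1.
  rewrite n2; move: (n.+1%:R : R) n1 n1' => q q0 q1.
  have a2 : 0 < a ^+ 2 by rewrite exprn_gt0.
  have d1 : 0 < 1 + (a * q) ^+ 2 by rewrite ltr_wpDr ?sqr_ge0.
  have d2 : 0 < q * (q + 1) by rewrite mulr_gt0// ltr_wpDr.
  rewrite -[leLHS]mul1r ler_pdivrMr// mulrAC ler_pdivlMr// mul1r.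
  rewrite -ler_pdivrMl ?divr_gt0// invf_div.
  have q2 : q * (q + 1) <= 2 * q ^+ 2 by rewrite expr2; nra.
  have := ler_wpM2l (ltW a2) q2; rewrite exprMn; lra.
have -> : series (fun n => Q * u n) = (fun n => Q * series u n).
  by apply/funext => n; rewrite /series /= mulr_sumr.
by apply: is_cvgM; [exact: is_cvg_cst|exact: cu].
Qed.

Lemma cvgn_shift1_sum (u : nat -> R) : cvgn (series (fun n => u n.+1)) ->
  (fun N => \sum_(1 <= n < N) u n) @ \oo --> limn (series (fun n => u n.+1)).
Proof.
move=> cu; rewrite -(cvg_shiftS (fun N => \sum_(1 <= n < N) u n)).
rewrite (_ : (fun n => _) = series (fun n => u n.+1))//.
by apply/funext => N; rewrite /series /= big_add1.
Qed.

Lemma Rintg_sum (u : nat -> R -> R) n : (forall k, intg (u k)) ->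
  intg (fun r => \sum_(k < n) u k r) /\
  \int[mu]_r (\sum_(k < n) u k r) = \sum_(k < n) \int[mu]_r u k r.
Proof.
move=> ui; elim: n => [|n [IH1 IH2]].
  have E r : 0 = \sum_(k < 0) u k r by rewrite big_ord0.
  by rewrite big_ord0 -(funext E) Rintegral_cst// mul0r; split=> //; exact: integrable0.
have E r : \sum_(k < n) u k r + u n r = \sum_(k < n.+1) u k r by rewrite big_ord_recr.
by rewrite big_ord_recr /= -(funext E); split; [exact: intgD|rewrite RintgD// IH2].
Qed.

(* The partial sums of the left side are integrals of f against Dirichlet
   kernels, and their means converge by Cesaro.  Replacing f by the step function
   f (node L r) makes the means equal to the right side for every N; the error
   vanishes since |f r - f (node L r)| = O(|sin (pi r / L)|) cancels the
   singularities of the Fejer kernel. *)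
Lemma poisson_summation f L C C' d K : 0 < L -> 0 < d -> continuous f ->
  (forall r, f (- r) = f r) ->
  (forall s, `|f s| <= C * expR (- (d * `|s|))) ->
  (forall r s, `|r - s| <= L -> `|f r - f s| <= C' * `|r - s| * expR (- (d * `|r|))) ->
  (forall t, `|\int[mu]_s (cos (t * s) * f s)| <= K * (1 + t ^+ 2)^-1) ->
  let fh t := \int[mu]_s (cos (t * s) * f s) in
  exists S1 S2 : R, [/\ (fun N => \sum_(1 <= n < N) fh (2 * pi / L * n%:R)) @ \oo --> S1,
    (fun N => \sum_(1 <= n < N) f (L * n%:R)) @ \oo --> S2 &
    fh 0 + 2 * S1 = L * (f 0 + 2 * S2)].
Proof.
move=> L0 d0 cf ef bf lf bK fh.
have C0 : 0 <= C.
  by have := bf 0; rewrite normr0 mulr0 oppr0 expR0 mulr1; apply: le_trans.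
have C'0 : 0 <= C'.
  have := lf 0 L; rewrite sub0r normrN normr0 mulr0 oppr0 expR0 mulr1 (gtr0_norm L0) => /(_ (lexx _)) h.
  by have := le_trans (normr_ge0 _) h; rewrite pmulr_lge0.
have K0 : 0 <= K.
  by have := bK 0; rewrite expr0n addr0 invr1 mulr1; apply: le_trans.
have fi := intg_decay d0 (continuous_measurable_fun cf) bf.
pose a := 2 * pi / L; have a0 : 0 < a by rewrite divr_gt0// mulr_gt0// pi_gt0.
have c1 : cvgn (series (fun n => fh (a * n.+1%:R))).
  apply: normed_cvg; apply: (@series_le_cvg R _ (fun n => K * (1 + (a * n.+1%:R) ^+ 2)^-1)) => //.
  - by move=> n /=; exact: normr_ge0.
  - by move=> n; rewrite mulr_ge0// oneDsqrV_ge0.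
  - by move=> n; exact: bK.
  - exact: cvg_inv_sqr_series.
have hS1 := @cvgn_shift1_sum (fun n => fh (a * n%:R)) c1.
set S1 := limn _ in hS1.
have {}c1 : series (fun n => fh (a * n.+1%:R)) @ \oo --> S1 := c1.
have gi : intg (fun t => f (node L t)).
  have cc : continuous (fun _ : R => 1 : R) by move=> t; exact: cvg_cst.
  have := intg_node L0 d0 cf cc (fun t => ltac:(by rewrite normr1)) bf.
  by apply: eq_intg => t; rewrite mulr1.
have hn := cvg_node_sum L0 d0 cf ef bf.
set I := \int[mu]_t f (node L t) in hn.
pose S2 := (I / L - f 0) / 2.
have hS2 : series (fun n => f (L * n.+1%:R)) @ \oo --> S2.
  rewrite (_ : series _ = (fun M => (L * (f 0 + 2 * \sum_(k < M) f (L * k.+1%:R)) / L - f 0) / 2)).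
    apply: cvgM; last exact: cvg_cst.
    apply: cvgB; last exact: cvg_cst.
    by apply: cvgM; [exact: hn|exact: cvg_cst].
  apply/funext => M; rewrite /series /= big_mkord; field; by rewrite gt_eqF.
have c2 : cvgn (series (fun n => f (L * n.+1%:R))) by apply/cvg_ex; exists S2.
have hS2' := @cvgn_shift1_sum (fun n => f (L * n%:R)) c2; rewrite (cvg_lim _ hS2)// in hS2'.
exists S1, S2; split => //.
have -> : L * (f 0 + 2 * S2) = I by rewrite /S2; field; rewrite gt_eqF.
pose S (m : nat) := fh 0 + 2 * \sum_(k < m) fh (a * k.+1%:R).
have hS : S @ \oo --> fh 0 + 2 * S1.
  apply: cvgD; first exact: cvg_cst.
  apply: cvgM; first exact: cvg_cst.
  rewrite (_ : (fun m => _) = series (fun n => fh (a * n.+1%:R)))//.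
  by apply/funext => m; rewrite /series /= big_mkord.
have hA := cesaro hS.
pose D (m : nat) r := dirichlet (pi * r / L) m.
have DE m r : D m r = 1 + 2 * \sum_(k < m) cos (a * k.+1%:R * r).
  rewrite /D /dirichlet; congr (1 + 2 * _); apply: eq_bigr => k _; congr cos.
  by rewrite /a; ring.
have cosI (g : R -> R) k : intg g -> intg (fun r => g r * cos (a * k.+1%:R * r)).
  move=> ig; apply: (intg_le _ _ (intg_norm ig)).
    apply: measurable_funM; first exact: intg_meas ig.
    by apply: continuous_measurable_fun; exact: continuous_cosM.
  by move=> r; rewrite normrM ler_piMr// norm_cos_le1.
have sumI (g : R -> R) m : intg g ->
    intg (fun r => D m r * g r) /\ \int[mu]_r (D m r * g r) =
      \int[mu]_r g r + 2 * \sum_(k < m) \int[mu]_r (g r * cos (a * k.+1%:R * r)).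
  move=> ig; have [s1 s2] := Rintg_sum m (fun k => cosI g k ig).
  have E r : g r + 2 * \sum_(k < m) (g r * cos (a * k.+1%:R * r)) = D m r * g r.
    by rewrite DE -mulr_sumr; ring.
  rewrite -(funext E) -s2 -RintgZ//; split; first by apply: intgD => //; exact: intgZ.
  by rewrite RintgD//; exact: intgZ.
have fejI (g : R -> R) N : intg g ->
    intg (fun r => fejer (pi * r / L) N * g r) /\ \int[mu]_r (fejer (pi * r / L) N * g r) =
      N.+1%:R^-1 * \sum_(m < N.+1) \int[mu]_r (D m r * g r).
  move=> ig; have [s1 s2] := Rintg_sum N.+1 (fun m => (sumI g m ig).1).
  have E r : N.+1%:R^-1 * \sum_(m < N.+1) (D m r * g r) = fejer (pi * r / L) N * g r.
    by rewrite -mulr_suml; exact: mulrA.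
  by rewrite -(funext E) -s2 -RintgZ//; split=> //; exact: intgZ.
have Eg N : \int[mu]_r (fejer (pi * r / L) N * f (node L r)) = I.
  rewrite (fejI _ N gi).2.
  have E m : \int[mu]_r (D m r * f (node L r)) = I.
    rewrite (sumI _ m gi).2 big1 ?mulr0 ?addr0// => k _.
    have := Rintg_node_cos k L0 d0 cf bf; congr (_ = _); apply: eq_Rintg => r.
    by congr (_ * cos (_ * r)); rewrite /a; ring.
  under eq_bigr do rewrite E.
  by rewrite sumr_const card_ord -[I *+ _]mulr_natl mulKf// pnatr_eq0.
have Ef N : \int[mu]_r (fejer (pi * r / L) N * f r) = arithmetic_mean S N.
  rewrite (fejI _ N fi).2 /arithmetic_mean /series /= big_mkord; congr (_ * _); apply: eq_bigr => m _.
  rewrite (sumI _ m fi).2 /S /fh; congr (_ + 2 * _).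
    by apply: eq_Rintg => r; rewrite mul0r cos0 mul1r.
  by apply: eq_bigr => k _; apply: eq_Rintg => r; rewrite mulrC.
have dif N : \int[mu]_r (fejer (pi * r / L) N * (f r - f (node L r))) = arithmetic_mean S N - I.
  rewrite -Ef -(Eg N) -RintgB; [|exact: (fejI _ N fi).1|exact: (fejI _ N gi).1].
  by apply: eq_Rintg => r; rewrite mulrBr.
pose q := 2 * L / pi; have q0 : 0 < q by rewrite divr_gt0 ?pi_gt0// mulr_gt0.
have bd r : `|f r - f (node L r)| <= C' * q * expR (- (d * `|r|)) * `|sin (pi * r / L)|.
  have nd := node_dist r L0; have ns := norm_sin_node r L0.
  apply: le_trans (lf r (node L r) _) _; first by lra.
  have := ler_wpM2l C'0 ns; move=> /(ler_wpM2r (expR_ge0 (- (d * `|r|)))).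
  by move=> h; apply: le_trans h _; apply: le_of_eq; rewrite /q; ring.
have k0 r : 0 <= C' * q * expR (- (d * `|r|)).
  by apply: mulr_ge0; [apply: mulr_ge0 => //; exact: ltW|exact: expR_ge0].
have bF0 N r : `|fejer (pi * r / L) N * (f r - f (node L r))| <=
    C' * q * expR (- (d * `|r|)) * `|fejer (pi * r / L) N * sin (pi * r / L)|.
  rewrite !normrM [leRHS]mulrCA; apply: ler_wpM2l => //.
have bF N r : `|fejer (pi * r / L) N * (f r - f (node L r))| <= C' * q * expR (- (d * `|r|)).
  by apply: le_trans (bF0 N r) _; rewrite ler_piMr// fejer_le1.
have cF r : fejer (pi * r / L) N * (f r - f (node L r)) @[N --> \oo] --> (0 : R).
  set k := C' * q * expR (- (d * `|r|)) in bF0 k0.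
  have l : k * `|fejer (pi * r / L) N * sin (pi * r / L)| @[N --> \oo] --> (0 : R).
    rewrite -(mulr0 k) -(normr0 R); apply: cvgM; first exact: cvg_cst.
    by apply: cvg_norm; exact: fejer_cvg0.
  apply: (@squeeze_cvgr _ _ _ _ (fun N => - (k * `|fejer (pi * r / L) N * sin (pi * r / L)|))
     (fun N => k * `|fejer (pi * r / L) N * sin (pi * r / L)|)) => //.
    by apply: nearW => N; rewrite -ler_norml; exact: bF0.
  by rewrite -oppr0; exact: cvgN.
have mF N : measurable_fun setT (fun r => fejer (pi * r / L) N * (f r - f (node L r))).
  exact: intg_meas (fejI _ N (intgB fi gi)).1.
have [_ L1] := Rdct mF cF bF (intgZ _ (intg_expabs d0)).
rewrite (funext dif) in L1.
have L2 : arithmetic_mean S N - I @[N --> \oo] --> fh 0 + 2 * S1 - I by apply: cvgB; [exact: hA|exact: cvg_cst].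
have e : \int[mu]_(_ in setT) (0 : R) = fh 0 + 2 * S1 - I by exact: (cvg_unique _ L1 L2).
by apply/eqP; rewrite -subr_eq0 -e Rintegral_cst// mul0r.
Qed.

End poisson.

Section closed_forms.
Context {R : realType}.
Notation mu := (@lebesgue_measure R).
Implicit Types (x m r t : R).

Definition Dconst m x : R :=
  expR (- ((m + 2^-1) * ln 2)) * expR (- x / 2) / rGamma (1 - 2 * m).

Lemma rGamma_half_gt0 m : m < 2^-1 -> 0 < rGamma (1 - 2 * m).
Proof. by move=> m2; apply: rGamma_gt0; lra. Qed.

Lemma Gamma_half m : m < 2^-1 -> Gamma (1 - 2 * m)%:C = (rGamma (1 - 2 * m))%:C.
Proof. by move=> m2; apply: Gamma_real; lra. Qed.

Lemma parabolicD_Dconst m x r : m < 2^-1 -> 0 < x ->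
  (expR (x * sinh (r / 2) ^+ 2 / 2))%:C
    * parabolicD (2 * m - 1)%:C (Num.sqrt (2 * x) * cosh (r / 2)) =
  (Dconst m x * Gk (2^-1 - m) x r)%:C.
Proof.
move=> m2 x0; have g0 := rGamma_half_gt0 m2.
have G0 : (rGamma (1 - 2 * m))%:C != 0 :> R[i] by rewrite rc_neq0 gt_eqF.
apply: (mulfI G0); rewrite -{1}Gamma_half// parabolicD_Gk// -rcM /Dconst; congr _%:C.
by field; rewrite gt_eqF.
Qed.

Lemma parabolicD_Dconst0 m x : m < 2^-1 -> 0 < x ->
  parabolicD (2 * m - 1)%:C (Num.sqrt (2 * x)) = (Dconst m x * Gk (2^-1 - m) x 0)%:C.
Proof.
move=> m2 x0; rewrite -parabolicD_Dconst//.
have -> : sinh (0 / 2 : R) = 0 by rewrite /sinh mul0r oppr0 subrr mul0r.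
have -> : cosh (0 / 2 : R) = 1.
  by rewrite /cosh mul0r oppr0 expR0 -[1 + 1]/(2%:R) mulfV ?pnatr_eq0.
by rewrite expr0n mulr0 mul0r expR0 mul1r mulr1.
Qed.

Lemma powR2_Dconst m x : m < 2^-1 ->
  2 `^ (m + 2^-1) * (rGamma (1 - 2 * m) * Dconst m x) = expR (- x / 2).
Proof.
move=> m2; have g0 := rGamma_half_gt0 m2.
rewrite /Dconst /powR pnatr_eq0 /=; move: (rGamma _) g0 => g g0.
rewrite (_ : expR ((m + 2^-1) * ln 2) * _ = expR ((m + 2^-1) * ln 2) * expR (- ((m + 2^-1) * ln 2)) * expR (- x / 2)).
  by rewrite -expRD subrr expR0 mul1r.
by field; rewrite gt_eqF.
Qed.

Lemma cos_transform_even (f : R -> R) t :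
  \int[mu]_s (cos (- t * s) * f s) = \int[mu]_s (cos (t * s) * f s).
Proof. by apply: eq_Rintg => s; rewrite mulNr cosN. Qed.

Lemma ccvg_real (u : nat -> R) (l : R) : u n @[n --> \oo] --> l ->
  cvgn (fun n => (u n)%:C : R[i]^o) /\ limn (fun n => (u n)%:C : R[i]^o) = l%:C.
Proof.
move=> h; have c : ccvg (fun n => (u n)%:C) l%:C by exact: cvgC_real.
split; first by apply/cvg_ex; exists (l%:C : R[i]^o); exact: c.
exact: (ccvg_lim c).
Qed.

End closed_forms.

Theorem corollary3p8 (R : realType) (x alpha mu : R)
    (x_gt0 : 0 < x) (alpha_gt0 : 0 < alpha) (mu_lt : mu < 2^-1) :
  let lhs_term (n : nat) : R[i]^o :=
    `|Gamma ((2^-1 - mu) +i* (alpha * n%:R))| ^+ 2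
    * whittakerW mu%:C (0 +i* (alpha * n%:R)) x in
  let rhs_term (n : nat) : R[i]^o :=
    (expR (x * sinh (pi * n%:R / alpha) ^+ 2 / 2))%:C
    * parabolicD (2 * mu - 1)%:C
        (Num.sqrt (2 * x) * cosh (pi * n%:R / alpha)) in
  [/\ [/\ cvgn (fun N => \sum_(1 <= n < N) lhs_term n),
          cvgn (fun N => \sum_(1 <= n < N) rhs_term n) &
          Gamma (2^-1 - mu)%:C ^+ 2 * whittakerW mu%:C 0 x
          + 2 * limn (fun N => \sum_(1 <= n < N) lhs_term n)
          = (pi * 2 `^ (mu + 2^-1) * Num.sqrt x / alpha)%:C
            * Gamma (1 - 2 * mu)%:C
            * (parabolicD (2 * mu - 1)%:C (Num.sqrt (2 * x))
               + 2 * limn (fun N => \sum_(1 <= n < N) rhs_term n))],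
      forall xi : R,
        let f (tau : R) : R[i] :=
          `|Gamma ((2^-1 - mu) +i* tau)| ^+ 2
          * whittakerW mu%:C (0 +i* tau) x * cexp (0 +i* (- (tau * xi))) in
        cintegrable setT f /\
        cintegral setT f
        = (pi * 2 `^ (mu + 2^-1) * Num.sqrt x)%:C * Gamma (1 - 2 * mu)%:C
          * (expR (x * sinh (xi / 2) ^+ 2 / 2))%:C
          * parabolicD (2 * mu - 1)%:C (Num.sqrt (2 * x) * cosh (xi / 2)) &
      forall tau : R,
        let g (xi : R) : R[i] :=
          (expR (x * sinh (xi / 2) ^+ 2 / 2))%:C
          * parabolicD (2 * mu - 1)%:C (Num.sqrt (2 * x) * cosh (xi / 2))
          * cexp (0 +i* (tau * xi)) in
        cintegrable setT g /\
        `|Gamma ((2^-1 - mu) +i* tau)| ^+ 2 * whittakerW mu%:C (0 +i* tau) x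
        = (2 `^ (mu - 2^-1) * Num.sqrt x)%:C * Gamma (1 - 2 * mu)%:C
          * cintegral setT g].
Proof.
move=> lhs_term rhs_term.
set al := 2^-1 - mu; have al0 : 0 < al by rewrite /al; lra.
pose f := Gk al x.
pose fh t := \int[lebesgue_measure]_s (cos (t * s) * f s).
have cf : continuous f := continuous_Gk al0 x_gt0.
have ef : forall r, f (- r) = f r := Gk_even al x.
have fi : intg f := intg_Gk al0 x_gt0.
have [C C0 bf] := Gk_le al0 x_gt0.
have [K bK] := Gk_transform_le al0 x_gt0.
have d0 : 0 < al / 2 by rewrite divr_gt0.
have cfh : continuous fh := continuous_cos_transform d0 cf bf.
pose c := expR (- x / 2) * Num.sqrt x / 2.
have W tau : `|Gamma (al +i* tau)| ^+ 2 * whittakerW mu%:C (0 +i* tau) x = (c * fh tau)%:C.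
  exact: whittaker_Gk.
have P2 := powR2_Dconst x mu_lt; have GE := Gamma_half mu_lt.
have PD r := parabolicD_Dconst r mu_lt x_gt0.
set k := Dconst mu x in P2 PD; set g0 := rGamma (1 - 2 * mu) in P2 GE.
split.
- pose L := 2 * pi / alpha; have L0 : 0 < L by rewrite divr_gt0// mulr_gt0// pi_gt0.
  have [C' _ lf] := Gk_lipschitz al0 x_gt0 L0.
  have [S1 [S2 [h1 h2 h3]]] := poisson_summation L0 d0 cf ef bf lf bK.
  have Lal : 2 * pi / L = alpha.
    by rewrite /L invf_div mulrC divfK// gt_eqF// mulr_gt0// pi_gt0.
  rewrite Lal in h1.
  have E1 N : \sum_(1 <= n < N) lhs_term n = (c * \sum_(1 <= n < N) fh (alpha * n%:R))%:C.
    by rewrite mulr_sumr rmorph_sum; apply: eq_bigr => n _; exact: W.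
  have E2 N : \sum_(1 <= n < N) rhs_term n = (k * \sum_(1 <= n < N) f (L * n%:R))%:C.
    rewrite mulr_sumr rmorph_sum; apply: eq_bigr => n _; rewrite /rhs_term.
    have -> : pi * n%:R / alpha = L * n%:R / 2 by rewrite /L; field; rewrite gt_eqF.
    exact: PD.
  have [v1 l1] := ccvg_real (cvgM (cvg_cst c) h1).
  have [v2 l2] := ccvg_real (cvgM (cvg_cst k) h2).
  rewrite (funext E1) (funext E2); split; [exact: v1|exact: v2|].
  rewrite l1 l2 GE parabolicD_Dconst0// -/k -/al -/f.
  have W0 := W 0.
  have -> : Gamma al%:C ^+ 2 * whittakerW mu%:C 0 x = (c * fh 0)%:C.
    rewrite -W0 sqr_normc Gamma_real// conjc_real; reflexivity.
  have D2 (u v w : R) : (w * u)%:C + 2 * (w * v)%:C = (w * (u + 2 * v))%:C.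
    by rewrite mulrDr rcD mulrCA (rcM 2) rc_nat.
  have {}h3 : fh 0 + 2 * S1 = L * (f 0 + 2 * S2) := h3.
  rewrite !D2 h3 -!rcM; congr _%:C.
  rewrite /c -P2 /L; move: (f 0 + 2 * S2) (pi : R) => A p.
  by field; rewrite gt_eqF.
- move=> xi F.
  have FE tau : F tau = cexp (iR (- xi * tau)) * (c * fh tau)%:C.
    by rewrite /F W mulrC; congr (cexp _ * _); rewrite /iR mulNr (mulrC xi).
  have [ih ii] := fourier_inversion xi d0 cf ef bf bK.
  have i1 : intg (fun tau => c * fh tau).
    apply: intgZ; apply: intg_le (intgZ K (Rintg_oneDsqr (R := R)).1); last exact: bK.
    exact: continuous_measurable_fun.
  have ce : continuous (fun tau => c * fh tau).
    by move=> t; apply: cvgM; [exact: cvg_cst|exact: cfh].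
  have efh tau : fh (- tau) = fh tau.
    exact: cos_transform_even.
  have ee tau : c * fh (- tau) = c * fh tau by rewrite efh.
  have [j1 j2] := cint_even (- xi) ce ee i1.
  rewrite (funext FE); split; first exact: j1.
  rewrite -/(cint _) j2.
  have -> : \int[lebesgue_measure]_r (cos (- xi * r) * (c * fh r)) = c * (2 * pi * f xi).
    have E r : cos (- xi * r) * (c * fh r) = c * (cos (r * xi) * fh r).
      by rewrite (mulNr xi r) cosN (mulrC xi r) mulrCA.
    by rewrite (eq_Rintg E) (RintgZ c ih) ii.
  rewrite -[RHS]mulrA PD GE -!rcM; congr _%:C.
  by rewrite /c -P2 -/f; move: (pi : R) => p; field.
- move=> tau G.
  have GE' xi : G xi = cexp (iR (tau * xi)) * (k * f xi)%:C.
    by rewrite /G PD mulrC.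
  have i1 : intg (fun r => k * f r) by exact: intgZ.
  have ce : continuous (fun r => k * f r).
    by move=> t; apply: cvgM; [exact: cvg_cst|exact: cf].
  have ee r : k * f (- r) = k * f r by rewrite ef.
  have [j1 j2] := cint_even tau ce ee i1.
  rewrite (funext GE') W; split; first exact: j1.
  rewrite -/(cint _) j2 GE -!rcM; congr _%:C.
  have -> : \int[lebesgue_measure]_r (cos (tau * r) * (k * f r)) = k * fh tau.
    rewrite /fh -RintgZ; last exact: intg_bounded_cos.
    by apply: eq_Rintg => r; rewrite mulrCA.
  have -> : 2 `^ (mu - 2^-1) = 2 `^ (mu + 2^-1) / 2 :> R.
    rewrite /powR pnatr_eq0 /= -[X in _ = _ / X](lnK (_ : 2 \is Num.pos)) ?posrE//.
    by rewrite -expRN -expRD; congr expR; field.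
  by rewrite /c -P2; field.
Qed.
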